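(* In the Heisenberg group $\mathbb H^1$ with coordinates $g=(x,y,\sigma)$, let $f(x,y,\sigma)=x+6y\sigma-x^3$, which is harmonic, i.e. $\Delta_Hf=0$. Then there exists $r_0>0$ such that the frequency $$N(f,r)=\frac{r\int_{B_r}|\nabla_Hf|^2\,dg}{\int_{S_r}f^2\,|\nabla_H\rho|\,d\sigma_H}$$ is nonincreasing for $r\in(0,r_0)$.
   Context: $\mathbb H^1$ is $\mathbb R^3$ with coordinates $(x,y,\sigma)$ and the group law for which the left-invariant horizontal vector fields are $X_1=\partial_x-\frac y2\partial_\sigma$, $X_2=\partial_y+\frac x2\partial_\sigma$. Set $|\nabla_Hu|^2=(X_1u)^2+(X_2u)^2$ and $\Delta_H=X_1^2+X_2^2$. $dg$ is Lebesgue measure; the homogeneous dimension is $Q=4$. Let $\tilde\Gamma(g)$ be the unique positive fundamental solution of $-\Delta_H$ with pole at the identity $0$ which vanishes at infinity; it is homogeneous of degree $2-Q=-2$ under the dilations $(x,y,\sigma)\mapsto(\lambda x,\lambda y,\lambda^2\sigma)$. The pseudo-gauge is $\rho(g)=\tilde\Gamma(g)^{-1/(Q-2)}$; $B_r=\{\rho<r\}$ and $S_r=\partial B_r$. $d\sigma_H=\frac{|\nabla_H\rho|}{|\nabla\rho|}\,dH_2$ is the horizontal perimeter measure on $S_r$, where $H_2$ is the Euclidean 2-dimensional Hausdorff measure and $\nabla$ the Euclidean gradient. *)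

(* Defs.v *)
From HB Require Import structures.
From mathcomp Require Import all_boot all_order all_algebra.
From mathcomp Require Import all_classical all_reals all_analysis.

Set Implicit Arguments.
Unset Strict Implicit.
Unset Printing Implicit Defensive.

Import Order.TTheory GRing.Theory Num.Def Num.Theory.
Import numFieldNormedType.Exports.

Local Open Scope classical_set_scope.
Local Open Scope ring_scope.

(* The point (x, y, sigma) of H^1 is the triple with
   x = g.1.1, y = g.1.2, sigma = g.2. The norm of R * R * R as a normed module
   is the sup norm, so the Euclidean metric is introduced separately. *)
Notation heis R := (R * R * R)%type.

Section heisenberg.
Variable R : realType.
Implicit Types (u f rho Gam phi : heis R -> R) (g p q : heis R) (A U : set (heis R)).

Definition d_x u g : R := 'D_(1, 0, 0) u g.
Definition d_y u g : R := 'D_(0, 1, 0) u g.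
Definition d_s u g : R := 'D_(0, 0, 1) u g.

Definition X1 u g : R := d_x u g - g.1.2 / 2 * d_s u g.
Definition X2 u g : R := d_y u g + g.1.1 / 2 * d_s u g.

Definition horizontal_grad_norm u g : R := sqrtr (X1 u g ^+ 2 + X2 u g ^+ 2).
Definition grad_norm u g : R :=
  sqrtr (d_x u g ^+ 2 + d_y u g ^+ 2 + d_s u g ^+ 2).
Definition sublaplacian u g : R := X1 (X1 u) g + X2 (X2 u) g.

Definition leb3 : {measure set (measurableTypeR R * measurableTypeR R *
                                measurableTypeR R)%type -> \bar R} :=
  ((@lebesgue_measure R \x @lebesgue_measure R) \x @lebesgue_measure R)%E.

(* C^oo: all iterated directional derivatives are differentiable everywhere. *)
Definition smooth phi : Prop :=
  forall (vs : seq (heis R)) g, differentiable (foldr (fun v u => 'D_v u) phi vs) g.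

Definition test_function phi : Prop :=
  smooth phi /\ compact (closure [set g | phi g != 0]).

(* The identity of H^1 is 0. The distribution - sublaplacian Gam = delta_0 is
   tested against C_c^oo; sublaplacian is formally self-adjoint and Lebesgue
   measure is Haar measure. The value Gam 0 carries no information: it stands
   for the value +oo at the pole. *)
Record positive_fundamental_solution Gam : Prop := {
  fs_continuous : forall g, g != 0 -> {for g, continuous Gam} ;
  fs_positive : forall g, g != 0 -> 0 < Gam g ;
  fs_locally_integrable : forall K : set (heis R), compact K ->
    leb3.-integrable K (EFin \o Gam) ;
  fs_delta : forall phi, test_function phi ->
    \int[leb3]_g (Gam g * - sublaplacian phi g) = phi 0 ;
  fs_vanishes_at_infinity : forall e : R, 0 < e ->
    \forall M \near +oo, forall g, M < `|g| -> `|Gam g| < e }.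

Definition homogeneous_dim : nat := 4.

(* rho = Gam^(-1/(Q-2)), with rho(0) = (+oo)^(-1/(Q-2)) = 0 at the pole. *)
Definition pseudo_gauge Gam g : R :=
  if g == 0 then 0 else Gam g `^ (- ((homogeneous_dim - 2)%:R)^-1).

Definition gauge_ball rho (r : R) : set (heis R) := [set g | rho g < r].
Definition gauge_sphere rho (r : R) : set (heis R) :=
  closure (gauge_ball rho r) `\` (gauge_ball rho r)°.

Local Open Scope ereal_scope.

Definition euclidean_dist p q : R :=
  Num.sqrt ((p.1.1 - q.1.1) ^+ 2 + (p.1.2 - q.1.2) ^+ 2 + (p.2 - q.2) ^+ 2)%R.

(* 0 is adjoined so that the empty set has diameter 0. *)
Definition diam U : \bar R :=
  ereal_sup (0 |` [set x | exists p q, [/\ U p, U q & x = (euclidean_dist p q)%:E]]).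

Definition delta_cover (delta : R) A : set ((set (heis R))^nat) :=
  [set U | (forall k, diam (U k) <= delta%:E) /\ A `<=` \bigcup_k U k].

(* pi / 4 is the area of the disc of diameter 1. *)
Definition disc_area U : \bar R := (pi / 4)%:E * diam U ^+ 2.

Definition hausdorff2_delta (delta : R) A : \bar R :=
  ereal_inf [set \sum_(k <oo) disc_area (U k) | U in delta_cover delta A].

Definition hausdorff2 A : \bar R :=
  ereal_sup [set hausdorff2_delta delta A | delta in [set delta : R | (0 < delta)%R]].

Lemma diam_ge0 U : 0 <= diam U.
Proof. by apply: ereal_sup_ubound; left. Qed.

Lemma disc_area_ge0 U : 0 <= disc_area U.
Proof.
apply: mule_ge0; last by rewrite expe2 mule_ge0// diam_ge0.
by rewrite lee_fin divr_ge0// pi_ge0.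
Qed.

Lemma diam0 : diam set0 = 0.
Proof.
rewrite /diam; rewrite (_ : [set x | _] = set0) ?setU0 ?ereal_sup1//.
by apply/seteqP; split => x //= [p [q []]].
Qed.

Lemma hausdorff2_delta_ge0 d A : 0 <= hausdorff2_delta d A.
Proof.
apply: le_ereal_inf_tmp => _ [U _ <-].
by apply: nneseries_ge0 => *; exact: disc_area_ge0.
Qed.

Lemma hausdorff2_ge0 A : 0 <= hausdorff2 A.
Proof.
apply: le_trans (hausdorff2_delta_ge0 1%R A) _.
by apply: ereal_sup_ubound; exists 1%R => //=.
Qed.

Lemma hausdorff2_set0 : hausdorff2 set0 = 0.
Proof.
apply/eqP; rewrite eq_le hausdorff2_ge0 andbT.
apply: ge_ereal_sup => _ [d /= d0 <-].
apply: ereal_inf_lbound; exists (fun=> set0).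
  by split => // k; rewrite diam0 lee_fin ltW.
by rewrite eseries0// => k _ _; rewrite /disc_area diam0 expe2 mule0 mule0.
Qed.

Lemma le_hausdorff2 : {homo hausdorff2 : A B / A `<=` B >-> A <= B}.
Proof.
move=> A B AB; apply: ge_ereal_sup => _ [d /= d0 <-].
apply: (@le_trans _ _ (hausdorff2_delta d B)).
  apply: ereal_inf_le_tmp => x [U [dU BU] <-].
  by exists U => //; split => //; exact: subset_trans AB BU.
by apply: ereal_sup_ubound; exists d.
Qed.

Lemma hausdorff2_delta_sigma_subadditive d : sigma_subadditive (hausdorff2_delta d).
Proof.
move=> A; have [[i ioo]|] := pselect (exists i, hausdorff2_delta d (A i) = +oo).
  rewrite (eseries_pinfty _ _ ioo) ?leey// => n _.
  by rewrite -ltNye (lt_le_trans _ (hausdorff2_delta_ge0 _ _)).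
rewrite -forallNE => Aoo.
apply/lee_addgt0Pr => _/posnumP[e].
rewrite (le_trans _ (epsilon_trick _ _ _))//; last first.
  by move=> n; exact: hausdorff2_delta_ge0.
pose P n (B : (set (heis R))^nat) := delta_cover d (A n) B /\
  \sum_(k <oo) disc_area (B k) <= hausdorff2_delta d (A n) + (e%:num / (2 ^ n.+1)%:R)%:E.
have [G PG] : {G : ((set (heis R))^nat)^nat & forall n, P n (G n)}.
  apply: (@choice _ _ P) => n; rewrite /P.
  have fA : hausdorff2_delta d (A n) \is a fin_num.
    by rewrite ge0_fin_numE ?hausdorff2_delta_ge0// ltey; apply/eqP/Aoo.
  have en1 : (0 < e%:num / (2 ^ n.+1)%:R)%R by [].
  have [x [B AnB muBx] xS] := lb_ereal_inf_adherent en1 fA.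
  by exists B; split => //; rewrite muBx; exact/ltW.
apply: (@le_trans _ _ (\esum_(i in setT) (disc_area \o uncurry G) i)).
  apply: ereal_inf_lbound => /=.
  have /card_esym/ppcard_eqP[f] := card_nat2.
  exists (uncurry G \o f).
    split => [i|].
      by rewrite /=; case: (f i) => a b; exact: (PG a).1.1.
    move=> t [i _ /((PG i).1.2)[j _ Bijt]]; exists (f^-1%FUN (i, j)) => //=.
    by rewrite invK ?inE.
  rewrite -(esum_pred_image (disc_area \o uncurry G) _ xpredT) ?[fun=> _]set_true//.
    by rewrite image_eq.
  by move=> *; exact: disc_area_ge0.
rewrite (_ : esum _ _ = \sum_(i <oo) \sum_(j <oo ) disc_area (G i j)); last first.
  pose J : nat -> set (nat * nat) := fun i => [set (i, j) | j in setT].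
  rewrite (_ : setT = \bigcup_k J k); last first.
    by rewrite predeqE => -[a b]; split => // _; exists a => //; exists b.
  rewrite esum_bigcupT /=; last 2 first.
    - apply/trivIsetP => i j _ _ ij.
      rewrite predeqE => -[n m] /=; split => //= -[] [_] _ [<-{n} _].
      by move=> [m' _] [] /esym/eqP; rewrite (negbTE ij).
    - by move=> /= [n m]; exact: disc_area_ge0.
  rewrite -(image_id [set: nat]) -fun_true esum_pred_image//; last first.
    by move=> n _; apply: esum_ge0 => *; exact: disc_area_ge0.
  apply: eq_eseriesr => /= j _.
  rewrite -(esum_pred_image (disc_area \o uncurry G) (pair j) predT)//=.
  - by congr esum; rewrite predeqE => -[a b]; split; move=> [i _ <-]; exists i.
  - by move=> *; exact: disc_area_ge0.
  - by move=> ? ? _ _; exact: (@can_inj _ _ _ snd).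
apply: lee_nneseries => [n _ _|n _].
  by apply: nneseries_ge0 => *; exact: disc_area_ge0.
exact: (PG n).2.
Qed.

Lemma hausdorff2_sigma_subadditive : sigma_subadditive hausdorff2.
Proof.
move=> A; apply: ge_ereal_sup => _ [d /= d0 <-].
apply: le_trans (hausdorff2_delta_sigma_subadditive d A) _.
apply: lee_nneseries => [n _ _|n _]; first exact: hausdorff2_delta_ge0.
by apply: ereal_sup_ubound; exists d.
Qed.

HB.instance Definition _ := isOuterMeasure.Build R (heis R) hausdorff2
  hausdorff2_set0 hausdorff2_ge0 le_hausdorff2 hausdorff2_sigma_subadditive.

Definition hausdorff2_outer : {outer_measure set (heis R) -> \bar R} := hausdorff2.

(* H2 lives on the Caratheodory sigma-algebra, which contains the Borel sets. *)
Definition H2 : {measure set (caratheodory_type hausdorff2_outer) -> \bar R} :=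
  hausdorff2_outer : set (caratheodory_type hausdorff2_outer) -> \bar R.

Local Close Scope ereal_scope.

(* The integral of h against the horizontal perimeter measure
   d sigma_H = |grad_H rho| / |grad rho| dH_2 on the sphere of radius r. *)
Definition perimeter_integral rho (r : R) (h : heis R -> R) : R :=
  \int[H2]_(g in gauge_sphere rho r)
    (h g * (horizontal_grad_norm rho g / grad_norm rho g)).

Definition frequency rho f (r : R) : R :=
  (r * \int[leb3]_(g in gauge_ball rho r) (horizontal_grad_norm f g ^+ 2)) /
  perimeter_integral rho r (fun g => f g ^+ 2 * horizontal_grad_norm rho g).

End heisenberg.

(* Main.v *)
Require Import Defs.
From HB Require Import structures.
From mathcomp Require Import all_boot all_order all_algebra.
From mathcomp Require Import all_classical all_reals all_analysis.
From mathcomp Require Import ring lra measurable_realfun.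

(** Write [N^4 = |z|^4 + 16 sigma^2]. Testing the fundamental solution against
    [exp_bump (N^4 c) N^-2], regularised at the pole and left translated to
    [h], produces an average of [Gam] near [h] plus an error which vanishes as
    [c -> 0], because [Gam] vanishes at infinity. The total weight of the average
    does not depend on [h], so [Gam = C N^-2] and the pseudo-gauge is a multiple
    of [N]; no uniqueness theorem is needed.

    On the sphere [N = tau] the horizontal perimeter weight only depends on
    [sigma]. Short strips of the sphere are almost isometric to strips of a
    cylinder, so integrals of functions of [sigma] against this weight are
    multiples of Lebesgue integrals in [sigma]; averaging over rotations about
    the [sigma]-axis reduces [f^2] to such a function. By homogeneity, with
    [t = tau^2] and [W_n] the integral of [(1 - 16 u^2)^(n/2)] over [16 u^2 < 1],
    the frequency is a nonnegative multiple of
      [(W_1 - 3 W_2 t + O(t^2)) / (W_1 / 2 - 3/4 W_2 t + O(t^2))],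
    whose derivative at [0] has the sign of [- 3/4 W_1 W_2 < 0]. *)

Set Implicit Arguments.
Unset Strict Implicit.
Unset Printing Implicit Defensive.

Import Order.TTheory GRing.Theory Num.Def Num.Theory.
Import numFieldNormedType.Exports.

Local Open Scope classical_set_scope.
Local Open Scope ring_scope.

(** * Affine changes of variables *)

Section lebesgue_affine.
Variable R : realType.
Local Notation leb := (@lebesgue_measure R).
Local Open Scope ereal_scope.

(** The drop comes from a failure of orthogonality. [f] is the sum of the homogeneous harmonic
    polynomials [x] and [6 y sigma - x^3], of degrees 1 and 3. Euclidean harmonics of different
    degrees are orthogonal on spheres; here the mean of [2 x (6 y sigma - x^3)] over a circle of
    squared radius [w] is [- 3/4 w^2], so the mixed term is negative. Relative to the boundary
    integral, the energy weights it by the mean degree 2 and the leading term by 1, so near 0 the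
    frequency behaves like [(1 - 2 k t) / (1 - k t)] with [k > 0]. Two obstacles shape the rest.
    [Gam] comes without derivatives, so all of them fall on a test function whose sublaplacian is
    known in closed form. And [H2] is defined by coverings, so surface integrals are reached through
    Lipschitz comparison with cylinders rather than through a parametrisation. The areas of the unit
    disc and of the unit cylinder stay unevaluated: they only contribute a common factor to the
    frequency. *)

Lemma measurable_affine (c d : R) :
  measurable_fun [set: measurableTypeR R]
    (fun x : measurableTypeR R => (c * x + d)%R : measurableTypeR R).
Proof. by apply: measurable_funD => //; apply: measurable_funM. Qed.

(** Lebesgue measure is determined by its values on half-open intervals, where both sides are
    explicit. *)
Lemma lebesgue_measure_affine (c d : R) (A : set (measurableTypeR R)) : (0 < c)%R -> measurable A ->
  leb A = c%:E * pushforward leb (fun x : measurableTypeR R => (c * x + d)%R : measurableTypeR R) A.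
Proof.
move=> c0 mA.
pose cn : {nonneg R} := NngNum (ltW c0).
pose phi (x : measurableTypeR R) : measurableTypeR R := (c * x + d)%R.
have mphi := measurable_affine c d.
pose m0 : {measure set _ -> \bar R} := measure_function_pushforward__canonical__measure_function_Measure leb mphi.
pose m : {measure set _ -> \bar R} := mscale cn m0.
apply: (lebesgue_measure_unique (mu := m)) => //= _ [[a b] _ <-] /=.
rewrite /m /mscale /m0/= /pushforward/=.
have -> : phi @^-1` `]a, b] = [set` `]((a - d) / c)%R, ((b - d) / c)%R]].
  apply/seteqP; split => x; rewrite /= !in_itv/= /phi ltr_pdivrMr// ler_pdivlMr//;
  by rewrite (mulrC x) ltrBlDr lerBrDr.
rewrite !lebesgue_measure_itv/= !lte_fin.
have -> : ((a - d) / c < (b - d) / c)%R = (a < b)%R.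
  by rewrite ltr_pM2r ?invr_gt0// ltrD2r.
case: ifPn => _; last by rewrite mule0.
rewrite -!EFinD -EFinM; congr (_%:E); field; exact: lt0r_neq0.
Qed.

Lemma ge0_integral_affine (c d : R) (f : measurableTypeR R -> \bar R) : (0 < c)%R ->
  measurable_fun setT f -> (forall x, 0 <= f x) ->
  \int[leb]_x f x = c%:E * \int[leb]_x f (c * x + d)%R.
Proof.
move=> c0 mf f0.
pose cn : {nonneg R} := NngNum (ltW c0).
pose phi (x : measurableTypeR R) : measurableTypeR R := (c * x + d)%R.
have mphi := measurable_affine c d.
pose m0 : {measure set _ -> \bar R} := measure_function_pushforward__canonical__measure_function_Measure leb mphi.
pose m : {measure set _ -> \bar R} := mscale cn m0.
rewrite (eq_measure_integral m); last first.
  by move=> A mA _; exact: lebesgue_measure_affine.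
rewrite ge0_integral_mscale//=; congr (_ * _).
by rewrite ge0_integral_pushforward.
Qed.

Local Notation T2 := (measurableTypeR R * measurableTypeR R)%type.
Local Notation T3 := (measurableTypeR R * measurableTypeR R * measurableTypeR R)%type.

Lemma ge0_integral_leb2 (f : T2 -> \bar R) :
  measurable_fun setT f -> (forall g, 0 <= f g) ->
  \int[leb \x leb]_g f g = \int[leb]_x \int[leb]_y f (x, y).
Proof. by move=> mf f0; rewrite (fubini_tonelli1 f). Qed.

(* The library's own sigma-finite instance of [\x] is shadowed by the one for
   subprobabilities, so the product is packed under a name. *)
Definition leb2 : set T2 -> \bar R := leb \x leb.
HB.instance Definition _ := Measure.on leb2.

Let leb2_sigma_finite : sigma_finite setT leb2.
Proof.
have /sigma_finiteP[F [TF ndF Foo]] := @sigma_finiteT _ _ _ leb.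
exists (fun n => F n `*` F n).
  apply/seteqP; split => // -[x y] _.
  have [[n _ Fnx] [k _ Fky]] : (\bigcup_k F k) x /\ (\bigcup_k F k) y by rewrite -TF.
  exists (maxn n k) => //; split => /=.
  - by move: x Fnx; exact/subsetPset/ndF/leq_maxl.
  - by move: y Fky; exact/subsetPset/ndF/leq_maxr.
move=> k; have [mF Fk] := Foo k; split; first exact: measurableX.
by rewrite [leb2 _]product_measure1E// lte_mul_pinfty// ge0_fin_numE.
Qed.
HB.instance Definition _ := Measure_isSigmaFinite.Build _ _ _ leb2 leb2_sigma_finite.

Let fubini_leb3 (f : T3 -> \bar R) :
  measurable_fun setT f -> (forall g, 0 <= f g) ->
  \int[@leb3 R]_g f g = \int[leb2]_p \int[leb]_s f (p, s).
Proof. by move=> mf f0; exact: (@fubini_tonelli1 _ _ _ _ R leb2 leb f mf f0). Qed.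

(** A common form for the dilations of the group, with [m = 0], and its left translations, with
    [a = b = c = 1] and [m] affine in the planar point. *)
Definition shear (a b c p q : R) (m : T2 -> measurableTypeR R) (g : T3) : T3 :=
  ((a * g.1.1 + p)%R, (b * g.1.2 + q)%R, (c * g.2 + m g.1)%R).

Lemma measurable_shear a b c p q m : measurable_fun setT m ->
  measurable_fun setT (shear a b c p q m).
Proof.
move=> mm; apply/measurable_fun_pair => /=; first apply/measurable_fun_pair => /=.
- apply: (measurableT_comp (measurable_affine a p)).
  exact: measurableT_comp.
- apply: (measurableT_comp (measurable_affine b q)).
  exact: measurableT_comp.
- apply: measurable_funD; first by apply: measurable_funM => //.
  exact: measurableT_comp.
Qed.

Lemma ge0_integral_shear2 (a b p q : R) (f : T2 -> \bar R) :
  (0 < a)%R -> (0 < b)%R -> measurable_fun setT f -> (forall g, 0 <= f g) ->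
  \int[leb \x leb]_g f g = (a * b)%:E * \int[leb \x leb]_g f ((a * g.1 + p)%R, (b * g.2 + q)%R).
Proof.
move=> a0 b0 mf f0; rewrite !ge0_integral_leb2//; last first.
  apply: measurableT_comp => //.
  apply/measurable_fun_pair => /=.
    by apply: (measurableT_comp (measurable_affine a p)).
  by apply: (measurableT_comp (measurable_affine b q)).
rewrite (@ge0_integral_affine a p)//; last 2 first.
- exact: measurable_fun_fubini_tonelli_F.
- by move=> x; apply: integral_ge0.
rewrite EFinM -muleA; congr (_ * _).
rewrite -ge0_integralZl//; last 3 first.
- apply: (@measurable_fun_fubini_tonelli_F _ _ _ _ _ _ (fun g : T2 => f ((a * g.1 + p)%R, (b * g.2 + q)%R))) => //.
  apply: measurableT_comp => //.
  apply/measurable_fun_pair => /=.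
    by apply: (measurableT_comp (measurable_affine a p)).
  by apply: (measurableT_comp (measurable_affine b q)).
- by move=> x _; apply: integral_ge0.
- by rewrite lee_fin ltW.
apply: eq_integral => x _.
rewrite (@ge0_integral_affine b q)//.
by apply: measurableT_comp => //; exact: measurable_pair1.
Qed.

(** For a fixed planar point the map is affine in the last coordinate, whatever [m] is; Tonelli
    reduces the rest to the planar case. *)
Lemma ge0_integral_shear (a b c p q : R) m (f : T3 -> \bar R) :
  (0 < a)%R -> (0 < b)%R -> (0 < c)%R -> measurable_fun setT m ->
  measurable_fun setT f -> (forall g, 0 <= f g) ->
  \int[@leb3 R]_g f g = (a * b * c)%:E * \int[@leb3 R]_g f (shear a b c p q m g).
Proof.
move=> a0 b0 c0 mm mf f0.
rewrite fubini_leb3// (fubini_leb3 (f := f \o shear a b c p q m)); [|by apply: measurableT_comp => //; exact: measurable_shear|by move=> g /=].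
rewrite -[LHS]/(\int[leb \x leb]_g fubini_F leb f g) (@ge0_integral_shear2 a b p q)//; last 2 first.
- exact: (@measurable_fun_fubini_tonelli_F _ _ _ _ _ leb f).
- by move=> x; apply: integral_ge0.
rewrite [in RHS]EFinM -muleA; congr (_ * _).
rewrite -ge0_integralZl//; last 3 first.
- apply: (@measurable_fun_fubini_tonelli_F _ _ _ _ _ _ (f \o shear a b c p q m)); last by move=> x /=.
  by apply: measurableT_comp => //; exact: measurable_shear.
- by move=> x _; apply: integral_ge0 => y _ /=.
- by rewrite lee_fin ltW.
apply: eq_integral => x _.
rewrite /fubini_F (@ge0_integral_affine c (m x) (fun s => f ((a * x.1 + p)%R, (b * x.2 + q)%R, s)))//.
by apply: measurableT_comp => //; exact: measurable_pair1.
Qed.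

Lemma leb3_shear (a b c p q : R) m A : (0 < a)%R -> (0 < b)%R -> (0 < c)%R ->
  measurable_fun setT m -> measurable A ->
  @leb3 R A = (a * b * c)%:E * @leb3 R (shear a b c p q m @^-1` A).
Proof.
move=> a0 b0 c0 mm mA.
have mS : measurable (shear a b c p q m @^-1` A).
  by rewrite -[_ @^-1` _]setTI; apply: (measurable_shear a b c p q mm).
rewrite -[in LHS](setIT A) -integral_indic// (@ge0_integral_shear a b c p q m)//.
  congr (_ * _); rewrite -[in RHS](setIT (_ @^-1` _)) -integral_indic//.
exact/measurable_EFinP.
Qed.

End lebesgue_affine.

(** * Two-dimensional Hausdorff measure *)

Section hausdorff.
Variable R : realType.
Implicit Types (p q g h : heis R) (A B U X : set (heis R)).

(** Comparing squares keeps the Lipschitz conditions below polynomial. *)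
Definition sqdist p q : R := (p.1.1 - q.1.1) ^+ 2 + (p.1.2 - q.1.2) ^+ 2 + (p.2 - q.2) ^+ 2.

Lemma sqdist_ge0 p q : 0 <= sqdist p q.
Proof. by rewrite !addr_ge0 ?sqr_ge0. Qed.

Local Open Scope ereal_scope.

Lemma diam_le U (d : R) : (0 <= d)%R ->
  (forall p q, U p -> U q -> (sqdist p q <= d ^+ 2)%R) -> diam U <= d%:E.
Proof.
move=> d0 Ud; apply: ge_ereal_sup => x [->|[p [q [Up Uq ->]]]]; rewrite lee_fin//.
by rewrite -[leRHS](ger0_norm d0) -sqrtr_sqr ler_wsqrtr// Ud.
Qed.

Lemma sqdist_le_diam U p q (d : R) : diam U <= d%:E -> U p -> U q ->
  (sqdist p q <= d ^+ 2)%R.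
Proof.
move=> Ud Up Uq.
have : (euclidean_dist p q)%:E <= d%:E.
  by apply: le_trans Ud; apply: ereal_sup_ubound; right; exists p, q.
rewrite lee_fin /euclidean_dist -/(sqdist p q) => pqd.
rewrite -[leLHS](sqr_sqrtr (sqdist_ge0 p q)) ler_pXn2r ?nnegrE ?sqrtr_ge0//.
by rewrite (le_trans _ pqd)// sqrtr_ge0.
Qed.

Lemma diam_fin_num U (d : R) : diam U <= d%:E -> diam U \is a fin_num.
Proof. by move=> Ud; rewrite ge0_fin_numE ?diam_ge0// (le_lt_trans Ud)// ltry. Qed.

(** [K] bounds squared distances, so two-dimensional areas scale by [K] itself and diameters by its
    square root. The covering sets are cut down to [A], since [T] is controlled only there. *)
Lemma hausdorff2_delta_lipschitz (T : heis R -> heis R) A (K d : R) : (0 < K)%R -> (0 < d)%R ->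
  {in A &, forall p q, sqdist (T p) (T q) <= K * sqdist p q}%R ->
  hausdorff2_delta d (T @` A) <= K%:E * hausdorff2_delta (d / Num.sqrt K)%R A.
Proof.
move=> K0 d0 TK; have sK0 : (0 < Num.sqrt K)%R by rewrite sqrtr_gt0.
rewrite muleC -lee_pdivrMr//; apply: le_ereal_inf_tmp => _ [U [dU AU] <-].
rewrite lee_pdivrMr// muleC -nneseriesZl//; last first.
  by move=> i _; exact: disc_area_ge0.
have dV k : diam (T @` (U k `&` A)) <= (Num.sqrt K)%:E * diam (U k).
  have Uk := diam_fin_num (dU k).
  rewrite -(fineK Uk) -EFinM; apply: diam_le.
    by rewrite mulr_ge0 ?fine_ge0 ?diam_ge0// sqrtr_ge0.
  move=> _ _ [p [Up Ap] <-] [q [Uq Aq] <-].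
  apply: le_trans (TK _ _ _ _) _; rewrite ?inE//.
  rewrite exprMn (sqr_sqrtr (ltW K0)) ler_pM2l//.
  by apply: (@sqdist_le_diam (U k)) => //; rewrite fineK.
apply: (@le_trans _ _ (\sum_(k <oo) disc_area (T @` (U k `&` A)))).
  apply: ereal_inf_lbound; exists (fun k => T @` (U k `&` A)) => //; split.
    move=> k; apply: (le_trans (dV k)).
    rewrite (_ : d = Num.sqrt K * (d / Num.sqrt K))%R; last first.
      by rewrite mulrCA divff ?mulr1// gt_eqF.
    by rewrite EFinM lee_pmul2l.
  move=> _ [p Ap <-]; have [k _ Ukp] := AU _ Ap.
  by exists k => //; exists p.
apply: lee_nneseries => [k _ _|k _]; first exact: disc_area_ge0.
rewrite /disc_area [leRHS]muleCA; apply: lee_wpmul2l; first by rewrite lee_fin divr_ge0// pi_ge0.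
rewrite -[in leRHS](sqr_sqrtr (ltW K0)) expr2 EFinM !expe2 muleACA.
by rewrite lee_pmul// diam_ge0.
Qed.

Lemma hausdorff2_lipschitz (T : heis R -> heis R) A (K : R) : (0 < K)%R ->
  {in A &, forall p q, sqdist (T p) (T q) <= K * sqdist p q}%R ->
  hausdorff2 (T @` A) <= K%:E * hausdorff2 A.
Proof.
move=> K0 TK; apply: ge_ereal_sup => _ [d /= d0 <-].
apply: le_trans (hausdorff2_delta_lipschitz K0 d0 TK) _.
apply: lee_wpmul2l; first by rewrite lee_fin ltW.
apply: ereal_sup_ubound; exists (d / Num.sqrt K)%R => //=.
by rewrite divr_gt0// sqrtr_gt0.
Qed.

Lemma hausdorff2_delta_le (d e : R) A : (d <= e)%R ->
  hausdorff2_delta e A <= hausdorff2_delta d A.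
Proof.
move=> de; apply: ereal_inf_le_tmp => _ [U [dU AU] <-]; exists U => //; split => // k.
by apply: le_trans (dU k) _; rewrite lee_fin.
Qed.

Lemma hausdorff2_delta_le_hausdorff2 (d : R) A : (0 < d)%R ->
  hausdorff2_delta d A <= hausdorff2 A.
Proof. by move=> d0; apply: ereal_sup_ubound; exists d. Qed.

Definition contraction (f : heis R -> R) :=
  forall p q, ((f p - f q) ^+ 2 <= sqdist p q)%R.

(** A set of diameter at most [d < e] cannot meet both [A] and [B], so every cover of the union
    splits into two disjoint families. *)
Lemma hausdorff2_delta_separated (f : heis R -> R) A B (t d e : R) :
  contraction f -> (0 < d)%R -> (d < e)%R ->
  (forall p, A p -> (f p <= t)%R) -> (forall p, B p -> (t + e <= f p)%R) ->
  hausdorff2_delta d A + hausdorff2_delta d B <= hausdorff2_delta d (A `|` B).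
Proof.
move=> fc d0 de At Bt; apply: le_ereal_inf_tmp => _ [U [dU ABU] <-].
have sep k : U k `&` A = set0 \/ U k `&` B = set0.
  apply: contrapT => /not_orP[/eqP/set0P[p [Up Ap]] /eqP/set0P[q [Uq Bq]]].
  have := sqdist_le_diam (dU k) Up Uq; apply/negP; rewrite -ltNge.
  apply: lt_le_trans (fc p q).
  have := At p Ap; have := Bt q Bq => H1 H2.
  rewrite -(sqrrN (f p - f q)) opprB ltr_pXn2r ?nnegrE//; lra.
apply: (@le_trans _ _ (\sum_(k <oo) (disc_area (U k `&` A) + disc_area (U k `&` B)))).
  rewrite nneseriesD; last 2 first.
  - by move=> *; exact: disc_area_ge0.
  - by move=> *; exact: disc_area_ge0.
  have diamI k (C : set (heis R)) : diam (U k `&` C) <= d%:E.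
    by apply: diam_le; [exact: ltW|move=> p q [Up _] [Uq _]; exact: sqdist_le_diam (dU k) Up Uq].
  apply: leeD; apply: ereal_inf_lbound.
  - exists (fun k => U k `&` A) => //; split => // p Ap.
    by have [k _ Ukp] := ABU p (or_introl Ap); exists k.
  - exists (fun k => U k `&` B) => //; split => // p Ap.
    by have [k _ Ukp] := ABU p (or_intror Ap); exists k.
apply: lee_nneseries => [k _ _|k _].
  by rewrite adde_ge0// disc_area_ge0.
have H V : V `<=` U k -> disc_area V <= disc_area (U k).
  move=> VU; apply: lee_wpmul2l; first by rewrite lee_fin divr_ge0// pi_ge0.
  rewrite !expe2; apply: lee_pmul; rewrite ?diam_ge0//;
  apply: ge_ereal_sup => x [->|[p [q [Vp Vq ->]]]]; rewrite ?diam_ge0//;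
  by apply: ereal_sup_ubound; right; exists p, q; split => //; exact: VU.
have d00 : disc_area (@set0 (heis R)) = 0 by rewrite /disc_area diam0 expe2 !mule0.
case: (sep k) => ->; rewrite d00 ?add0e ?adde0; exact: H.
Qed.

(** This is the property of a metric outer measure. The suprema over scales for [A] and for [B] are
    treated one after the other, then compared at a scale below both and below [e]. *)
Lemma hausdorff2_separated (f : heis R -> R) A B (t e : R) :
  contraction f -> (0 < e)%R ->
  (forall p, A p -> (f p <= t)%R) -> (forall p, B p -> (t + e <= f p)%R) ->
  hausdorff2 A + hausdorff2 B <= hausdorff2 (A `|` B).
Proof.
move=> fc e0 At Bt.
have [->|] := eqVneq (hausdorff2 (A `|` B)) +oo; first by rewrite leey.
rewrite -ltey => ABoo.
have Bfin : hausdorff2 B \is a fin_num.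
  rewrite ge0_fin_numE ?hausdorff2_ge0// (le_lt_trans _ ABoo)//.
  by apply: le_hausdorff2; exact: subsetUr.
rewrite -leeBrDr//; apply: ge_ereal_sup => _ [d1 /= d10 <-].
have d1fin : hausdorff2_delta d1 A \is a fin_num.
  rewrite ge0_fin_numE ?hausdorff2_delta_ge0// (le_lt_trans _ ABoo)//.
  apply: le_trans (hausdorff2_delta_le_hausdorff2 A d10) _.
  by apply: le_hausdorff2; exact: subsetUl.
rewrite leeBrDr// addeC -leeBrDr//; apply: ge_ereal_sup => _ [d2 /= d20 <-].
rewrite leeBrDr//; pose d := Num.min (Num.min d1 d2) (e / 2)%R.
have d0 : (0 < d)%R by rewrite !lt_min d10 d20 divr_gt0.
have de : (d < e)%R by rewrite (@le_lt_trans _ _ (e / 2)%R)// ?ge_min ?lexx ?orbT// gtr_pMr// invf_lt1// ltr1n.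
apply: le_trans (hausdorff2_delta_le_hausdorff2 (A `|` B) d0).
apply: le_trans (hausdorff2_delta_separated fc d0 de At Bt).
by rewrite addeC; apply: leeD; apply: hausdorff2_delta_le; rewrite !ge_min lexx ?orbT.
Qed.

(** * Sublevel sets of contractions are Caratheodory measurable *)

Section level_sets.
Variables (f : heis R -> R) (t : R) (X : set (heis R)).
Hypotheses (fc : contraction f) (Xfin : hausdorff2 X < +oo).

Let a n : R := (t + n.+1%:R^-1)%R.
Let Y n := X `&` [set p | (a n <= f p)%R].
Let S n := X `&` [set p | (a n.+1 <= f p < a n)%R].

Let a_lt n : (a n.+1 < a n)%R.
Proof. by rewrite ltrD2l ltf_pV2 ?posrE// ltr_nat. Qed.

(** Consecutive shells touch, but two shells of the same parity are separated by the width of the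
    shell between them, so their measures add up. *)
Let sum_alternate_shells i m : \sum_(0 <= k < m) hausdorff2 (S (k.*2 + i).+1) <= hausdorff2 (Y (m.*2 + i)).
Proof.
elim: m => [|m IH]; first by rewrite big_geq// hausdorff2_ge0.
rewrite big_nat_recr//=; apply: le_trans (leeD2r _ IH) _.
rewrite addeC; pose n := (m.*2 + i)%N.
apply: (@le_trans _ _ (hausdorff2 (S n.+1 `|` Y n))).
  apply: (@hausdorff2_separated f _ _ (a n.+1) (a n - a n.+1)%R) => //.
  - by rewrite subr_gt0.
  - by move=> p [_ /andP[_ /ltW]].
  - by move=> p [_ /=]; rewrite addrC subrK.
apply: le_hausdorff2 => p [[Xp /andP[h _]]|[Xp /= h]]; split => //=.
by apply: le_trans h; apply/ltW/(lt_trans _ (a_lt _))/a_lt.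
Qed.

Let sum_even_odd (u : nat -> \bar R) m : \sum_(0 <= k < m.*2) u k =
  \sum_(0 <= k < m) u k.*2 + \sum_(0 <= k < m) u k.*2.+1.
Proof.
elim: m => [|m IH]; first by rewrite !big_geq// adde0.
by rewrite doubleS !big_nat_recr//= IH -!addeA; congr (_ + _); rewrite addeCA.
Qed.

Let sum_shells_fin : \sum_(0 <= k <oo) hausdorff2 (S k.+1) < +oo.
Proof.
apply: (@le_lt_trans _ _ (hausdorff2 X + hausdorff2 X)); last by rewrite lte_add_pinfty.
apply: lime_le; first by apply: is_cvg_nneseries => *; exact: hausdorff2_ge0.
near=> n.
apply: (@le_trans _ _ (\sum_(0 <= k < n.*2) hausdorff2 (S k.+1))).
  apply: lee_sum_nneg_natr => [k _ _|]; first exact: hausdorff2_ge0.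
  by rewrite -addnn leq_addr.
rewrite (sum_even_odd (fun k => hausdorff2 (S k.+1))).
apply: leeD.
  rewrite (eq_bigr (fun k => hausdorff2 (S (k.*2 + 0).+1))); last by move=> k; rewrite addn0.
  by apply: le_trans (sum_alternate_shells 0 n) _; apply: le_hausdorff2 => p [].
rewrite (eq_bigr (fun k => hausdorff2 (S (k.*2 + 1).+1))); last by move=> k; rewrite addn1.
by apply: le_trans (sum_alternate_shells 1 n) _; apply: le_hausdorff2 => p [].
Unshelve. all: by end_near. Qed.

(** [Y n] stays at positive distance from [f <= t], so additivity holds for it; what is missing from
    [f > t] is covered by the shells of index beyond [n], the tail of a convergent series. *)
Lemma hausdorff2_split_level :
  hausdorff2 (X `&` [set p | (f p <= t)%R]) + hausdorff2 (X `&` ~` [set p | (f p <= t)%R]) <= hausdorff2 X.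
Proof.
apply/lee_addgt0Pr => e e0.
have [n tail_n] : exists n, \sum_(n <= k <oo) hausdorff2 (S k.+1) <= e%:E.
  have := @nneseries_tail_cvg R (fun k => hausdorff2 (S k.+1)) xpredT sum_shells_fin.
  move=> /(_ (fun=> fun=> hausdorff2_ge0 _)).
  move=> /fine_cvgP[tfin /cvgrPdist_le/(_ e e0) tlim].
  near \oo => n; exists n.
  have nf : \sum_(n <= k <oo) hausdorff2 (S k.+1) \is a fin_num by near: n.
  have : (`|0 - fine (\sum_(n <= k <oo) hausdorff2 (S k.+1))| <= e)%R by near: n.
  rewrite sub0r normrN ger0_norm; last by rewrite fine_ge0// nneseries_ge0// => *; exact: hausdorff2_ge0.
  by rewrite -lee_fin fineK.
have cover : X `&` ~` [set p | (f p <= t)%R] `<=` Y n.+1 `|` \bigcup_(k in ~` `I_n) S k.+1.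
  move=> p [Xp /= /negP]; rewrite -ltNge => tp.
  have [anp|anp] := leP (a n.+1) (f p); [by left|right].
  have [N aN] : exists N, (a N <= f p)%R.
    have fpt : (0 < f p - t)%R by rewrite subr_gt0.
    exists (Num.truncn (f p - t)^-1); rewrite /a -lerBrDl -[leRHS]invrK lef_pV2 ?posrE// ?invr_gt0//.
    by apply/ltW; exact: truncnS_gt.
  have exN : exists N, (a N <= f p)%R by exists N.
  (* Minimality of [m] places the point in the shell between the levels [a m] and [a (m - 1)]. *)
  case: (ex_minnP exN) => m am mmin.
  have nm : (n.+1 < m)%N.
    rewrite ltnNge; apply/negP => mn; move: anp; rewrite ltNge => /negP; apply.
    by apply: le_trans am; rewrite lerD2l lef_pV2 ?posrE// ler_nat.
  case: m am mmin nm => // m; case: m => // m am mmin nm.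
  exists m; rewrite /= -?leqNgt; first by apply/negP; rewrite -leqNgt; exact: nm.
  split => //=; rewrite am/= ltNge; apply/negP => /mmin; by rewrite ltnn.
apply: (@le_trans _ _ (hausdorff2 (X `&` [set p | (f p <= t)%R]) + (hausdorff2 (Y n.+1) + e%:E))).
  apply: leeD => //; apply: le_trans (le_hausdorff2 cover) _.
  apply: le_trans (outer_measureU2 (@hausdorff2_outer R) _ _) _; apply: leeD => //.
  by apply: le_trans tail_n; exact: (outer_measure_sigma_subadditive_tail (@hausdorff2_outer R)).
rewrite addeA; apply: leeD => //.
apply: (@le_trans _ _ (hausdorff2 ((X `&` [set p | (f p <= t)%R]) `|` Y n.+1))).
  apply: (@hausdorff2_separated f _ _ t n.+2%:R^-1) => //.
  - by move=> p [].
  - by move=> p [].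
by apply: le_hausdorff2 => p [] [].
Unshelve. all: by end_near. Qed.

End level_sets.

Lemma caratheodory_level (f : heis R -> R) (t : R) : contraction f ->
  (@hausdorff2_outer R).-caratheodory [set p | (f p <= t)%R].
Proof.
move=> fc; apply: le_caratheodory_measurable => X.
have [Xoo|Xoo] := ltP (hausdorff2 X) +oo; first exact: hausdorff2_split_level.
by apply: le_trans Xoo; rewrite leey.
Qed.

Local Notation Tc := (caratheodory_type (@hausdorff2_outer R)).

Lemma measurable_contraction (f : heis R -> R) : contraction f ->
  measurable_fun [set: Tc] (f : Tc -> R).
Proof.
move=> fc; apply: (measurability _ (RGenOInfty.measurableE R)).
move=> _ [_ [x ->] <-]; rewrite setTI.
have -> : f @^-1` `]x, +oo[ = ~` [set p | (f p <= x)%R].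
  by apply/seteqP; split => p /=; rewrite in_itv/= andbT; [move=> /lt_geF -> //|move=> /negP; rewrite -ltNge].
by apply: (@measurableC _ Tc); exact: caratheodory_level.
Qed.

(** The hypothesis makes [T] injective on [A], and its inverse on the image has squared Lipschitz
    constant [K]; [S] is that inverse. *)
Lemma hausdorff2_colipschitz (T : heis R -> heis R) A (K : R) : (0 < K)%R ->
  {in A &, forall p q, sqdist p q <= K * sqdist (T p) (T q)}%R ->
  hausdorff2 A <= K%:E * hausdorff2 (T @` A).
Proof.
move=> K0 TK.
pose S y := xget 0%R [set p | A p /\ T p = y].
have SP y : (T @` A) y -> A (S y) /\ T (S y) = y.
  by move=> [p Ap Tpy]; rewrite /S; case: xgetP => [q -> //|/(_ p)/=]; tauto.
have eq_of_sqdist0 (p q : heis R) : p.1.1 = q.1.1 -> p.1.2 = q.1.2 -> p.2 = q.2 -> p = q.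
  by case: p q => [[? ?] ?] [[? ?] ?] /= -> -> ->.
have AS : A `<=` S @` (T @` A).
  move=> p Ap; exists (T p); first by exists p.
  have [ASp TSp] := SP (T p) (ex_intro2 _ _ p Ap erefl).
  have := TK (S (T p)) p; rewrite !inE => /(_ ASp Ap); rewrite TSp.
  have -> : sqdist (T p) (T p) = 0%R by rewrite /sqdist !subrr expr0n/= !addr0.
  rewrite mulr0 => h; have {}h : sqdist (S (T p)) p = 0%R by apply/eqP; rewrite eq_le h sqdist_ge0.
  move: h => /eqP; rewrite /sqdist !paddr_eq0 ?addr_ge0 ?sqr_ge0// !sqrf_eq0 !subr_eq0.
  by move=> /andP[/andP[/eqP h1 /eqP h2] /eqP h3]; exact: eq_of_sqdist0.
apply: le_trans (le_hausdorff2 AS) _; apply: hausdorff2_lipschitz => // y z /set_mem yA /set_mem zA.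
have [Ay Ty] := SP y yA; have [Az Tz] := SP z zA.
by rewrite -[in leRHS]Ty -[in leRHS]Tz; apply: TK; rewrite inE.
Qed.

Lemma hausdorff2_homothety (T : heis R -> heis R) A (K : R) : (0 < K)%R ->
  (forall p q, sqdist (T p) (T q) = K * sqdist p q)%R ->
  hausdorff2 (T @` A) = K%:E * hausdorff2 A.
Proof.
move=> K0 TK; apply/eqP; rewrite eq_le; apply/andP; split.
  by apply: hausdorff2_lipschitz => // p q _ _; rewrite TK.
rewrite -lee_pdivlMl//; apply: hausdorff2_colipschitz; first by rewrite invr_gt0.
by move=> p q _ _; rewrite TK mulrA mulVf ?mul1r// gt_eqF.
Qed.

Lemma hausdorff2_isometry (T : heis R -> heis R) A :
  (forall p q, sqdist (T p) (T q) = sqdist p q)%R ->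
  hausdorff2 (T @` A) = hausdorff2 A.
Proof.
by move=> TK; rewrite (@hausdorff2_homothety T A 1)// ?mul1e// => p q; rewrite TK mul1r.
Qed.

(** * The area of cylinders *)

Definition cylinder (r a b : R) : set (heis R) :=
  [set p | p.1.1 ^+ 2 + p.1.2 ^+ 2 = r ^+ 2 /\ a < p.2 <= b]%R.

(** The quarter of the cylinder on which the circle is a graph of slope at most 1 over the [x]
    coordinate. Its images under isometries exchanging or negating the planar coordinates cover the
    rest. *)
Let arc_piece : set (heis R) :=
  [set p | [/\ p.1.1 ^+ 2 + p.1.2 ^+ 2 = 1, `|p.1.1| <= p.1.2 & 0 < p.2 <= 1]%R].

Let arc_piece_sqdist p q : arc_piece p -> arc_piece q ->
  (sqdist p q <= 2 * (p.1.1 - q.1.1) ^+ 2 + (p.2 - q.2) ^+ 2)%R.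
Proof.
case: p q => [[x y] s] [[x' y'] s'] [/= xy1 xy _] [/= xy1' xy' _].
rewrite /sqdist/= lerD2r mulr_natl mulr2n lerD2l.
have y0 : (0 < y)%R.
  rewrite lt_neqAle (le_trans (normr_ge0 x) xy) andbT; apply/eqP => y0; move: xy1 xy.
  rewrite -y0 normr_le0 => + /eqP => /[swap] ->; rewrite expr0n/= addr0 => /eqP; by rewrite eq_sym oner_eq0.
have y0' : (0 <= y')%R := le_trans (normr_ge0 x') xy'.
have E : ((y - y') * (y + y') = (x' - x) * (x' + x))%R by rewrite -!subr_sqr; lra.
have yy : (0 < y + y')%R by rewrite ltr_pwDl.
have xxyy : (`|x' + x| <= y + y')%R by rewrite (le_trans (ler_normD _ _))// addrC lerD.
rewrite -(ler_pM2r (exprn_gt0 2 yy)) -[leLHS]exprMn E -(sqrrN (x - x')) opprB exprMn.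
by rewrite ler_wpM2l ?sqr_ge0// -[leLHS]real_normK ?num_real// ler_pXn2r ?nnegrE// ltW.
Qed.

(** Cells of width [2 / n] in [x] and [1 / n] in height have squared diameter at most
    [2 (2 / n)^2 + (1 / n)^2 = (3 / n)^2]. There are [n^2] of them, so the total is [9 pi / 4] at
    every scale. *)
Let hausdorff2_arc_piece : hausdorff2 arc_piece < +oo.
Proof.
apply: (@le_lt_trans _ _ (pi / 4 * 9)%:E); last by rewrite ltry.
apply: ge_ereal_sup => _ [d /= d0 <-].
have [n nd] : exists n, (0 < n)%N /\ (3 / n%:R <= d)%R.
  exists (Num.truncn (3 / d)).+1; split => //.
  rewrite ler_pdivrMr// mulrC -ler_pdivrMr//; exact/ltW/truncnS_gt.
case: nd => n0 nd.
have n0R : (0 < n%:R :> R)%R by rewrite ltr0n.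
pose cell (i j : nat) : set (heis R) := arc_piece `&`
  [set p | (2 * i%:R <= (p.1.1 + 1) * n%:R <= 2 * i.+1%:R) && (j%:R <= p.2 * n%:R <= j.+1%:R)]%R.
have dcell i j : diam (cell i j) <= (3 / n%:R)%:E.
  apply: diam_le => [|p q [Ap /andP[/andP[p1 p2] /andP[p3 p4]]] [Aq /andP[/andP[q1 q2] /andP[q3 q4]]]].
    by rewrite divr_ge0.
  apply: le_trans (arc_piece_sqdist Ap Aq) _.
  rewrite expr_div_n ler_pdivlMr ?exprn_gt0// mulrDl -mulrA -!exprMn.
  rewrite -!natr1 in p2 p4 q2 q4.
  move: p1 p2 p3 p4 q1 q2 q3 q4.
  set u := (_ - _)%R; set v := (p.2 - q.2)%R => p1 p2 p3 p4 q1 q2 q3 q4.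
  have h1 : ((u * n%:R) ^+ 2 <= 2 ^+ 2)%R.
    rewrite -[leLHS]real_normK ?num_real// ler_pXn2r ?nnegrE// ler_norml /u; apply/andP; split; lra.
  have h2 : ((v * n%:R) ^+ 2 <= 1 ^+ 2)%R.
    rewrite -[leLHS]real_normK ?num_real// ler_pXn2r ?nnegrE// ler_norml /v; apply/andP; split; lra.
  lra.
pose U k : set (heis R) := if (k < n * n)%N then cell (k %/ n)%N (k %% n)%N else set0.
have dU k : diam (U k) <= (3 / n%:R)%:E.
  by rewrite /U; case: ifPn => // _; rewrite diam0 lee_fin divr_ge0.
apply: (@le_trans _ _ (\sum_(k <oo) disc_area (U k))).
  apply: ereal_inf_lbound; exists U => //; split => [k|p Ap].
    by apply: le_trans (dU k) _; rewrite lee_fin.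
  have [xy1 xy /andP[s0 s1]] := Ap.
  have x1 : (-1 <= p.1.1 < 1)%R.
    have y0 := le_trans (normr_ge0 _) xy.
    have : (`|p.1.1| < 1)%R.
      rewrite ltNge; apply/negP => x1.
      have : (1 ^+ 2 + 1 ^+ 2 <= p.1.1 ^+ 2 + p.1.2 ^+ 2)%R.
        by rewrite -(real_normK (num_real p.1.1)); apply: lerD; rewrite ler_pXn2r ?nnegrE// (le_trans x1).
      rewrite xy1; lra.
    by rewrite ltr_norml => /andP[/ltW -> ->].
  have [i [ilt i1 i2]] : exists i, [/\ (i < n)%N, (2 * i%:R <= (p.1.1 + 1) * n%:R)%R & ((p.1.1 + 1) * n%:R <= 2 * i.+1%:R)%R].
    have t0 : (0 <= (p.1.1 + 1) * n%:R / 2)%R by rewrite divr_ge0// mulr_ge0//; lra.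
    have /andP[h1 h2] := truncn_itv t0.
    exists (Num.truncn ((p.1.1 + 1) * n%:R / 2)); split; [|lra|lra].
    rewrite -(ltr_nat R); apply: le_lt_trans h1 _; rewrite -mulrA mulrCA gtr_pMr//; lra.
  have [j [jlt j1 j2]] : exists j, [/\ (j < n)%N, (j%:R <= p.2 * n%:R)%R & (p.2 * n%:R <= j.+1%:R)%R].
    (* Truncation would send height exactly 1 to the index [n], which is out of range; it belongs to
       the last cell. *)
    have [->|p21] := eqVneq p.2 1%R.
      by exists n.-1; rewrite !mul1r ler_nat prednK ?ler_nat ?leq_pred.
    have t0 : (0 <= p.2 * n%:R)%R by rewrite mulr_ge0// ltW.
    have /andP[h1 h2] := truncn_itv t0.
    exists (Num.truncn (p.2 * n%:R)); split; [|lra|lra].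
    rewrite -(ltr_nat R); apply: le_lt_trans h1 _; rewrite gtr_pMl// lt_neqAle p21; lra.
  exists (i * n + j)%N => //; rewrite /U.
  have -> : (i * n + j < n * n)%N.
    by rewrite (@leq_trans (i * n + n)%N) ?ltn_add2l// -mulSnr leq_mul2r ilt orbT.
  rewrite divnMDl// divn_small// addn0 modnMDl modn_small//.
  by split => //=; rewrite i1 i2 j1 j2.
rewrite (@nneseries_split _ _ 0 (n * n)); last by move=> *; exact: disc_area_ge0.
rewrite [X in _ + X]eseries0 ?adde0; last first.
  move=> k; rewrite add0n => nk _; rewrite /U ltnNge nk/= /disc_area diam0 expe2 !mule0//.
apply: (@le_trans _ _ (\sum_(0 <= k < 0 + n * n) (pi / 4 * (3 / n%:R) ^+ 2)%:E)).
  apply: lee_sum => k _; rewrite /disc_area [leRHS]EFinM; apply: lee_wpmul2l; first by rewrite lee_fin divr_ge0// pi_ge0.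
  by rewrite expr2 EFinM expe2; apply: lee_pmul; rewrite ?diam_ge0.
rewrite sumEFin lee_fin sumr_const_nat subn0 add0n -[leLHS]mulr_natr (natrM _ n n).
rewrite le_eqVlt; apply/orP; left; apply/eqP; field; exact: lt0r_neq0.
Qed.

Lemma hausdorff2_cylinder_fin : hausdorff2 (cylinder 1 0 1) < +oo.
Proof.
pose T1 p : heis R := ((p.1.1, - p.1.2), p.2)%R.
pose T2 p : heis R := ((p.1.2, p.1.1), p.2)%R.
pose T3 p : heis R := ((- p.1.2, p.1.1), p.2)%R.
have iso1 : forall p q, (sqdist (T1 p) (T1 q) = sqdist p q)%R.
  by move=> p q; rewrite /sqdist/=; ring.
have iso2 : forall p q, (sqdist (T2 p) (T2 q) = sqdist p q)%R.
  by move=> p q; rewrite /sqdist/=; ring.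
have iso3 : forall p q, (sqdist (T3 p) (T3 q) = sqdist p q)%R.
  by move=> p q; rewrite /sqdist/=; ring.
have sub : cylinder 1 0 1 `<=` (arc_piece `|` (T1 @` arc_piece)) `|` ((T2 @` arc_piece) `|` (T3 @` arc_piece)).
  move=> [[x y] s] [/= xy s01]; rewrite expr1n in xy.
  have [yx|xy'] := leP `|x|%R `|y|%R.
    left; have [y0|y0] := leP 0%R y; [left|right].
      by split => //=; rewrite -(ger0_norm y0).
    exists ((x, - y), s)%R; last by rewrite /T1/= opprK.
    by split => //=; [rewrite sqrrN|rewrite -(ltr0_norm y0)].
  right; have [x0|x0] := leP 0%R x; [left|right].
    by exists ((y, x), s) => //; split => //=; [rewrite addrC|rewrite -(ger0_norm x0) ltW].
  exists ((y, - x), s)%R; last by rewrite /T3/= opprK.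
  by split => //=; [rewrite sqrrN addrC|rewrite -(ltr0_norm x0) ltW].
apply: le_lt_trans (le_hausdorff2 sub) _.
have U2 := @outer_measureU2 _ _ (@hausdorff2_outer R).
have fin T : (forall p q, (sqdist (T p) (T q) = sqdist p q)%R) ->
    @hausdorff2_outer R (T @` arc_piece) < +oo.
  by move=> iso; rewrite [ltLHS](_ : _ = hausdorff2 arc_piece)//; exact: hausdorff2_isometry.
apply: le_lt_trans (U2 _ _) _; apply: lte_add_pinfty; apply: le_lt_trans (U2 _ _) _.
  by apply: lte_add_pinfty; [exact: hausdorff2_arc_piece|exact: fin].
by apply: lte_add_pinfty; exact: fin.
Qed.

(** Classically [2 pi]. The truncation by [fine] is harmless by [hausdorff2_cylinder_fin]. *)
Definition cylinder_const : R := fine (hausdorff2 (cylinder 1 0 1)).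

Lemma hausdorff2_cylinder_shift a b (t : R) :
  hausdorff2 (cylinder 1 (a + t)%R (b + t)%R) = hausdorff2 (cylinder 1 a b).
Proof.
pose T p : heis R := (p.1, p.2 + t)%R.
rewrite -(@hausdorff2_isometry T (cylinder 1 a b)); last first.
  by move=> p q; rewrite /sqdist/= [(_ + t - _)%R](_ : _ = p.2 - q.2)%R//; ring.
congr hausdorff2; apply/seteqP; split => [[[x y] s] [/= xy /andP[s1 s2]]|_ [[[x y] s] [/= xy /andP[s1 s2]]] <-].
  exists ((x, y), s - t)%R; last by rewrite /T/= subrK.
  by split => //=; rewrite ltrBrDr lerBlDr s1.
by split => //=; rewrite ltrD2r lerD2r s1.
Qed.

Lemma measurable_coordinates : [/\
  measurable_fun [set: Tc] (fun p : Tc => p.1.1 : R),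
  measurable_fun [set: Tc] (fun p : Tc => p.1.2 : R) &
  measurable_fun [set: Tc] (fun p : Tc => p.2 : R)].
Proof.
split; apply: measurable_contraction => p q; rewrite /sqdist.
- by rewrite -addrA lerDl addr_ge0 ?sqr_ge0.
- by rewrite addrAC lerDr addr_ge0 ?sqr_ge0.
- by rewrite lerDr addr_ge0 ?sqr_ge0.
Qed.

Lemma measurable_slab (a b : R) : measurable ([set p : Tc | (a < p.2 <= b)%R]).
Proof.
have [_ _ ms] := measurable_coordinates.
have -> : [set p : Tc | (a < p.2 <= b)%R] = (fun p : Tc => p.2 : R) @^-1` `]a, b].
  by apply/seteqP; split => p /=; rewrite in_itv.
by rewrite -[_ @^-1` _]setTI; apply: ms => //; exact: measurable_itv.
Qed.

Lemma measurable_cylinder (r a b : R) : measurable (cylinder r a b : set Tc).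
Proof.
have [mx my ms] := measurable_coordinates.
have -> : cylinder r a b = (fun p : Tc => (p.1.1 ^+ 2 + p.1.2 ^+ 2)%R : R) @^-1` [set r ^+ 2]%R `&`
   [set p : Tc | (a < p.2 <= b)%R].
  by apply/seteqP; split => p.
apply: measurableI; last exact: measurable_slab.
rewrite -[_ @^-1` _]setTI.
have mf : measurable_fun [set: Tc] (fun p : Tc => (p.1.1 ^+ 2 + p.1.2 ^+ 2)%R : R).
  by apply: measurable_funD; apply: measurable_funX.
by apply: mf => //; exact: measurable_set1.
Qed.

Let phi (t : R) := hausdorff2 (cylinder 1 0 t).

Let phiD s t : (0 <= s)%R -> (0 <= t)%R -> phi (s + t)%R = phi s + phi t.
Proof.
move=> s0 t0; rewrite /phi -(hausdorff2_cylinder_shift 0 t s) add0r (addrC t).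
have -> : cylinder 1 0 (s + t)%R = cylinder 1 0 s `|` cylinder 1 s (s + t)%R.
  apply/seteqP; split => [p [/= h /andP[p0 pst]]|p [[/= h /andP[p0 pst]]|[/= h /andP[p0 pst]]]].
  - by have [ps|ps] := leP p.2 s; [left|right]; split => //=; rewrite ?p0 ?ps.
  - by split => //=; rewrite p0 (le_trans pst)// lerDl.
  - by split => //=; rewrite pst andbT (le_lt_trans s0).
rewrite -[LHS]/(@H2 R _) -[X in X + _]/(@H2 R _) -[X in _ + X]/(@H2 R _).
rewrite measureU//; try exact: measurable_cylinder.
apply/seteqP; split => // p [[_ /andP[_ /= p1]] [_ /andP[/= p2 _]]].
by have := le_lt_trans p1 p2; rewrite ltxx.
Qed.

Let phi_le s t : (s <= t)%R -> phi s <= phi t.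
Proof.
by move=> st; apply: le_hausdorff2 => p [h /andP[p0 ps]]; split => //=; rewrite p0 (le_trans ps st).
Qed.

Let phi0 : phi 0%R = 0.
Proof.
rewrite /phi (_ : cylinder _ _ _ = set0) ?hausdorff2_set0//.
by apply/seteqP; split => // p [_ /andP[/lt_le_trans h /h]]; rewrite ltxx.
Qed.

Let phi_nat n t : (0 <= t)%R -> phi (n%:R * t)%R = n%:R%:E * phi t.
Proof.
move=> t0; elim: n => [|n IH]; first by rewrite mul0r mul0e phi0.
rewrite -natr1 mulrDl mul1r phiD ?mulr_ge0// IH EFinD ge0_muleDl ?lee_fin//.
by rewrite mul1e.
Qed.

Let phi_fin t : phi t \is a fin_num.
Proof.
have [n tn] : exists n, (t <= n%:R * 1)%R.
  by exists (Num.truncn t).+1; rewrite mulr1; exact/ltW/truncnS_gt.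
rewrite ge0_fin_numE ?hausdorff2_ge0//; apply: le_lt_trans (phi_le tn) _.
rewrite phi_nat//; apply: lte_mul_pinfty; rewrite ?lee_fin//; exact: hausdorff2_cylinder_fin.
Qed.

(** A monotone additive function is linear: if [m <= n t < m + 1], then [n phi t] and [n c t] both
    lie between [m c] and [(m + 1) c], so [n |phi t - c t| <= c] for all [n]. *)
Let phiE t : (0 <= t)%R -> phi t = (cylinder_const * t)%:E.
Proof.
move=> t0; rewrite -[LHS]fineK//; congr (_%:E).
have f1 : (0 <= fine (phi 1))%R by rewrite fine_ge0// hausdorff2_ge0.
suff : (forall n, n.+1%:R * `|fine (phi t) - cylinder_const * t| <= cylinder_const)%R.
  move=> H; apply/eqP; rewrite -subr_eq0 -normr_le0 leNgt; apply/negP => d0.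
  have := H (Num.truncn (cylinder_const / `|fine (phi t) - cylinder_const * t|)%R).
  by rewrite -ler_pdivlMr// leNgt truncnS_gt.
move=> n.
have t0' : (0 <= n.+1%:R * t)%R by rewrite mulr_ge0.
have /andP[h1 h2] := truncn_itv t0'.
set m := Num.truncn _ in h1 h2.
rewrite -[X in (X * `|_|)%R]ger0_norm// -normrM mulrBr.
have E1 : (n.+1%:R * fine (phi t) = fine (phi (n.+1%:R * t)))%R.
  by rewrite phi_nat// fineM.
have E0 k : fine (phi k%:R) = (k%:R * cylinder_const)%R.
  by rewrite -{1}[k%:R]mulr1 phi_nat// fineM.
have L : ((m%:R * cylinder_const)%R <= fine (phi (n.+1%:R * t)%R))%R.
  by rewrite -E0; apply: fine_le; rewrite ?phi_fin// phi_le.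
have U : (fine (phi (n.+1%:R * t)) <= m.+1%:R * cylinder_const)%R.
  by rewrite -E0; apply: fine_le; rewrite ?phi_fin// phi_le// ltW.
rewrite E1 mulrCA ler_norml.
have c0 : (0 <= cylinder_const)%R by [].
have M1 : (cylinder_const * m%:R <= cylinder_const * (n.+1%:R * t))%R by rewrite ler_wpM2l.
have M2 : (cylinder_const * (n.+1%:R * t) <= cylinder_const * m.+1%:R)%R by rewrite ler_wpM2l// ltW.
rewrite -(natr1 m) in M2 U.
by apply/andP; split; lra.
Qed.

Lemma cylinder_const_ge0 : (0 <= cylinder_const)%R.
Proof. by rewrite fine_ge0// hausdorff2_ge0. Qed.

Lemma hausdorff2_cylinder (r a b : R) : (0 < r)%R -> (a <= b)%R ->
  hausdorff2 (cylinder r a b) = (cylinder_const * (r * (b - a)))%:E.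
Proof.
move=> r0 ab; pose T p : heis R := ((r * p.1.1, r * p.1.2), r * p.2)%R.
have -> : cylinder r a b = T @` (cylinder 1 (a / r)%R (b / r)%R).
  apply/seteqP; split => [[[x y] s] [/= xy /andP[s1 s2]]|_ [[[x y] s] [/= xy /andP[s1 s2]] <-]].
    exists ((x / r, y / r), s / r)%R; last by rewrite /T/= !(mulrC r) !divfK ?gt_eqF.
    split => /=; last by rewrite ltr_pM2r ?invr_gt0// ler_pM2r ?invr_gt0// s1.
    by rewrite !exprMn -mulrDl xy -exprMn divff ?gt_eqF.
  split => /=; first by rewrite !exprMn -mulrDr xy expr1n mulr1.
  by rewrite (mulrC r) -ltr_pdivrMr// s1 -ler_pdivlMr.
rewrite (@hausdorff2_homothety _ _ (r ^+ 2)) ?exprn_gt0//; last first.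
  by move=> p q; rewrite /sqdist/=; ring.
have -> : (a / r = 0 + a / r)%R by rewrite add0r.
have -> : (b / r = (b - a) / r + a / r)%R by rewrite -mulrDl subrK.
rewrite hausdorff2_cylinder_shift -/(phi _) phiE ?divr_ge0 ?subr_ge0 ?(ltW r0)//.
rewrite -EFinM; congr (_%:E); field; exact: lt0r_neq0.
Qed.

End hausdorff.

(** * Surface measure of the gauge spheres *)

(** The supremum [z] of the points reached from [a] can be passed by the local hypothesis at [z],
    unless [z = b]. This turns estimates on short intervals into global ones. *)
Lemma interval_induction (R : realType) (P : R -> R -> Prop) (a b : R) : a <= b ->
  (forall x y z, a <= x -> x <= y -> y <= z -> z <= b -> P x y -> P y z -> P x z) ->
  (forall t, a <= t <= b -> exists2 d : R, 0 < d &
    forall x y, a <= x -> x <= y -> y <= b -> t - d < x -> y < t + d -> P x y) ->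
  P a b.
Proof.
move=> ab Ptrans Ploc.
pose S := [set x | a <= x <= b /\ P a x].
have Sa : S a.
  split; first by rewrite lexx.
  have [|d d0 H] := Ploc a; first by rewrite lexx.
  by apply: H => //; rewrite ?ltrBlDr ?ltrDl.
have Sub : ubound S b by move=> x [/andP[]].
have supS : has_sup S by split; [exists a|exists b].
pose z := sup S.
have az : a <= z by apply: ub_le_sup => //; exists b.
have zb : z <= b by apply: ge_sup => //; exists a.
have [|d d0 H] := Ploc z; first by rewrite az.
have [x [[/andP[ax xb] Pax]] xz] := sup_adherent d0 supS.
have xlez : x <= z by apply: ub_le_sup; [exists b|split => //; rewrite ax].
pose y := Num.min b (z + d / 2).
have xy : x <= y by rewrite le_min xb (le_trans xlez)// lerDl divr_ge0// ltW.
have yb : y <= b by rewrite ge_min lexx.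
have yzd : y < z + d.
  rewrite (@le_lt_trans _ _ (z + d / 2))// ?ge_min ?lexx ?orbT// ltrD2l.
  by rewrite ltr_pdivrMr// mulr_natr mulr2n ltrDl.
have Pay : P a y by apply: (Ptrans a x y) => //; apply: H.
have yz : y <= z by apply: ub_le_sup; [exists b|split => //; rewrite (le_trans ax xy)].
have <- : y = b; last by [].
apply/eqP; rewrite eq_le yb /= leNgt; apply/negP => ylt.
have : y = z + d / 2 by move: ylt; rewrite /y minElt; case: ifP => //; rewrite ltxx.
move=> yE; move: yz; rewrite yE leNgt ltrDl divr_gt0//.
Qed.

Section sphere.
Variable R : realType.
Local Notation Tc := (caratheodory_type (@hausdorff2_outer R)).
Local Notation leb := (@lebesgue_measure R).
Implicit Types (p q : heis R) (T s t a b : R).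

Definition planar_sq p : R := p.1.1 ^+ 2 + p.1.2 ^+ 2.
Definition gauge4 p : R := planar_sq p ^+ 2 + 16 * p.2 ^+ 2.

(** On the sphere [gauge4 = T] the circle at height [t] has squared radius [rad2 T t] and radius
    [rad T t]. Beyond the poles, where [16 t^2 > T], both are 0 because the square root of a
    negative number is 0. *)
Definition rad2 T t : R := Num.sqrt (T - 16 * t ^+ 2).
Definition rad T t : R := Num.sqrt (rad2 T t).
(** Half open, so that adjacent strips are disjoint and their integrals add. *)
Definition strip T a b : set (heis R) := [set p | gauge4 p = T /\ a < p.2 <= b].
Definition punctured_sphere T : set (heis R) := [set p | gauge4 p = T /\ 16 * p.2 ^+ 2 < T].
Definition height_range T : set R := [set t | 16 * t ^+ 2 < T].
(** With [|z|^2 = rad2 T t] this is [|z|^2 / sqrt (|z|^6 + 64 sigma^2)], which on a sphere is a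
    constant multiple of [|grad_H rho|^2 / |grad rho|]. *)
Definition area_weight T t : R := rad2 T t / Num.sqrt (rad2 T t ^+ 3 + 64 * t ^+ 2).

Lemma planar_sq_ge0 p : 0 <= planar_sq p.
Proof. by rewrite addr_ge0 ?sqr_ge0. Qed.

Lemma planar_sq_rad2 T p : gauge4 p = T -> planar_sq p = rad2 T p.2.
Proof. by move=> <-; rewrite /rad2 /gauge4 addrK sqrtr_sqr ger0_norm// planar_sq_ge0. Qed.

Lemma rad2_gt0 T t : 16 * t ^+ 2 < T -> 0 < rad2 T t.
Proof. by move=> tT; rewrite sqrtr_gt0 subr_gt0. Qed.

Lemma rad_gt0 T t : 16 * t ^+ 2 < T -> 0 < rad T t.
Proof. by move=> tT; rewrite sqrtr_gt0 rad2_gt0. Qed.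

Lemma rad2_sq T t : 16 * t ^+ 2 <= T -> rad2 T t ^+ 2 = T - 16 * t ^+ 2.
Proof. by move=> tT; rewrite sqr_sqrtr// subr_ge0. Qed.

Lemma rad_sq T t : rad T t ^+ 2 = rad2 T t.
Proof. by rewrite sqr_sqrtr// sqrtr_ge0. Qed.

Lemma continuous_rad2 T : continuous (rad2 T).
Proof.
move=> t; apply: (@continuous_comp _ _ _ (fun t => T - 16 * t ^+ 2) Num.sqrt); last exact: sqrt_continuous.
apply: cvgB; first exact: cvg_cst.
apply: cvgM; first exact: cvg_cst.
exact: exprn_continuous.
Qed.

Lemma continuous_rad T : continuous (rad T).
Proof.
move=> t; apply: (@continuous_comp _ _ _ (rad2 T) Num.sqrt); last exact: sqrt_continuous.
exact: continuous_rad2.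
Qed.

(** Minus the difference quotient of [rad], rationalised so that it makes sense for [s = t], where
    it is minus the derivative. *)
Definition rad_slope T s t : R := 16 * (s + t) / ((rad T s + rad T t) * (rad2 T s + rad2 T t)).

Lemma rad_slopeE T s t : 16 * s ^+ 2 < T -> 16 * t ^+ 2 < T ->
  (rad T s - rad T t) ^+ 2 = rad_slope T s t ^+ 2 * (s - t) ^+ 2.
Proof.
move=> sT tT.
have d0 : (rad T s + rad T t) * (rad2 T s + rad2 T t) != 0.
  by rewrite mulf_neq0// gt_eqF// addr_gt0// ?rad_gt0 ?rad2_gt0.
have E : (rad T s - rad T t) * ((rad T s + rad T t) * (rad2 T s + rad2 T t)) = - (16 * (s + t) * (s - t)).
  rewrite mulrA -subr_sqr !rad_sq -subr_sqr !rad2_sq ?ltW//; ring.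
have -> : rad T s - rad T t = - (rad_slope T s t * (s - t)).
  apply: (mulIf d0); rewrite E /rad_slope; field.
  by move: d0; rewrite mulf_eq0 negb_or => /andP[-> ->].
by rewrite sqrrN exprMn.
Qed.

(** The squared arc length element [1 + rad'^2] of the profile curve. *)
Definition profile_slope2 T t : R := 1 + rad_slope T t t ^+ 2.

Lemma profile_slope2_ge1 T t : 1 <= profile_slope2 T t.
Proof. by rewrite lerDl sqr_ge0. Qed.

Let area_weight_den T t : 16 * t ^+ 2 < T -> 0 < rad2 T t ^+ 3 + 64 * t ^+ 2.
Proof.
move=> tT; apply: ltr_pwDl; first by rewrite exprn_gt0 ?rad2_gt0.
by rewrite mulr_ge0 ?sqr_ge0.
Qed.

(** The area element of a surface of revolution is [rad * sqrt (1 + rad'^2)] in angle and height.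
    The horizontal weight is exactly its inverse, which is why weighted surface integrals become
    plain integrals in the height. *)
Lemma area_weightK T t : 16 * t ^+ 2 < T ->
  area_weight T t * (rad T t * Num.sqrt (profile_slope2 T t)) = 1.
Proof.
move=> tT.
have s0 := rad2_gt0 tT; have r0 := rad_gt0 tT.
have -> : rad T t * Num.sqrt (profile_slope2 T t) = Num.sqrt (rad2 T t ^+ 3 + 64 * t ^+ 2) / rad2 T t.
  have -> : profile_slope2 T t = (rad2 T t ^+ 3 + 64 * t ^+ 2) / rad2 T t ^+ 3.
    rewrite /profile_slope2 /rad_slope -!rad_sq; field.
    by rewrite !gt_eqF// addr_gt0// exprn_gt0.
  rewrite sqrtrM ?(ltW (area_weight_den tT))//.
  rewrite mulrCA; congr (_ * _).
  apply: (@mulIf _ (Num.sqrt (rad2 T t ^+ 3))).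
    by rewrite gt_eqF// sqrtr_gt0 exprn_gt0.
  rewrite -mulrA sqrtrV ?exprn_ge0 ?ltW// mulVf ?mulr1; last by rewrite gt_eqF// sqrtr_gt0 exprn_gt0.
  rewrite exprS sqrtrM ?ltW// sqrtr_sqr ger0_norm ?ltW// -/(rad T t).
  rewrite mulrCA mulVf ?mulr1// gt_eqF//.
have w0 : Num.sqrt (rad2 T t ^+ 3 + 64 * t ^+ 2) != 0.
  by rewrite gt_eqF// sqrtr_gt0 area_weight_den.
rewrite /area_weight; field; rewrite w0/= gt_eqF//.
Qed.

(** Pushes each circle radially to the radius at height [t] and stretches heights by the arc length
    factor at [t], so that a thin strip around height [t] lands almost isometrically on a straight
    cylinder. *)
Definition unroll T t p : heis R :=
  ((rad T t / rad T p.2 * p.1.1, rad T t / rad T p.2 * p.1.2), Num.sqrt (profile_slope2 T t) * p.2).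

Lemma unroll_strip T t a b : 16 * t ^+ 2 < T ->
  (forall s, a < s <= b -> 16 * s ^+ 2 < T) ->
  unroll T t @` strip T a b =
  cylinder (rad T t) (Num.sqrt (profile_slope2 T t) * a) (Num.sqrt (profile_slope2 T t) * b).
Proof.
move=> tT abT.
have k0 : 0 < Num.sqrt (profile_slope2 T t).
  by rewrite sqrtr_gt0 (lt_le_trans _ (profile_slope2_ge1 T t)).
apply/seteqP; split => [_ [[[x y] s] [/= gT sab] <-]|[[x y] s] [/= xy sab]].
  have s0 := abT _ sab.
  split => /=; last by rewrite ltr_pM2l// ler_pM2l.
  rewrite !exprMn -mulrDr -[_ ^+ 2 + _ ^+ 2]/(planar_sq (x, y, s)) (planar_sq_rad2 gT)/=.
  by rewrite -rad_sq exprVn mulfVK// expf_eq0/= gt_eqF// rad_gt0.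
have sab' : a < s / Num.sqrt (profile_slope2 T t) <= b.
  by rewrite ltr_pdivlMr// ler_pdivrMr// !(mulrC _ (Num.sqrt _)).
have s0 := abT _ sab'; have r0 := rad_gt0 s0; have r0' := rad_gt0 tT.
set u := s / Num.sqrt (profile_slope2 T t) in sab' s0 r0 *.
exists ((rad T u / rad T t * x, rad T u / rad T t * y), u).
  split => //=; rewrite /gauge4/= /planar_sq/= [(_ * x) ^+ 2]exprMn [(_ * y) ^+ 2]exprMn -mulrDr xy -exprMn.
  by rewrite divfK ?gt_eqF// rad_sq rad2_sq ?ltW// subrK.
have -> : s = Num.sqrt (profile_slope2 T t) * u by rewrite /u mulrC divfK// gt_eqF.
rewrite /unroll/=; congr ((_, _), _); field; rewrite ?(gt_eqF r0) ?(gt_eqF r0') ?(gt_eqF k0)//.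
Qed.

(* |z1 - z2|^2 = (r1 - r2)^2 + r1 r2 |z1/r1 - z2/r2|^2 for |zi| = ri *)
Lemma sqdist_strip T t p q : gauge4 p = T -> gauge4 q = T ->
  16 * p.2 ^+ 2 < T -> 16 * q.2 ^+ 2 < T -> 16 * t ^+ 2 < T ->
  exists2 e : R, 0 <= e &
  sqdist p q = rad T p.2 * rad T q.2 * e + (1 + rad_slope T p.2 q.2 ^+ 2) * (p.2 - q.2) ^+ 2 /\
  sqdist (unroll T t p) (unroll T t q) = rad T t ^+ 2 * e + profile_slope2 T t * (p.2 - q.2) ^+ 2.
Proof.
case: p q => [[x y] s] [[x' y'] s'] /= gp gq sT sT' tT.
exists ((x / rad T s - x' / rad T s') ^+ 2 + (y / rad T s - y' / rad T s') ^+ 2).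
  by rewrite addr_ge0 ?sqr_ge0.
have r0 := rad_gt0 sT; have r0' := rad_gt0 sT'.
have xy : x ^+ 2 + y ^+ 2 = rad T s ^+ 2 by rewrite rad_sq -(planar_sq_rad2 gp).
have xy' : x' ^+ 2 + y' ^+ 2 = rad T s' ^+ 2 by rewrite rad_sq -(planar_sq_rad2 gq).
split.
  rewrite mulrDl mul1r -rad_slopeE// /sqdist/= [RHS]addrCA [LHS]addrC; congr (_ + _).
  transitivity ((x ^+ 2 + y ^+ 2) + (x' ^+ 2 + y' ^+ 2) - 2 * (x * x' + y * y')); first by ring.
  transitivity ((x ^+ 2 + y ^+ 2) * (rad T s' / rad T s) + (x' ^+ 2 + y' ^+ 2) * (rad T s / rad T s')
    - 2 * (x * x' + y * y') + (rad T s - rad T s') ^+ 2); last first.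
    by field; rewrite (gt_eqF r0) (gt_eqF r0').
  by rewrite xy xy'; field; rewrite (gt_eqF r0) (gt_eqF r0').
have k0 : 0 <= profile_slope2 T t by rewrite (le_trans _ (profile_slope2_ge1 T t)).
rewrite /sqdist/= -[_ * s - _]mulrBr [(_ * (s - s')) ^+ 2]exprMn (sqr_sqrtr k0); congr (_ + _).
by field; rewrite (gt_eqF r0) (gt_eqF r0').
Qed.

Lemma strip_near T t e : 16 * t ^+ 2 < T -> 0 < e -> exists2 d : R, 0 < d &
  forall s s', t - d < s < t + d -> t - d < s' < t + d ->
  [/\ 16 * s ^+ 2 < T, `|rad T s * rad T s' - rad T t ^+ 2| <= e &
   `|1 + rad_slope T s s' ^+ 2 - profile_slope2 T t| <= e].
Proof.
move=> tT e0.
have c1 : {for (t, t), continuous (fun z : R * R => T - 16 * z.1 ^+ 2)}.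
  apply: cvgB; first exact: cvg_cst.
  apply: cvgM; first exact: cvg_cst.
  by apply: (@continuous_comp _ _ _ fst (fun x : R => x ^+ 2)); [exact: cvg_fst|exact: exprn_continuous].
have cr1 : {for (t, t), continuous (fun z : R * R => rad T z.1)}.
  by apply: (@continuous_comp _ _ _ fst (rad T)); [exact: cvg_fst|exact: continuous_rad].
have cr2 : {for (t, t), continuous (fun z : R * R => rad T z.2)}.
  by apply: (@continuous_comp _ _ _ snd (rad T)); [exact: cvg_snd|exact: continuous_rad].
have cs1 : {for (t, t), continuous (fun z : R * R => rad2 T z.1)}.
  by apply: (@continuous_comp _ _ _ fst (rad2 T)); [exact: cvg_fst|exact: continuous_rad2].
have cs2 : {for (t, t), continuous (fun z : R * R => rad2 T z.2)}.
  by apply: (@continuous_comp _ _ _ snd (rad2 T)); [exact: cvg_snd|exact: continuous_rad2].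
have c2 : {for (t, t), continuous (fun z : R * R => rad T z.1 * rad T z.2)} by apply: cvgM.
have c3 : {for (t, t), continuous (fun z : R * R => rad_slope T z.1 z.2)}.
  apply: cvgM.
    apply: cvgM; first exact: cvg_cst.
    by apply: cvgD; [exact: cvg_fst|exact: cvg_snd].
  apply: cvgV; last by apply: cvgM; apply: cvgD.
  by rewrite /= gt_eqF// mulr_gt0// addr_gt0// ?rad_gt0 ?rad2_gt0.
have c4 : {for (t, t), continuous (fun z : R * R => 1 + rad_slope T z.1 z.2 ^+ 2)}.
  apply: cvgD; first exact: cvg_cst.
  by apply: (@continuous_comp _ _ _ (fun z : R * R => rad_slope T z.1 z.2) (fun x : R => x ^+ 2)) => //; exact: exprn_continuous.
have n1 : \forall z \near (t, t), 16 * z.1 ^+ 2 < T.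
  have : \forall z \near (t, t), 0 < T - 16 * z.1 ^+ 2.
    by move/cvgr_gt : c1; apply => /=; rewrite subr_gt0.
  by apply: filterS => z; rewrite subr_gt0.
have n2 : \forall z \near (t, t), `|rad T z.1 * rad T z.2 - rad T t ^+ 2| <= e.
  by move/cvgrPdist_le : c2 => /(_ e e0); apply: filterS => z; rewrite /= distrC expr2.
have n3 : \forall z \near (t, t), `|1 + rad_slope T z.1 z.2 ^+ 2 - profile_slope2 T t| <= e.
  by move/cvgrPdist_le : c4 => /(_ e e0); apply: filterS => z; rewrite /= distrC.
have : \forall z \near ((t, t) : R * R), 16 * z.1 ^+ 2 < T /\
    (`|rad T z.1 * rad T z.2 - rad T t ^+ 2| <= e /\
    `|1 + rad_slope T z.1 z.2 ^+ 2 - profile_slope2 T t| <= e).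
  by apply: filterI => //; apply: filterI.
move=> /nbhs_ballP[d /= d0 dH].
exists d => // s s' /andP[s1 s2] /andP[s1' s2'].
have B : ball (t, t) d (s, s').
  split => /=; rewrite /ball/= ltr_norml; apply/andP; split; lra.
by have [h1 [h2 h3]] := dH _ B.
Qed.

(** By [sqdist_strip] the squared distances before and after unrolling are combinations of the same
    two nonnegative terms, with coefficients that agree up to a factor [1 + e] or [1 - e] near
    height [t]. *)
Lemma hausdorff2_strip T t e : 16 * t ^+ 2 < T -> 0 < e < 1 -> exists2 d : R, 0 < d &
  forall a b, a <= b -> t - d < a -> b < t + d ->
  let C := cylinder_const R * (rad T t * Num.sqrt (profile_slope2 T t)) * (b - a) in
  ((((1 - e) * C)%:E <= hausdorff2 (strip T a b))%E /\
  (hausdorff2 (strip T a b) <= ((1 + e) * C)%:E)%E).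
Proof.
move=> tT /andP[e0 e1].
have r0 := rad_gt0 tT; have k1 := profile_slope2_ge1 T t.
have k0 : 0 < profile_slope2 T t by rewrite (lt_le_trans _ k1).
(* Both coefficients need relative precision [e]. For [profile_slope2], which is at least 1, an
   absolute error [e] is enough. *)
pose e' := Num.min (e * rad T t ^+ 2) e.
have e'0 : 0 < e' by rewrite lt_min e0 mulr_gt0// exprn_gt0.
have [d d0 H] := strip_near tT e'0.
exists d => // a b ab ta bt C.
have ab_in s : a < s <= b -> t - d < s < t + d.
  by move=> /andP[as_ sb]; rewrite (lt_trans ta as_) (le_lt_trans sb bt).
have key p q : strip T a b p -> strip T a b q ->
  (1 - e) * sqdist (unroll T t p) (unroll T t q) <= sqdist p q <= (1 + e) * sqdist (unroll T t p) (unroll T t q).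
  move=> [gp pab] [gq qab].
  have [pT H1 H2] := H _ _ (ab_in _ pab) (ab_in _ qab).
  have [qT _ _] := H _ _ (ab_in _ qab) (ab_in _ pab).
  have [w w0 [-> ->]] := sqdist_strip gp gq pT qT tT.
  have {}H1 : `|rad T p.2 * rad T q.2 - rad T t ^+ 2| <= e * rad T t ^+ 2.
    by rewrite (le_trans H1)// ge_min lexx.
  have {}H2 : `|1 + rad_slope T p.2 q.2 ^+ 2 - profile_slope2 T t| <= e * profile_slope2 T t.
    rewrite (le_trans H2)// (@le_trans _ _ e)//; first by rewrite ge_min lexx orbT.
    by rewrite -{1}[e]mulr1 ler_pM2l.
  move: H1 H2; rewrite !ler_norml => /andP[h1 h2] /andP[h3 h4].
  have v0 := sqr_ge0 (p.2 - q.2).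
  have h1' := ler_wpM2r w0 h1; have h2' := ler_wpM2r w0 h2.
  have h3' := ler_wpM2r v0 h3; have h4' := ler_wpM2r v0 h4.
  by apply/andP; split; lra.
have cylE : hausdorff2 (unroll T t @` strip T a b) = C%:E.
  rewrite unroll_strip//; last by move=> s /ab_in sd; have [] := H _ _ sd sd.
  rewrite hausdorff2_cylinder//; last by rewrite ler_wpM2l// sqrtr_ge0.
  by congr (_%:E); rewrite /C; ring.
split.
  have := @hausdorff2_lipschitz _ (unroll T t) (strip T a b) (1 - e)^-1.
  rewrite cylE invr_gt0 subr_gt0 => /(_ e1) K.
  rewrite EFinM -lee_pdivlMl ?subr_gt0//; apply: K => p q /set_mem ps /set_mem qs.
  by rewrite ler_pdivlMl ?subr_gt0//; have /andP[] := key p q ps qs.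
have := @hausdorff2_colipschitz _ (unroll T t) (strip T a b) (1 + e).
rewrite cylE -EFinM; apply; first by rewrite addr_gt0.
by move=> p q /set_mem ps /set_mem qs; have /andP[] := key p q ps qs.
Qed.

Lemma measurable_gauge4 : measurable_fun [set: Tc] (gauge4 : Tc -> R).
Proof.
have [mx my ms] := @measurable_coordinates R.
apply: measurable_funD.
  by apply: measurable_funX; apply: measurable_funD; apply: measurable_funX.
by apply: measurable_funM; [exact: measurable_cst|exact: measurable_funX].
Qed.

Lemma measurable_strip T a b : measurable (strip T a b : set Tc).
Proof.
have -> : strip T a b = (gauge4 : Tc -> R) @^-1` [set T] `&` [set p : Tc | a < p.2 <= b].
  by apply/seteqP; split => p.
apply: measurableI; last exact: measurable_slab.
rewrite -[_ @^-1` _]setTI; apply: measurable_gauge4 => //; exact: measurable_set1.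
Qed.

Lemma continuous_area_weight T t : 16 * t ^+ 2 < T -> {for t, continuous (area_weight T)}.
Proof.
move=> tT; apply: cvgM; first exact: continuous_rad2.
apply: cvgV; first by rewrite gt_eqF// sqrtr_gt0 area_weight_den.
apply: (@continuous_comp _ _ _ (fun t => rad2 T t ^+ 3 + 64 * t ^+ 2) Num.sqrt); last exact: sqrt_continuous.
apply: cvgD.
  by apply: (@continuous_comp _ _ _ (rad2 T) (fun x : R => x ^+ 3)); [exact: continuous_rad2|exact: exprn_continuous].
apply: cvgM; first exact: cvg_cst.
exact: exprn_continuous.
Qed.

Lemma area_weight_ge0 T t : 0 <= area_weight T t.
Proof. by rewrite divr_ge0// sqrtr_ge0. Qed.

Lemma measurable_rad2 T : measurable_fun [set: R] (rad2 T).
Proof. by apply: continuous_measurable_fun; exact: continuous_rad2. Qed.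

Lemma measurable_area_weight T : measurable_fun [set: R] (area_weight T).
Proof.
(* The real power with exponent -1 is measurable on the whole line and agrees with the inverse on
   nonnegative numbers, 0 included. *)
have -> : area_weight T = fun t => rad2 T t * Num.sqrt (rad2 T t ^+ 3 + 64 * t ^+ 2) `^ (-1).
  by apply/funext => t; rewrite powR_inv1 ?sqrtr_ge0.
apply: measurable_funM; first exact: measurable_rad2.
apply: (measurableT_comp (f := fun x : R => x `^ (-1))); first exact: measurable_powR.
apply: continuous_measurable_fun => t.
apply: (@continuous_comp _ _ _ (fun t => rad2 T t ^+ 3 + 64 * t ^+ 2) Num.sqrt); last exact: sqrt_continuous.
apply: cvgD.
  by apply: (@continuous_comp _ _ _ (rad2 T) (fun x : R => x ^+ 3)); [exact: continuous_rad2|exact: exprn_continuous].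
by apply: cvgM; [exact: cvg_cst|exact: exprn_continuous].
Qed.

Local Notation surf_int T G a b :=
  (\int[@H2 R]_(p in (strip T a b : set Tc)) (G p.2 * area_weight T p.2)%:E)%E.
Local Notation line_int G a b := (\int[leb]_(s in [set` `]a, b]]) (G s)%:E)%E.

(** * Weighted surface integrals of functions of the height *)

Section continuous_weight.
Variables (T : R) (G : R -> R).
Hypotheses (cG : continuous G) (G0 : forall s, 0 <= G s).

Let mG : measurable_fun [set: R] G.
Proof. exact: continuous_measurable_fun. Qed.

Let mh : measurable_fun [set: Tc] (fun p : Tc => (G p.2 * area_weight T p.2)%:E).
Proof.
have [mx my ms] := @measurable_coordinates R.
apply/measurable_EFinP; apply: (measurableT_comp (f := fun s => G s * area_weight T s)) => //.
by apply: measurable_funM => //; exact: measurable_area_weight.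
Qed.

Let h_ge0 p : 0 <= G p.2 * area_weight T p.2.
Proof. by rewrite mulr_ge0// area_weight_ge0. Qed.

Let surf_int_bound a b m M : (forall s, a < s <= b -> m <= G s * area_weight T s <= M) -> 0 <= m ->
  (m%:E * hausdorff2 (strip T a b) <= surf_int T G a b)%E /\
  (surf_int T G a b <= M%:E * hausdorff2 (strip T a b))%E.
Proof.
move=> H m0; have mS := measurable_strip T a b.
have c0 x : 0 <= x -> forall p : Tc, strip T a b p -> (0 <= cst x%:E p)%E.
  by move=> x0 p _; rewrite lee_fin.
split.
  apply: (@le_trans _ _ (\int[@H2 R]_(p in (strip T a b : set Tc)) cst m%:E p)%E).
    by rewrite (integral_cst (@H2 R) mS).
  apply: ge0_le_integral; [exact: mS|exact: c0|exact: measurable_cst|exact: measurable_funTS|].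
  by move=> p [_ /H/andP[]]; rewrite lee_fin.
apply: (@le_trans _ _ (\int[@H2 R]_(p in (strip T a b : set Tc)) cst M%:E p)%E).
  apply: ge0_le_integral; [exact: mS| |exact: measurable_funTS|exact: measurable_cst|].
    by move=> p _; rewrite lee_fin.
  by move=> p [_ /H/andP[]]; rewrite lee_fin.
by rewrite (integral_cst (@H2 R) mS).
Qed.

Let line_int_bound a b m M : a <= b -> (forall s, a < s <= b -> m <= G s <= M) ->
  ((m * (b - a))%:E <= line_int G a b)%E /\ (line_int G a b <= (M * (b - a))%:E)%E.
Proof.
move=> ab H.
have lE : (leb [set` `]a, b]] = (b - a)%:E)%E.
  rewrite lebesgue_measure_itv/= lte_fin; case: ltP => // ba.
  by have -> : a = b by [apply/eqP; rewrite eq_le ab ba]; rewrite subrr.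
have mI : measurable [set` `]a, b]] by exact: measurable_itv.
have G0' s : (0 <= (G s)%:E)%E by rewrite lee_fin.
split.
  have [m0|m0] := leP 0 m; last first.
    rewrite (@le_trans _ _ 0%E)//; last exact: integral_ge0.
    by rewrite lee_fin nmulr_rle0// subr_ge0.
  rewrite EFinM -lE -(integral_cst leb mI m%:E); apply: ge0_le_integral => //.
  - by apply: measurable_funTS; apply/measurable_EFinP.
  - by move=> s; rewrite /= in_itv/= => /H/andP[]; rewrite lee_fin.
rewrite EFinM -lE -(integral_cst leb mI M%:E); apply: ge0_le_integral => //.
- by apply: measurable_funTS; apply/measurable_EFinP.
- by move=> s; rewrite /= in_itv/= => /H/andP[]; rewrite lee_fin.
Qed.

Local Notation c := (cylinder_const R).

(** Near [t] the weight and [G] are almost constant and the strip has almost the area of its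
    cylinder; by [area_weightK] both sides are close to [c G(t) (b - a)]. *)
Let local_estimate t e : 16 * t ^+ 2 < T -> 0 < e -> exists2 d : R, 0 < d &
  forall a b, a <= b -> t - d < a -> b < t + d ->
  ((surf_int T G a b <= c%:E * line_int G a b + (e * (b - a))%:E)%E /\
  (c%:E * line_int G a b <= surf_int T G a b + (e * (b - a))%:E)%E).
Proof.
move=> tT e0.
pose J := rad T t * Num.sqrt (profile_slope2 T t).
have wJ : area_weight T t * J = 1 := area_weightK tT.
have J0 : 0 <= J by rewrite mulr_ge0 ?sqrtr_ge0.
have c0 := cylinder_const_ge0 R.
(* Freezing the weight, the strip area and [G] at [t] costs at most [e1 (G t + J + e1 J + 1)] per
   unit of [c (b - a)]; as [e1 <= 1/2] this is at most [e1 K]. *)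
pose K := G t + 2 * J + 1.
have K0 : 0 < K by rewrite ltr_wpDl// addr_ge0// mulr_ge0.
have cK0 : 0 < c * K + 1 by rewrite ltr_wpDl// mulr_ge0// ltW.
pose e1 := Num.min 2^-1 (e / (c * K + 1)).
have e10 : 0 < e1 by rewrite lt_min invr_gt0 ltr0n divr_gt0.
have e12 : e1 <= 2^-1 by rewrite ge_min lexx.
have e1K : c * (e1 * K) <= e.
  have : e1 <= e / (c * K + 1) by rewrite ge_min lexx orbT.
  rewrite ler_pdivlMr// mulrDr mulr1 mulrCA mulrCA; have := ltW e10; lra.
have [d1 d10 H1] : exists2 d : R, 0 < d & forall a b, a <= b -> t - d < a -> b < t + d ->
  let C := c * J * (b - a) in
  ((((1 - e1) * C)%:E <= hausdorff2 (strip T a b))%E /\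
  (hausdorff2 (strip T a b) <= ((1 + e1) * C)%:E)%E).
  by apply: hausdorff2_strip => //; rewrite e10 (le_lt_trans e12)// invf_lt1// ltr1n.
have : \forall s \near t, `|G t - G s| <= e1 /\ `|G t * area_weight T t - G s * area_weight T s| <= e1.
  apply: filterI; first by move/cvgrPdist_le : (@cG t) => /(_ e1 e10).
  have : {for t, continuous (fun s => G s * area_weight T s)}.
    by apply: cvgM; [exact: cG|exact: continuous_area_weight].
  by move/cvgrPdist_le => /(_ e1 e10).
move=> /nbhs_ballP[d2 /= d20 H2].
exists (Num.min d1 d2); first by rewrite lt_min d10.
move=> a b ab ta bt.
have tab s : a < s <= b -> ball t d2 s.
  move=> /andP[as_ sb]; rewrite /ball/= ltr_norml.
  have m2 : Num.min d1 d2 <= d2 by rewrite ge_min lexx orbT.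
  apply/andP; split; lra.
have [L U] : (((1 - e1) * (c * J * (b - a)))%:E <= hausdorff2 (strip T a b))%E /\
  (hausdorff2 (strip T a b) <= ((1 + e1) * (c * J * (b - a)))%:E)%E.
  have m1 : Num.min d1 d2 <= d1 by rewrite ge_min lexx.
  apply: H1 => //; lra.
set h0 := G t * area_weight T t in H2.
have h0J : h0 * J = G t by rewrite -mulrA wJ mulr1.
have h00 : 0 <= h0 by rewrite mulr_ge0// area_weight_ge0.
(* The lower bound of [surf_int_bound] has to be nonnegative, hence the truncation. *)
pose m := Num.max 0 (h0 - e1).
have m0 : 0 <= m by rewrite le_max lexx.
have mh0 : h0 - e1 <= m by rewrite le_max lexx orbT.
have [S1 S2] : (m%:E * hausdorff2 (strip T a b) <= surf_int T G a b)%E /\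
  (surf_int T G a b <= (h0 + e1)%:E * hausdorff2 (strip T a b))%E.
  apply: surf_int_bound => // s /tab/H2[_]; rewrite ler_norml => /andP[k1 k2].
  rewrite ge_max mulr_ge0 ?area_weight_ge0//=; apply/andP; split; lra.
have [L1 L2] : (((G t - e1) * (b - a))%:E <= line_int G a b)%E /\ (line_int G a b <= ((G t + e1) * (b - a))%:E)%E.
  by apply: line_int_bound => // s /tab/H2[]; rewrite ler_norml => /andP[k1 k2] _; apply/andP; split; lra.
have D0 : 0 <= b - a by rewrite subr_ge0.
have GtJ : 0 <= G t by [].
have A1 : 0 <= c * (b - a) by rewrite mulr_ge0.
have A2 := ler_wpM2r D0 e1K.
split.
  apply: (le_trans S2); apply: (@le_trans _ _ ((h0 + e1)%:E * ((1 + e1) * (c * J * (b - a)))%:E)%E).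
    by apply: lee_wpmul2l => //; rewrite lee_fin addr_ge0// ltW.
  apply: (@le_trans _ _ (c%:E * ((G t - e1) * (b - a))%:E + (e * (b - a))%:E)%E); last first.
    by apply: leeD => //; apply: lee_wpmul2l.
  rewrite -!EFinM -EFinD lee_fin.
  have -> : (h0 + e1) * ((1 + e1) * (c * J * (b - a))) =
    (h0 * J + e1 * (h0 * J) + e1 * J + e1 * e1 * J) * (c * (b - a)) by ring.
  rewrite h0J.
  have : (G t + e1 * G t + e1 * J + e1 * e1 * J) * (c * (b - a)) <= (G t - e1 + e1 * K) * (c * (b - a)).
    apply: ler_wpM2r => //; rewrite /K.
    have : e1 * (e1 * J) <= 2^-1 * (e1 * J) by rewrite ler_wpM2r// mulr_ge0// ltW.
    have : 0 <= e1 * J by rewrite mulr_ge0// ltW.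
    lra.
  lra.
apply: (@le_trans _ _ (c%:E * ((G t + e1) * (b - a))%:E)%E); first by apply: lee_wpmul2l.
apply: (@le_trans _ _ (m%:E * ((1 - e1) * (c * J * (b - a)))%:E + (e * (b - a))%:E)%E); last first.
  by apply: leeD => //; apply: le_trans S1; apply: lee_wpmul2l.
rewrite -!EFinM -EFinD lee_fin.
have B1 : (h0 - e1) * ((1 - e1) * (c * J * (b - a))) <= m * ((1 - e1) * (c * J * (b - a))).
  apply: ler_wpM2r => //; rewrite mulr_ge0//; last by rewrite mulr_ge0// mulr_ge0.
  lra.
have E1 : (h0 - e1) * ((1 - e1) * (c * J * (b - a))) =
    (h0 * J - e1 * (h0 * J) - e1 * J + e1 * e1 * J) * (c * (b - a)) by ring.
rewrite E1 h0J in B1.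
have : (G t + e1) * (c * (b - a)) <= (G t - e1 * G t - e1 * J + e1 * e1 * J + e1 * K) * (c * (b - a)).
  apply: ler_wpM2r => //; rewrite /K.
  have := mulr_ge0 (mulr_ge0 (ltW e10) (ltW e10)) J0.
  have : 0 <= e1 * J by rewrite mulr_ge0// ltW.
  lra.
lra.
Qed.

Let surf_intD x y z : x <= y -> y <= z ->
  surf_int T G x z = (surf_int T G x y + surf_int T G y z)%E.
Proof.
move=> xy yz.
have E : (strip T x z : set Tc) = strip T x y `|` strip T y z.
  apply/seteqP; split => [p [/= h /andP[p0 pst]]|p [[/= h /andP[p0 pst]]|[/= h /andP[p0 pst]]]].
  - by have [ps|ps] := leP p.2 y; [left|right]; split => //=; rewrite ?p0 ?ps.
  - by split => //=; rewrite p0 (le_trans pst).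
  - by split => //=; rewrite pst andbT (le_lt_trans xy).
rewrite E; apply: ge0_integral_setU; [exact: measurable_strip|exact: measurable_strip|exact: measurable_funTS| |].
  by move=> p _; rewrite lee_fin.
apply/disj_set2P/seteqP; split => // p [[_ /andP[_ /= p1]] [_ /andP[/= p2 _]]].
by have := le_lt_trans p1 p2; rewrite ltxx.
Qed.

Let line_intD x y z : x <= y -> y <= z ->
  line_int G x z = (line_int G x y + line_int G y z)%E.
Proof.
move=> xy yz.
have E : [set` `]x, z]] = [set` `]x, y]] `|` [set` `]y, z]].
  apply/seteqP; split => [p /=|p [/=|/=]]; rewrite ?in_itv/=.
  - by move=> /andP[p0 p1]; have [ps|ps] := leP p y; [left|right]; rewrite ?p0 ?ps.
  - by move=> /andP[-> /le_trans]; apply.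
  - by move=> /andP[/(le_lt_trans xy) ->].
rewrite E; apply: ge0_integral_setU; [exact: measurable_itv|exact: measurable_itv| | |].
- by apply: measurable_funTS; apply/measurable_EFinP.
- by move=> p _; rewrite lee_fin.
apply/disj_set2P/seteqP; split => // p [/=]; rewrite !in_itv/= => /andP[_ p1] /andP[p2 _].
by have := le_lt_trans p1 p2; rewrite ltxx.
Qed.

(** An error proportional to the length is additive over adjacent intervals, which is the stability
    that [interval_induction] asks for. *)
Let estimate a b e : a <= b -> 16 * a ^+ 2 < T -> 16 * b ^+ 2 < T -> 0 < e ->
  ((surf_int T G a b <= c%:E * line_int G a b + (e * (b - a))%:E)%E /\
  (c%:E * line_int G a b <= surf_int T G a b + (e * (b - a))%:E)%E).
Proof.
move=> ab aT bT e0.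
have li0 x y : (0 <= line_int G x y)%E by apply: integral_ge0 => s _; rewrite lee_fin.
apply: (interval_induction (P := fun a b =>
  (surf_int T G a b <= c%:E * line_int G a b + (e * (b - a))%:E)%E /\
  (c%:E * line_int G a b <= surf_int T G a b + (e * (b - a))%:E)%E) ab).
  move=> x y z _ xy yz _ [h1 h2] [h3 h4].
  rewrite (surf_intD xy yz) (line_intD xy yz) ge0_muleDr//.
  have -> : e * (z - x) = e * (y - x) + e * (z - y) by ring.
  rewrite EFinD; split; rewrite [leRHS]addeACA.
    by apply: leeD; [exact: h1|exact: h3].
  by apply: leeD; [exact: h2|exact: h4].
move=> t /andP[at_ tb].
have tT : 16 * t ^+ 2 < T.
  have [t0|t0] := leP 0 t.
    by apply: le_lt_trans bT; rewrite ler_pM2l// ler_pXn2r// nnegrE (le_trans t0).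
  apply: le_lt_trans aT; rewrite ler_pM2l// -(sqrrN t) -(sqrrN a) ler_pXn2r ?nnegrE ?oppr_ge0 ?lerN2// ltW//.
  exact: le_lt_trans t0.
have [d d0 H] := local_estimate tT e0.
by exists d => // x y _ xy _; exact: H.
Qed.

Lemma surf_int_strip a b : a <= b -> 16 * a ^+ 2 < T -> 16 * b ^+ 2 < T ->
  surf_int T G a b = (c%:E * line_int G a b)%E.
Proof.
move=> ab aT bT.
have pos e : 0 < e -> 0 < e / (b - a + 1).
  by move=> e0; rewrite divr_gt0// ltr_wpDl// subr_ge0.
have lee e : 0 < e -> e / (b - a + 1) * (b - a) <= e.
  move=> e0; have d0 : 0 < b - a + 1 by rewrite ltr_wpDl// subr_ge0.
  by rewrite mulrAC ler_pdivrMr// ler_pM2l// lerDl.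
apply/eqP; rewrite eq_le; apply/andP; split; apply/lee_addgt0Pr => e e0.
  have [+ _] := estimate ab aT bT (pos _ e0) => /le_trans; apply.
  by apply: leeD => //; rewrite lee_fin lee.
have [_ +] := estimate ab aT bT (pos _ e0) => /le_trans; apply.
by apply: leeD => //; rewrite lee_fin lee.
Qed.

(** Unrolling degenerates at the poles, so the identity is known on strips that stay away from them
    and passes to the limit by monotone convergence on both sides. *)
Lemma surf_int_total : 0 < T ->
  (\int[@H2 R]_(p in (punctured_sphere T : set Tc)) (G p.2 * area_weight T p.2)%:E =
   c%:E * \int[leb]_(s in height_range T) (G s)%:E)%E.
Proof.
move=> T0.
(* The poles of the sphere lie at heights [L] and [- L], and [l n] increases to [L]. *)
pose L := Num.sqrt T / 4.
have L0 : 0 < L by rewrite divr_gt0// sqrtr_gt0.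
have LT : T = 16 * L ^+ 2.
  by rewrite /L expr_div_n sqr_sqrtr ?ltW//; field.
pose l (n : nat) : R := L * (1 - n.+1%:R^-1).
have l0 n : 0 <= l n by rewrite mulr_ge0 ?(ltW L0)// subr_ge0 invf_le1// ler1n.
have lL n : l n < L by rewrite gtr_pMr// ltrBlDr ltrDl.
have lT n : 16 * l n ^+ 2 < T by rewrite LT ltr_pM2l// ltr_pXn2r ?nnegrE// ltW.
have lnd m n : (m <= n)%N -> l m <= l n.
  move=> mn; rewrite ler_pM2l// lerD2l lerN2 lef_pV2 ?posrE// ler_nat//.
have lex s : 16 * s ^+ 2 < T -> exists n, `|s| < l n.
  rewrite LT ltr_pM2l// => sL.
  have {}sL : `|s| < L by rewrite -(ltr_pXn2r (n:=2)) ?nnegrE ?(ltW L0)// real_normK ?num_real.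
  have d0 : 0 < 1 - `|s| / L by rewrite subr_gt0 ltr_pdivrMr// mul1r.
  exists (Num.truncn (1 - `|s| / L)^-1).
  rewrite /l mulrC -ltr_pdivrMr// ltrBrDr -ltrBrDl -[ltRHS]invrK ltf_pV2 ?posrE ?invr_gt0//.
  exact: truncnS_gt.
have cvS : (\int[@H2 R]_(p in (strip T (- l n) (l n) : set Tc)) (G p.2 * area_weight T p.2)%:E @[n --> \oo] -->
  \int[@H2 R]_(p in (\bigcup_n (strip T (- l n) (l n)) : set Tc)) (G p.2 * area_weight T p.2)%:E)%E.
  apply: ge0_nondecreasing_set_cvg_integral.
  - move=> m n mn; apply/subsetPset => p [h /andP[h1 h2]]; split => //.
    by rewrite (le_trans h2 (lnd _ _ mn)) andbT (le_lt_trans _ h1)// lerN2 lnd.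
  - by move=> n; exact: measurable_strip.
  - by move=> n; exact: measurable_funTS.
  - by move=> n p _; rewrite lee_fin.
pose I n : set R := [set` `](- l n), (l n)]].
have cvL : (\int[leb]_(s in I n) (G s)%:E @[n --> \oo] --> \int[leb]_(s in \bigcup_n I n) (G s)%:E)%E.
  apply: ge0_nondecreasing_set_cvg_integral.
  - move=> m n mn; apply/subsetPset => p; rewrite /I/= !in_itv/= => /andP[h1 h2].
    by rewrite (le_trans h2 (lnd _ _ mn)) andbT (le_lt_trans _ h1)// lerN2 lnd.
  - by move=> n; exact: measurable_itv.
  - by move=> n; apply: measurable_funTS; apply/measurable_EFinP.
  - by move=> n p _; rewrite lee_fin.
have ES : punctured_sphere T = \bigcup_n (strip T (- l n) (l n)).
  apply/seteqP; split => [p [gp /lex[n]]|p [n _ [gp /andP[h1 h2]]]].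
    by rewrite ltr_norml => /andP[h1 h2]; exists n => //; split => //; rewrite h1 ltW.
  split => //; apply: le_lt_trans (lT n); rewrite ler_pM2l// -[leLHS]real_normK ?num_real//.
  by rewrite ler_pXn2r ?nnegrE// ler_norml h2 ltW.
have EL : height_range T = \bigcup_n I n.
  apply/seteqP; split => [s /lex[n]|s [n _]].
    by rewrite ltr_norml => /andP[h1 h2]; exists n => //; rewrite /I/= in_itv/= h1 ltW.
  rewrite /I/= in_itv/= => /andP[h1 h2].
  rewrite /height_range/=; apply: le_lt_trans (lT n); rewrite ler_pM2l// -[leLHS]real_normK ?num_real//.
  by rewrite ler_pXn2r ?nnegrE// ler_norml h2 ltW.
rewrite ES EL; have /cvg_lim <- // := cvS.
rewrite (_ : (fun n => _) = (fun n => c%:E * \int[leb]_(s in I n) (G s)%:E)%E); last first.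
  apply/funext => n; rewrite surf_int_strip ?sqrrN//.
  by rewrite (le_trans _ (l0 n))// oppr_le0.
by apply/cvg_lim => //; exact: cvgeZl.
Qed.

End continuous_weight.

End sphere.

(** * Horizontal derivatives and test functions *)

Section bump.
Variable R : realType.
Implicit Types (t : R) (k : nat).

(** [exp_bump 0] is the usual cutoff [exp (-1 / (1 - t))]. The extra powers make the family closed
    under differentiation up to linear combinations, so smoothness can be followed algebraically. *)
Definition exp_bump k t : R :=
  if t < 1 then (1 - t)^-1 ^+ k * expR (- (1 - t)^-1) else 0.

Lemma bump_ge0 k t : 0 <= exp_bump k t.
Proof.
rewrite /exp_bump; case: ifPn => // t1.
by rewrite mulr_ge0 ?expR_ge0// exprn_ge0// invr_ge0 subr_ge0 ltW.
Qed.

Lemma bump_eq0 k t : 1 <= t -> exp_bump k t = 0.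
Proof. by rewrite /exp_bump ltNge => ->. Qed.

(** The exponential dominates the term of order [k + n + 1] of its series at [1 / (1 - t)]. The case
    [n = 1] yields the derivative at the junction [t = 1], the case [n = 0] uniform bounds. *)
Lemma bump_le k n t : exp_bump k t <= (k + n.+1)`!%:R * `|1 - t| ^+ n.+1.
Proof.
have F0 : 0 < (k + n.+1)`!%:R :> R by rewrite ltr0n fact_gt0.
rewrite /exp_bump; case: ifPn => t1; last by rewrite mulr_ge0// ltW.
have d0 : 0 < 1 - t by rewrite subr_gt0.
have i0 : 0 < (1 - t)^-1 by rewrite invr_gt0.
rewrite (gtr0_norm d0).
have : (1 - t)^-1 ^+ (k + n.+1) / (k + n.+1)`!%:R <= expR (1 - t)^-1.
  have := @expR_ge1Dxn R (1 - t)^-1 (k + n) (ltW i0); rewrite addnS; apply: le_trans.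
  by rewrite lerDr.
rewrite expRN => H.
have E0 := expR_gt0 (1 - t)^-1.
rewrite ler_pdivrMr// -mulrA mulrC.
move: H; rewrite exprD ler_pdivrMr// => H.
have := ler_wpM2r (exprn_ge0 n.+1 (ltW d0)) H.
rewrite -mulrA -exprMn mulVf ?gt_eqF// expr1n mulr1 => /le_trans; apply.
by rewrite le_eqVlt; apply/orP; left; apply/eqP; ring.
Qed.

(** Serves the junction [t = 1] of [exp_bump], which is not covered by the formulas on either
    side. *)
Lemma is_derive_quadratic (f : R -> R) (a C : R) : (forall h, `|f (a + h)| <= C * h ^+ 2) ->
  is_derive a 1 f 0.
Proof.
move=> fC.
have fa : f a = 0.
  by apply/eqP; rewrite -normr_le0; have := fC 0; rewrite addr0 expr0n/= mulr0.
have C0 : 0 <= C by have := fC 1; rewrite expr1n mulr1; apply: le_trans.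
have H : h^-1 *: (f (h *: 1 + a) - f a) @[h --> 0^'] --> (0 : R).
  apply/cvgr0Pnorm_le => e e0; near=> h.
  have h0 : h != 0 by near: h; exact: nbhs_dnbhs_neq.
  rewrite fa subr0 normrZ normfV ler_pdivrMl ?normr_gt0// addrC.
  rewrite [h *: 1]mulr1; apply: le_trans (fC h) _.
  rewrite -real_normK ?num_real// expr2 mulrCA ler_wpM2l//.
  have : `|h| <= e / (C + 1).
    near: h; apply: dnbhs0_le; rewrite divr_gt0// ltr_wpDl//.
  rewrite ler_pdivlMr ?ltr_wpDl// => hC; apply: le_trans hC.
  by rewrite mulrC ler_wpM2l// lerDl.
by split; [apply/cvg_ex; exists 0|exact/cvg_lim].
Unshelve. all: by end_near. Qed.

Lemma is_derive_bump k t : is_derive t 1 (exp_bump k) (k%:R * exp_bump k.+1 t - exp_bump k.+2 t).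
Proof.
have [t1|t1|->] := ltgtP t 1.
- apply: (@near_eq_is_derive _ _ _ (fun t => (1 - t)^-1 ^+ k * expR (- (1 - t)^-1))) => //.
    near=> s; rewrite /exp_bump ifT//; near: s; exact: lt_nbhsl.
  have d0 : 1 - t != 0 by rewrite subr_eq0 gt_eqF.
  rewrite /exp_bump t1.
  have dV : is_derive t 1 (fun t => (1 - t)^-1) ((1 - t)^-1 ^+ 2).
    have : is_derive t 1 (fun t => 1 - t) (-1 : R).
      apply: (@is_derive_eq _ _ _ ((cst 1 : R -> R) - id) _ _ _ (0 - 1)); last by rewrite sub0r.
    move=> h; have H := @is_deriveV _ (fun t => 1 - t) _ _ _ d0 h.
    by apply: is_derive_eq H _; rewrite /GRing.scale/= mulrN1 opprK exprVn.
  have dX : is_derive t 1 (fun t => (1 - t)^-1 ^+ k) (k%:R * (1 - t)^-1 ^+ k.+1).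
    have H := @is_deriveX _ _ (fun t : R => (1 - t)^-1) k _ _ _ dV.
    rewrite (_ : (fun t => _) = (fun t : R => (1 - t)^-1) ^+ k); last by apply/funext => s; rewrite exprfctE.
    apply: is_derive_eq H _.
    case: k => [|k]; first by rewrite !mul0r scale0r.
    by rewrite /GRing.scale/= !exprS; ring.
  have dE : is_derive t 1 (fun t => expR (- (1 - t)^-1)) (- (1 - t)^-1 ^+ 2 * expR (- (1 - t)^-1)).
    have H : is_derive t 1 (fun t => - (1 - t)^-1) (- (1 - t)^-1 ^+ 2) by apply: is_deriveN.
    have := @is_derive1_comp _ expR (fun t => - (1 - t)^-1) t _ _ _ H.
    by move=> K; apply: is_derive_eq; rewrite mulrC.
  by apply: (is_derive_eq (is_deriveM dX dE)); rewrite /GRing.scale/= !exprS; ring.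
- rewrite !bump_eq0 ?ltW// mulr0 subr0.
  apply: (@near_eq_is_derive _ _ _ (cst 0)) => //.
    near=> s; rewrite bump_eq0// ltW//; near: s; exact: lt_nbhsr.
- rewrite !bump_eq0// mulr0 subr0; apply: (@is_derive_quadratic _ _ ((k + 2)`!%:R)) => h.
  rewrite ger0_norm ?bump_ge0//; apply: le_trans (bump_le k 1 _) _.
  by rewrite opprD addrA subrr sub0r normrN real_normK ?num_real.
Unshelve. all: by end_near. Qed.

Lemma continuous_bump k : continuous (exp_bump k).
Proof.
by move=> t; apply/differentiable_continuous/derivable1_diffP; have [] := is_derive_bump k t.
Qed.

End bump.

(** * Directional derivatives, smoothness and horizontal derivatives *)

Section directional.
Variable R : realType.
Implicit Types (u w : heis R -> R) (du dw : heis R -> heis R -> R) (g v : heis R).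

(** Differentiability is carried along because the chain rule for directional derivatives needs it.
    The direction comes first so that each [du v] is again a function to be differentiated. *)
Definition has_directional u du := forall g, differentiable u g /\ forall v, 'D_v u g = du v g.

Lemma has_directional_cst (c : R) : has_directional (fun=> c) (fun _ _ => 0).
Proof. by move=> g; split=> [//|v]; rewrite derive_cst. Qed.

Let has_directional_linear (l : heis R -> R) : linear l -> continuous l ->
  has_directional l (fun v _ => l v).
Proof.
move=> ll cl g.
pose lM := GRing.isLinear.Build _ _ _ _ _ ll.
pose lL : {linear heis R -> R} := HB.pack l lM.
have dl : differentiable lL g by exact: linear_differentiable.
by split => // v; rewrite deriveE// (@diff_lin _ _ _ lL).
Qed.

Lemma continuous_x : continuous (fun g : heis R => g.1.1).
Proof. by move=> g; apply: (@continuous_comp _ _ _ fst fst); exact: cvg_fst. Qed.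

Lemma continuous_y : continuous (fun g : heis R => g.1.2).
Proof. by move=> g; apply: (@continuous_comp _ _ _ fst snd); [exact: cvg_fst|exact: cvg_snd]. Qed.

Lemma continuous_s : continuous (fun g : heis R => g.2).
Proof. by move=> g; exact: cvg_snd. Qed.

Lemma has_directional_x : has_directional (fun g => g.1.1) (fun v _ => v.1.1).
Proof. by apply: has_directional_linear => //; exact: continuous_x. Qed.

Lemma has_directional_y : has_directional (fun g => g.1.2) (fun v _ => v.1.2).
Proof. by apply: has_directional_linear => //; exact: continuous_y. Qed.

Lemma has_directional_s : has_directional (fun g => g.2) (fun v _ => v.2).
Proof. by apply: has_directional_linear => //; exact: continuous_s. Qed.

Lemma has_directionalD u w du dw : has_directional u du -> has_directional w dw ->
  has_directional (fun g => u g + w g) (fun v g => du v g + dw v g).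
Proof.
move=> hu hw g; have [du1 du2] := hu g; have [dw1 dw2] := hw g.
split; first exact: differentiableD.
by move=> v; rewrite -du2 -dw2 -deriveD//; exact: diff_derivable.
Qed.

Lemma has_directionalM u w du dw : has_directional u du -> has_directional w dw ->
  has_directional (fun g => u g * w g) (fun v g => u g * dw v g + du v g * w g).
Proof.
move=> hu hw g; have [du1 du2] := hu g; have [dw1 dw2] := hw g.
split; first exact: differentiableM.
move=> v; rewrite -du2 -dw2 -[LHS]/('D_v (u * w) g) deriveM; [|exact: diff_derivable|exact: diff_derivable].
by rewrite /GRing.scale/= (mulrC ('D_v u g)).
Qed.

Lemma has_directional_comp (F : R -> R) (dF : R -> R) u du : has_directional u du ->
  (forall g, is_derive (u g) 1 F (dF (u g))) ->
  has_directional (fun g => F (u g)) (fun v g => dF (u g) * du v g).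
Proof.
move=> hu hF g; have [du1 du2] := hu g; have [F1 F2] := hF g.
have dF1 : differentiable F (u g) by apply/derivable1_diffP.
have dFu : differentiable (F \o u) g by exact: differentiable_comp.
split => // v.
rewrite -[LHS]/('D_v (F \o u) g) deriveE// diff_comp// -du2 [in RHS]deriveE//=.
by rewrite diff1E// derive1E F2 mulrC.
Qed.

(** Given by generators so that closure under derivatives is proved by induction. *)
Inductive polynomial_fun : (heis R -> R) -> Prop :=
| poly_cst c : polynomial_fun (fun=> c)
| poly_x : polynomial_fun (fun g => g.1.1)
| poly_y : polynomial_fun (fun g => g.1.2)
| poly_s : polynomial_fun (fun g => g.2)
| poly_add u w : polynomial_fun u -> polynomial_fun w -> polynomial_fun (fun g => u g + w g)
| poly_mul u w : polynomial_fun u -> polynomial_fun w -> polynomial_fun (fun g => u g * w g).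

Definition closed_directional (C : (heis R -> R) -> Prop) u :=
  exists2 du, has_directional u du & forall v, C (du v).

Lemma poly_directional u : polynomial_fun u -> closed_directional polynomial_fun u.
Proof.
elim=> {u} [c||||u w pu [du hu cu] pw [dw hw cw]|u w pu [du hu cu] pw [dw hw cw]].
- by exists (fun _ _ => 0); [exact: has_directional_cst|move=> v; exact: poly_cst].
- by exists (fun v _ => v.1.1); [exact: has_directional_x|move=> v; exact: poly_cst].
- by exists (fun v _ => v.1.2); [exact: has_directional_y|move=> v; exact: poly_cst].
- by exists (fun v _ => v.2); [exact: has_directional_s|move=> v; exact: poly_cst].
- by exists (fun v g => du v g + dw v g); [exact: has_directionalD|move=> v; exact: poly_add].
- exists (fun v g => u g * dw v g + du v g * w g); first exact: has_directionalM.
  by move=> v; apply: poly_add; apply: poly_mul.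
Qed.

Section cutoff_class.
Variables (Q : heis R -> R) (c : R).
Hypotheses (pQ : polynomial_fun Q) (Q0 : forall g, 0 < Q g).

(* This class is closed under directional derivatives, hence consists of smooth functions. *)
Inductive cutoff_fun : (heis R -> R) -> Prop :=
| cutoff_poly u : polynomial_fun u -> cutoff_fun u
| cutoff_bump k : cutoff_fun (fun g => exp_bump k (Q g * c))
| cutoff_inv : cutoff_fun (fun g => (Q g)^-1)
| cutoff_isqrt : cutoff_fun (fun g => (Num.sqrt (Q g))^-1)
| cutoff_add u w : cutoff_fun u -> cutoff_fun w -> cutoff_fun (fun g => u g + w g)
| cutoff_mul u w : cutoff_fun u -> cutoff_fun w -> cutoff_fun (fun g => u g * w g).

Lemma is_derive_inv (x : R) : 0 < x -> is_derive x 1 (fun x : R => x^-1) (- (x^-1 * x^-1)).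
Proof.
move=> x0; have xn0 : x != 0 by rewrite gt_eqF.
have H := @is_deriveV _ id _ _ _ xn0 (@is_derive_id _ _ x (1 : R)).
by apply: is_derive_eq H _; rewrite /GRing.scale/= mulr1 expr2 invfM.
Qed.

Lemma is_derive_isqrt (x : R) : 0 < x -> is_derive x 1 (fun x : R => (Num.sqrt x)^-1)
  (- 2^-1 * (x^-1 * (Num.sqrt x)^-1)).
Proof.
move=> x0; have sx0 : 0 < Num.sqrt x by rewrite sqrtr_gt0.
have xn0 : Num.sqrt x != 0 by rewrite gt_eqF.
have H := @is_deriveV _ Num.sqrt _ _ _ xn0 (@is_derive1_sqrt _ x x0).
apply: is_derive_eq H _; rewrite /GRing.scale/=.
have -> : x^-1 = (Num.sqrt x ^+ 2)^-1 by rewrite sqr_sqrtr// ltW.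
by field.
Qed.

Lemma cutoff_directional u : cutoff_fun u -> closed_directional cutoff_fun u.
Proof.
have [dQ hQ cQ] := poly_directional pQ.
elim=> {u} [u pu|k||| u w pu [du hu cu] pw [dw hw cw]|u w pu [du hu cu] pw [dw hw cw]].
- have [du hu cu] := poly_directional pu.
  by exists du => // v; exact: cutoff_poly.
- have hQc := has_directionalM hQ (has_directional_cst c).
  have H := has_directional_comp (dF := fun t => k%:R * exp_bump k.+1 t - exp_bump k.+2 t) hQc (fun g => is_derive_bump k (Q g * c)).
  exists (fun v g => (k%:R * exp_bump k.+1 (Q g * c) + (-1) * exp_bump k.+2 (Q g * c)) * (Q g * 0 + dQ v g * c)).
    move=> g; have [H1 H2] := H g; split=> // v; rewrite H2; ring.
  move=> v; apply: cutoff_mul.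
    apply: cutoff_add; apply: cutoff_mul; try exact: cutoff_bump; apply: cutoff_poly; exact: poly_cst.
  apply: cutoff_poly; apply: poly_add; apply: poly_mul => //; exact: poly_cst.
- exists (fun v g => - 1 * ((Q g)^-1 * (Q g)^-1) * dQ v g).
    move=> g; have [H1 H2] := has_directional_comp (dF := fun x => - (x^-1 * x^-1)) hQ (fun g => is_derive_inv (Q0 g)) g.
    by split=> // v; rewrite H2 mulN1r.
  move=> v; apply: cutoff_mul; last exact: cutoff_poly.
  by apply: cutoff_mul; [apply: cutoff_poly; exact: poly_cst|apply: cutoff_mul; exact: cutoff_inv].
- exists (fun v g => - 2^-1 * ((Q g)^-1 * (Num.sqrt (Q g))^-1) * dQ v g).
    move=> g; have [H1 H2] := has_directional_comp (dF := fun x => - 2^-1 * (x^-1 * (Num.sqrt x)^-1)) hQ (fun g => is_derive_isqrt (Q0 g)) g.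
    by split.
  move=> v; apply: cutoff_mul; last exact: cutoff_poly.
  apply: cutoff_mul; first by apply: cutoff_poly; exact: poly_cst.
  by apply: cutoff_mul; [exact: cutoff_inv|exact: cutoff_isqrt].
- by exists (fun v g => du v g + dw v g); [exact: has_directionalD|move=> v; exact: cutoff_add].
- exists (fun v g => u g * dw v g + du v g * w g); first exact: has_directionalM.
  by move=> v; apply: cutoff_add; apply: cutoff_mul.
Qed.

Lemma cutoff_smooth u : cutoff_fun u -> smooth u.
Proof.
move=> cu vs.
suff : cutoff_fun (foldr (fun v u => 'D_v u) u vs).
  by move=> /cutoff_directional[du + _] g => /(_ g)[].
elim: vs => [//|v vs IH] /=.
have [du hu cdu] := cutoff_directional IH.
by rewrite (_ : 'D_v _ = du v)//; apply/funext => g; have [_ ->] := hu g.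
Qed.

End cutoff_class.

(** Pairs [u] with candidates for [X1 u] and [X2 u]. Derivatives are assembled by the rules below
    and matched with the expected formulas by [ring] or [field]. *)
Definition horizontal u (a b : heis R -> R) := exists2 du, has_directional u du &
  forall g, a g = du (1, 0, 0) g - g.1.2 / 2 * du (0, 0, 1) g /\
            b g = du (0, 1, 0) g + g.1.1 / 2 * du (0, 0, 1) g.

Lemma horizontalE u a b : horizontal u a b -> X1 u = a /\ X2 u = b.
Proof.
move=> [du hu H]; split; apply/funext => g; have [Ha Hb] := H g; have [_ E] := hu g;
by rewrite ?Ha ?Hb /X1 /X2 /d_x /d_y /d_s !E.
Qed.

Lemma horizontal_cst c : horizontal (fun=> c) (fun=> 0) (fun=> 0).
Proof.
exists (fun _ _ => 0); first exact: has_directional_cst.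
by move=> g; rewrite !mulr0 subr0 addr0.
Qed.

Lemma horizontal_x : horizontal (fun g => g.1.1) (fun=> 1) (fun=> 0).
Proof.
exists (fun v _ => v.1.1); first exact: has_directional_x.
by move=> g /=; rewrite !mulr0 subr0 addr0.
Qed.

Lemma horizontal_y : horizontal (fun g => g.1.2) (fun=> 0) (fun=> 1).
Proof.
exists (fun v _ => v.1.2); first exact: has_directional_y.
by move=> g /=; rewrite !mulr0 subr0 addr0.
Qed.

Lemma horizontal_s : horizontal (fun g => g.2) (fun g => - (g.1.2 / 2)) (fun g => g.1.1 / 2).
Proof.
exists (fun v _ => v.2); first exact: has_directional_s.
by move=> g /=; rewrite !mulr1 sub0r add0r.
Qed.

Lemma horizontalD u w a b a' b' : horizontal u a b -> horizontal w a' b' ->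
  horizontal (fun g => u g + w g) (fun g => a g + a' g) (fun g => b g + b' g).
Proof.
move=> [du hu H] [dw hw H']; exists (fun v g => du v g + dw v g); first exact: has_directionalD.
by move=> g; have [-> ->] := H g; have [-> ->] := H' g; split; ring.
Qed.

Lemma horizontalM u w a b a' b' : horizontal u a b -> horizontal w a' b' ->
  horizontal (fun g => u g * w g) (fun g => u g * a' g + a g * w g) (fun g => u g * b' g + b g * w g).
Proof.
move=> [du hu H] [dw hw H']; exists (fun v g => u g * dw v g + du v g * w g); first exact: has_directionalM.
by move=> g; have [-> ->] := H g; have [-> ->] := H' g; split; ring.
Qed.

Lemma horizontal_comp (F dF : R -> R) u a b : horizontal u a b ->
  (forall g, is_derive (u g) 1 F (dF (u g))) ->
  horizontal (fun g => F (u g)) (fun g => dF (u g) * a g) (fun g => dF (u g) * b g).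
Proof.
move=> [du hu H] hF; exists (fun v g => dF (u g) * du v g); first exact: has_directional_comp.
by move=> g; have [-> ->] := H g; split; ring.
Qed.

Lemma horizontal_eq u w a b a' b' : horizontal u a b -> u =1 w -> a =1 a' -> b =1 b' ->
  horizontal w a' b'.
Proof. by move=> h /funext <- /funext <- /funext <-. Qed.

Lemma horizontalX u a b n : horizontal u a b ->
  horizontal (fun g => u g ^+ n) (fun g => n%:R * u g ^+ n.-1 * a g) (fun g => n%:R * u g ^+ n.-1 * b g).
Proof.
move=> hu; elim: n => [|n IH].
  by apply: horizontal_eq (horizontal_cst 1) _ _ _ => g; rewrite ?expr0// !mul0r.
apply: horizontal_eq (horizontalM hu IH) _ _ _ => g; first by rewrite exprS.
- by case: n {IH} => [|n]; rewrite /= ?expr0 ?mul0r ?mulr0 ?add0r ?mul1r ?mulr1// -[in RHS]natr1 exprS; ring.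
- by case: n {IH} => [|n]; rewrite /= ?expr0 ?mul0r ?mulr0 ?add0r ?mul1r ?mulr1// -[in RHS]natr1 exprS; ring.
Qed.

Definition cubic_harmonic : heis R -> R := fun g => g.1.1 + 6 * g.1.2 * g.2 - g.1.1 ^+ 3.

Lemma horizontal_cubic : horizontal cubic_harmonic
  (fun g => 1 - 3 * planar_sq g) (fun g => 6 * g.2 + 3 * (g.1.1 * g.1.2)).
Proof.
apply: horizontal_eq (horizontalD (horizontalD horizontal_x
  (horizontalM (horizontalM (horizontal_cst 6) horizontal_y) horizontal_s))
  (horizontalM (horizontal_cst (-1)) (horizontalX 3 horizontal_x))) _ _ _ => g /=;
  rewrite /cubic_harmonic /planar_sq; by [ring|field].
Qed.

Lemma horizontal_planar_sq : horizontal (@planar_sq R) (fun g => 2 * g.1.1) (fun g => 2 * g.1.2).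
Proof.
by apply: horizontal_eq (horizontalD (horizontalX 2 horizontal_x) (horizontalX 2 horizontal_y)) _ _ _
  => g /=; rewrite /planar_sq; ring.
Qed.

Lemma sublaplacian_cubic g : sublaplacian cubic_harmonic g = 0.
Proof.
rewrite /sublaplacian; have [-> ->] := horizontalE horizontal_cubic.
have [-> _] : X1 (fun g => 1 - 3 * planar_sq g) = (fun g => -6 * g.1.1) /\ X2 (fun g => 1 - 3 * planar_sq g) = (fun g => -6 * g.1.2).
  apply: horizontalE; apply: horizontal_eq (horizontalD (horizontal_cst 1)
    (horizontalM (horizontal_cst (-3)) horizontal_planar_sq)) _ _ _ => k /=; ring.
have [_ ->] : X1 (fun g => 6 * g.2 + 3 * (g.1.1 * g.1.2)) = (fun g => 0) /\
   X2 (fun g => 6 * g.2 + 3 * (g.1.1 * g.1.2)) = (fun g => 6 * g.1.1).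
  apply: horizontalE; apply: horizontal_eq (horizontalD (horizontalM (horizontal_cst 6) horizontal_s)
    (horizontalM (horizontal_cst 3) (horizontalM horizontal_x horizontal_y))) _ _ _ => k /=; by [ring|field].
ring.
Qed.

Lemma horizontal_grad_norm_cubic g : horizontal_grad_norm cubic_harmonic g ^+ 2 =
  (1 - 3 * planar_sq g) ^+ 2 + (6 * g.2 + 3 * (g.1.1 * g.1.2)) ^+ 2.
Proof.
rewrite /horizontal_grad_norm sqr_sqrtr ?addr_ge0 ?sqr_ge0//.
by have [-> ->] := horizontalE horizontal_cubic.
Qed.

(** * The regularised, translated test function and its sublaplacian *)

Section translated_gauge.
Variables (h : heis R) (e c : R).
Hypothesis e0 : 0 < e.

(* The coordinates of [h^-1 g]. *)
Definition left_translate (g : heis R) : heis R :=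
  ((g.1.1 - h.1.1, g.1.2 - h.1.2), g.2 - h.2 - (h.1.1 * g.1.2 - h.1.2 * g.1.1) / 2).

(** Adding [e] to [|z|^2], and not to the whole gauge, keeps the algebra exact: the negative
    sublaplacian of [reg_gauge4^(-1/2)] is the positive function [4 e reg_gauge4^(-3/2)]. *)
Definition reg_gauge4 (k : heis R) : R := (planar_sq k + e) ^+ 2 + 16 * k.2 ^+ 2.

Lemma reg_gauge4_gt0 k : 0 < reg_gauge4 k.
Proof.
apply: ltr_pwDl; last by rewrite mulr_ge0 ?sqr_ge0.
by rewrite exprn_gt0// ltr_wpDl// planar_sq_ge0.
Qed.

Let tx g := (left_translate g).1.1.
Let ty g := (left_translate g).1.2.
Let ts g := (left_translate g).2.
Let P g := reg_gauge4 (left_translate g).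

Let hx : horizontal tx (fun=> 1) (fun=> 0).
Proof.
by apply: horizontal_eq (horizontalD horizontal_x (horizontal_cst (- h.1.1))) _ _ _ => g //=; rewrite addr0.
Qed.

Let hy : horizontal ty (fun=> 0) (fun=> 1).
Proof.
by apply: horizontal_eq (horizontalD horizontal_y (horizontal_cst (- h.1.2))) _ _ _ => g //=; rewrite addr0.
Qed.

Let hs : horizontal ts (fun g => - (ty g / 2)) (fun g => tx g / 2).
Proof.
apply: horizontal_eq (horizontalD (horizontalD horizontal_s (horizontal_cst (- h.2)))
  (horizontalD (horizontalM (horizontal_cst (- h.1.1 / 2)) horizontal_y)
   (horizontalM (horizontal_cst (h.1.2 / 2)) horizontal_x))) _ _ _ => g /=;
  rewrite /ts /tx /ty /left_translate/=; by field.
Qed.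

Let s g := tx g ^+ 2 + ty g ^+ 2.
Let A g := 4 * (s g + e) * tx g - 16 * (ty g * ts g).
Let B g := 4 * (s g + e) * ty g + 16 * (tx g * ts g).

Let hse : horizontal (fun g => s g + e) (fun g => 2 * tx g) (fun g => 2 * ty g).
Proof.
by apply: horizontal_eq (horizontalD (horizontalD (horizontalX 2 hx) (horizontalX 2 hy)) (horizontal_cst e)) _ _ _
  => g /=; rewrite /s; ring.
Qed.

Let hP : horizontal P A B.
Proof.
apply: horizontal_eq (horizontalD (horizontalX 2 hse) (horizontalM (horizontal_cst 16) (horizontalX 2 hs))) _ _ _
  => g /=; rewrite /P /reg_gauge4 /A /B /s /planar_sq /tx /ty /ts; by [ring|field].
Qed.

(** Only [X1 A] and [X2 B] enter the sublaplacian, so the other horizontal derivatives of [A] and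
    [B] stay anonymous. *)
Let hA : exists b, horizontal A (fun g => 12 * s g + 4 * e) b.
Proof.
eexists; apply: horizontal_eq (horizontalD (horizontalM (horizontalM (horizontal_cst 4) hse) hx)
  (horizontalM (horizontal_cst (-16)) (horizontalM hy hs))) _ _ _ => g /=; last reflexivity.
- by rewrite /A; ring.
- by rewrite /s; field.
Qed.

Let hB : exists a, horizontal B a (fun g => 12 * s g + 4 * e).
Proof.
eexists; apply: horizontal_eq (horizontalD (horizontalM (horizontalM (horizontal_cst 4) hse) hy)
  (horizontalM (horizontal_cst 16) (horizontalM hx hs))) _ _ _ => g /=; last 2 first.
- reflexivity.
- by rewrite /s; field.
- by rewrite /B; ring.
Qed.

Let isq (t : R) := (Num.sqrt t)^-1.
Let F t := exp_bump 0 (t * c) * isq t.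
Let F1 t := (- c * exp_bump 2 (t * c) + - 2^-1 * exp_bump 0 (t * c) * t^-1) * isq t.
Let F2 t := (- c ^+ 2 * (2 * exp_bump 3 (t * c) - exp_bump 4 (t * c)) + c * exp_bump 2 (t * c) * t^-1 +
  3 / 4 * exp_bump 0 (t * c) * (t^-1 * t^-1)) * isq t.

Let dbump k (t : R) : is_derive t 1 (fun t => exp_bump k (t * c)) ((k%:R * exp_bump k.+1 (t * c) - exp_bump k.+2 (t * c)) * c).
Proof.
have H : is_derive t 1 (fun t : R => t * c) c.
  apply: (@is_derive_eq _ _ _ (id * cst c) _ _ _ _ (@is_deriveM _ _ id (cst c) _ _ _ _ (@is_derive_id _ _ _ _) (@is_derive_cst _ _ _ c _ _))).
  by rewrite /GRing.scale/= mulr0 add0r mulr1.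
exact: (@is_derive1_comp _ (exp_bump k) (fun t => t * c) t _ _ (is_derive_bump k (t * c)) H).
Qed.

Let dinv (t : R) := @is_derive_inv t.
Let disq (t : R) := @is_derive_isqrt t.

Let dF (t : R) : 0 < t -> is_derive t 1 F (F1 t).
Proof.
move=> t0; apply: (is_derive_eq (is_deriveM (dbump 0 t) (disq t0))).
by rewrite /GRing.scale/= /F1 /isq; ring.
Qed.

Let dF1 (t : R) : 0 < t -> is_derive t 1 F1 (F2 t).
Proof.
move=> t0; have tn0 : t != 0 by rewrite gt_eqF.
have D2 : is_derive t 1 (fun t => - c * exp_bump 2 (t * c)) (- c * ((2%:R * exp_bump 3 (t * c) - exp_bump 4 (t * c)) * c)).
  apply: (is_derive_eq (is_deriveM (@is_derive_cst _ _ _ (- c) t (1 : R)) (dbump 2 t))).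
  by rewrite /GRing.scale/= mulr0 addr0.
have D0 : is_derive t 1 (fun t => - 2^-1 * exp_bump 0 (t * c)) (- 2^-1 * (- exp_bump 2 (t * c) * c)).
  apply: (is_derive_eq (is_deriveM (@is_derive_cst _ _ _ (- 2^-1 : R) t (1 : R)) (dbump 0 t))).
  by rewrite /GRing.scale/= mulr0 addr0 mul0r sub0r.
have D3 := is_deriveM D0 (dinv t0).
have D4 := is_deriveD D2 D3.
have D5 := is_deriveM D4 (disq t0).
apply: (is_derive_eq D5); rewrite /F2 /isq /GRing.scale/=.
rewrite -[(_ + _ * _) t]/(- c * exp_bump 2 (t * c) + - 2^-1 * exp_bump 0 (t * c) * t^-1).
by field; rewrite tn0 gt_eqF// sqrtr_gt0.
Qed.

Definition test_bump (g : heis R) : R := F (P g).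

(* For [P := reg_gauge4] one has [|grad_H P|^2 = 16 |z|^2 P] and
   [Delta_H P = 24 |z|^2 + 8 e], so the terms of [- Delta_H (F o P)] in which no
   derivative falls on the bump combine into the positive kernel [neg_lap_main],
   which concentrates at the pole; all others are in [neg_lap_error]. *)
Definition neg_lap_main (k : heis R) : R :=
  4 * e * (exp_bump 0 (reg_gauge4 k * c) * ((reg_gauge4 k)^-1 * isq (reg_gauge4 k))).
Definition neg_lap_error (k : heis R) : R :=
  isq (reg_gauge4 k) * c * (16 * planar_sq k * (reg_gauge4 k * c) * (2 * exp_bump 3 (reg_gauge4 k * c) - exp_bump 4 (reg_gauge4 k * c))
    + 8 * (planar_sq k + e) * exp_bump 2 (reg_gauge4 k * c)).

Lemma sublaplacian_test_bump g :
  - sublaplacian test_bump g = neg_lap_main (left_translate g) + neg_lap_error (left_translate g).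
Proof.
have hF := horizontal_comp hP (fun g => dF (reg_gauge4_gt0 (left_translate g))).
have hF1 := horizontal_comp (dF := F2) hP (fun g => dF1 (reg_gauge4_gt0 (left_translate g))).
have [b hA'] := hA; have [a hB'] := hB.
rewrite /sublaplacian /test_bump; have [-> ->] := horizontalE hF.
have [-> _] := horizontalE (horizontalM hF1 hA').
have [_ ->] := horizontalE (horizontalM hF1 hB').
have -> : P g = reg_gauge4 (left_translate g) by [].
have p0 := reg_gauge4_gt0 (left_translate g).
have gradE : A g ^+ 2 + B g ^+ 2 = 16 * planar_sq (left_translate g) * reg_gauge4 (left_translate g).
  by rewrite /A /B /reg_gauge4 /planar_sq /s /tx /ty /ts; ring.
set p := reg_gauge4 _ in p0 gradE *.
transitivity (- (F2 p * (A g ^+ 2 + B g ^+ 2) + F1 p * (24 * planar_sq (left_translate g) + 8 * e))).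
  by rewrite /s /planar_sq -/(tx g) -/(ty g); ring.
rewrite gradE /F1 /F2 /neg_lap_main /neg_lap_error -/p.
by field; rewrite gt_eqF.
Qed.

Let poly_left_translate : [/\ polynomial_fun tx, polynomial_fun ty & polynomial_fun ts].
Proof.
have sub u w : polynomial_fun u -> polynomial_fun w -> polynomial_fun (fun g => u g - w g).
  move=> pu pw; rewrite (_ : (fun g => _) = (fun g => u g + (-1) * w g)).
    by apply: poly_add => //; apply: poly_mul => //; exact: poly_cst.
  by apply/funext => g; rewrite mulN1r.
split.
- by apply: (sub _ _); [exact: poly_x|exact: poly_cst].
- by apply: (sub _ _); [exact: poly_y|exact: poly_cst].
- apply: (sub _ _); first by apply: (sub _ _); [exact: poly_s|exact: poly_cst].
  apply: poly_mul; last exact: poly_cst.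
  by apply: (sub _ _); apply: poly_mul; first [exact: poly_cst|exact: poly_x|exact: poly_y].
Qed.

Lemma smooth_test_bump : smooth test_bump.
Proof.
have [px py ps] := poly_left_translate.
have sq u : polynomial_fun u -> polynomial_fun (fun g => u g ^+ 2).
  move=> pu; rewrite (_ : (fun g => _) = (fun g => u g * u g)); first exact: poly_mul.
  by apply/funext => g; rewrite expr2.
have pP : polynomial_fun P.
  apply: poly_add; last by apply: poly_mul; [exact: poly_cst|exact: (sq _)].
  apply: (sq _); apply: poly_add; last exact: poly_cst.
  by apply: poly_add; exact: (sq _).
apply: (@cutoff_smooth P c pP) => [g|]; first exact: reg_gauge4_gt0.
by apply: cutoff_mul; [exact: cutoff_bump|exact: cutoff_isqrt].
Qed.

End translated_gauge.

End directional.

(** * The fundamental solution *)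

Section heisenberg_volume.
Variable R : realType.
Local Notation T1 := (measurableTypeR R).
Local Notation T2 := (measurableTypeR R * measurableTypeR R)%type.
Local Notation T3 := (measurableTypeR R * measurableTypeR R * measurableTypeR R)%type.
Local Notation leb := (@lebesgue_measure R).
Local Notation vol := (@leb3 R).
Implicit Types (g h k : heis R).

Lemma measurable_heis_x : measurable_fun [set: T3] (fun g : T3 => g.1.1 : R).
Proof. exact: (measurableT_comp measurable_fst measurable_fst). Qed.

Lemma measurable_heis_y : measurable_fun [set: T3] (fun g : T3 => g.1.2 : R).
Proof. exact: (measurableT_comp measurable_snd measurable_fst). Qed.

Lemma measurable_heis_s : measurable_fun [set: T3] (fun g : T3 => g.2 : R).
Proof. exact: measurable_snd. Qed.

Lemma measurable_planar_sq : measurable_fun [set: T3] (@planar_sq R : T3 -> R).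
Proof.
by apply: measurable_funD; apply: measurable_funX; [exact: measurable_heis_x|exact: measurable_heis_y].
Qed.

Lemma measurable_reg_gauge4 e : measurable_fun [set: T3] (reg_gauge4 e : T3 -> R).
Proof.
apply: measurable_funD.
  apply: measurable_funX; apply: measurable_funD; last exact: measurable_cst.
  exact: measurable_planar_sq.
apply: measurable_funM; first exact: measurable_cst.
by apply: measurable_funX; exact: measurable_heis_s.
Qed.

Definition box (m : R) : set (heis R) := ([set` `[- m, m]] `*` [set` `[- m, m]]) `*` [set` `[- m, m]].

Lemma boxP m g : box m g <-> [/\ `|g.1.1| <= m, `|g.1.2| <= m & `|g.2| <= m].
Proof.
rewrite /box /= !in_itv/= -!ler_norml; split; first by move=> [[? ?] ?].
by move=> [? ? ?].
Qed.

Lemma compact_box m : compact (box m).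
Proof. by apply: compact_setX; [apply: compact_setX|]; exact: segment_compact. Qed.

Lemma measurable_box m : measurable (box m : set T3).
Proof. by apply: measurableX; [apply: measurableX|]; exact: measurable_itv. Qed.

Lemma leb3_box m : (vol (box m) < +oo)%E.
Proof.
pose I : set T1 := [set` `[- m, m]].
have lI : (leb I < +oo)%E by rewrite lebesgue_measure_itv/=; case: ifPn => _; rewrite ltry.
have mI : measurable I by exact: measurable_itv.
have -> : vol (box m) = (leb I * leb I * leb I)%E.
  transitivity (@leb2 R (I `*` I) * leb I)%E.
    by apply: (@product_measure1E _ _ _ _ _ (@leb2 R) leb (I `*` I) I) => //; exact: measurableX.
  by congr (_ * _)%E; exact: (@product_measure1E _ _ _ _ _ leb leb I I).
by rewrite !lte_mul_pinfty// ?ge0_fin_numE// ?mule_ge0// lte_mul_pinfty// ge0_fin_numE.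
Qed.

Lemma norm_le_box m g : ~ box m g -> m < `|g|.
Proof.
case: g => [[x y] s] H; rewrite ltNge; apply/negP => gm; apply: H; apply/boxP.
move: gm; rewrite /Num.norm/= !ge_max => /andP[/andP[? ?] ?]; by split.
Qed.

Let mul_shift h (p : T2) : R := h.2 + (h.1.1 * p.2 - h.1.2 * p.1) / 2.

(** Left multiplication by [h], the inverse of [left_translate h], written as a shear with unit
    coefficients so that it preserves volume. *)
Definition left_mul h : T3 -> T3 := shear 1 1 1 h.1.1 h.1.2 (mul_shift h).

Let measurable_mul_shift h : measurable_fun [set: T2] (mul_shift h : T2 -> T1).
Proof.
apply: measurable_funD; first exact: measurable_cst.
apply: measurable_funM; last exact: measurable_cst.
apply: measurable_funB; apply: measurable_funM; try exact: measurable_cst.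
  exact: measurable_snd.
exact: measurable_fst.
Qed.

Lemma left_mulK h k : left_translate h (left_mul h k) = k.
Proof.
case: h k => [[a b] c] [[x y] s]; rewrite /left_mul /shear /left_translate /mul_shift/=.
by congr ((_, _), _); ring.
Qed.

Lemma measurable_left_translate h : measurable_fun [set: T3] (left_translate h : T3 -> T3).
Proof.
rewrite (_ : left_translate h = shear 1 1 1 (- h.1.1) (- h.1.2)
  (fun p => - h.2 - (h.1.1 * p.2 - h.1.2 * p.1) / 2)).
  apply: measurable_shear.
  apply: measurable_funB; first exact: measurable_cst.
  apply: measurable_funM; last exact: measurable_cst.
  apply: measurable_funB; apply: measurable_funM; try exact: measurable_cst.
    exact: measurable_snd.
  exact: measurable_fst.
apply/funext => -[[x y] s]; rewrite /left_translate /shear/=; congr ((_, _), _); ring.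
Qed.

Lemma ge0_integral_left_translate h (f : T3 -> \bar R) : measurable_fun setT f ->
  (forall g, 0 <= f g)%E ->
  (\int[vol]_g f (left_translate h g) = \int[vol]_g f g)%E.
Proof.
move=> mf f0.
rewrite (@ge0_integral_shear _ 1 1 1 h.1.1 h.1.2 (mul_shift h) (fun g => f (left_translate h g)))//.
- by rewrite !mulr1 mul1e; apply: eq_integral => k _; rewrite left_mulK.
- exact: (measurableT_comp mf (measurable_left_translate h)).
Qed.

Lemma leb3_left_translate h (A : set T3) : measurable A ->
  vol (left_translate h @^-1` A) = vol A.
Proof.
move=> mA; rewrite (@leb3_shear _ 1 1 1 h.1.1 h.1.2 (mul_shift h))//.
  rewrite !mulr1 mul1e; congr (vol _); apply/seteqP; split => k /=; by rewrite left_mulK.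
by rewrite -[_ @^-1` _]setTI; exact: (measurable_left_translate h).
Qed.

Definition gauge_ball4 (T : R) : set (heis R) := [set g | gauge4 g < T].

Lemma measurable_gauge4_heis : measurable_fun [set: T3] (@gauge4 R : T3 -> R).
Proof.
apply: measurable_funD; first by apply: measurable_funX; exact: measurable_planar_sq.
apply: measurable_funM; first exact: measurable_cst.
by apply: measurable_funX; exact: measurable_heis_s.
Qed.

Lemma measurable_gauge_ball4 T : measurable (gauge_ball4 T : set T3).
Proof.
rewrite (_ : gauge_ball4 T = (@gauge4 R : T3 -> R) @^-1` `]-oo, T[); last first.
  by apply/seteqP; split => g; rewrite /= in_itv.
by rewrite -[_ @^-1` _]setTI; apply: measurable_gauge4_heis => //; exact: measurable_itv.
Qed.

Lemma gauge_ball4_coord (t : R) g : 0 <= t -> gauge4 g < t ^+ 4 ->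
  [/\ `|g.1.1| <= t, `|g.1.2| <= t & `|g.2| <= t ^+ 2].
Proof.
case: g => [[x y] s] t0; rewrite /gauge4 /planar_sq/= => gt.
have t20 : 0 <= t ^+ 2 by rewrite sqr_ge0.
have s2 : 0 <= 16 * s ^+ 2 by rewrite mulr_ge0 ?sqr_ge0.
have xy : x ^+ 2 + y ^+ 2 <= t ^+ 2.
  rewrite -(ler_pXn2r (n := 2)) ?nnegrE ?addr_ge0 ?sqr_ge0// -exprM.
  by rewrite (le_trans _ (ltW gt))// lerDl.
have x2 := sqr_ge0 x; have y2 := sqr_ge0 y.
have abs (z w : R) : 0 <= w -> z ^+ 2 <= w ^+ 2 -> `|z| <= w.
  by move=> w0 zw; rewrite -(ler_pXn2r (n := 2)) ?nnegrE// real_normK// num_real.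
split; apply: abs => //; [lra|lra|].
have := sqr_ge0 (x ^+ 2 + y ^+ 2); have := sqr_ge0 s; rewrite -exprM; lra.
Qed.

(** The Jacobian [t * t * t^2] of the dilation is where the homogeneous dimension 4 appears. As
    [gauge4] is also of degree 4, volume is linear in its level. *)
Lemma leb3_gauge_ball4_dilation (t : R) : 0 < t ->
  vol (gauge_ball4 (t ^+ 4)) = ((t ^+ 4)%:E * vol (gauge_ball4 1))%E.
Proof.
move=> t0; rewrite (@leb3_shear _ t t (t ^+ 2) 0 0 (cst 0)) ?exprn_gt0//; last exact: measurable_gauge_ball4.
congr (_ * vol _)%E; first by congr (_%:E); ring.
have E g : gauge4 (shear t t (t ^+ 2) 0 0 (cst 0) g) = t ^+ 4 * gauge4 g.
  by rewrite /gauge4 /planar_sq /shear/=; ring.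
by apply/seteqP; split => g; rewrite /gauge_ball4/= E gtr_pMr ?exprn_gt0.
Qed.

Definition unit_vol : R := fine (vol (gauge_ball4 1)).

Lemma leb3_gauge_ball4 (T : R) : 0 < T -> vol (gauge_ball4 T) = (T * unit_vol)%:E.
Proof.
move=> T0.
have -> : T = (Num.sqrt (Num.sqrt T)) ^+ 4.
  by rewrite (exprM _ 2 2) sqr_sqrtr ?sqrtr_ge0// sqr_sqrtr// ltW.
rewrite leb3_gauge_ball4_dilation ?sqrtr_gt0// [RHS]EFinM; congr (_ * _)%E.
rewrite /unit_vol fineK// ge0_fin_numE//; apply: le_lt_trans (leb3_box 1).
apply: le_measure; rewrite ?inE; [exact: measurable_gauge_ball4|exact: measurable_box|].
move=> g g1; apply/boxP; have := @gauge_ball4_coord 1 g; rewrite !expr1n; apply => //.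
Qed.

Lemma unit_vol_ge0 : 0 <= unit_vol.
Proof. exact: fine_ge0. Qed.

Lemma measurable_bump (n : nat) : measurable_fun [set: R] (@exp_bump R n).
Proof. by apply: continuous_measurable_fun; exact: continuous_bump. Qed.

Lemma measurable_isqrt : measurable_fun [set: R] (fun t : R => (Num.sqrt t)^-1).
Proof.
rewrite (_ : (fun t => _) = fun t => Num.sqrt t `^ (-1)); last first.
  by apply/funext => t; rewrite powR_inv1 ?sqrtr_ge0.
apply: (measurableT_comp (f := fun x : R => x `^ (-1))); first exact: measurable_powR.
by apply: continuous_measurable_fun; exact: sqrt_continuous.
Qed.

(** * Size of the averaging kernel and of the error kernel *)

Section kernel.
Variable c : R.
Hypotheses (c0 : 0 < c) (c1 : c <= 1).
(** Away from the pole the main kernel has size of order [e], on a ball of volume of order [1 / c].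
    With [e = c^2] the product is of order [c] and vanishes in the limit. *)
Let e := c ^+ 2.
Let e0 : 0 < e. Proof. by rewrite exprn_gt0. Qed.
Local Notation P := (reg_gauge4 e).
Local Notation main := (neg_lap_main e c).
Local Notation err := (neg_lap_error e c).

Let P0 k : 0 < P k. Proof. exact: reg_gauge4_gt0. Qed.

Lemma gauge4_le_reg k : gauge4 k <= P k.
Proof.
rewrite lerD2r ler_pXn2r ?nnegrE ?planar_sq_ge0//.
  by rewrite lerDl ltW.
by rewrite addr_ge0 ?planar_sq_ge0// ltW.
Qed.

Let inv_isqrt k : (P k)^-1 = (Num.sqrt (P k))^-1 ^+ 2.
Proof. by rewrite exprVn sqr_sqrtr// ltW. Qed.

Let isq0 k : 0 < (Num.sqrt (P k))^-1. Proof. by rewrite invr_gt0 sqrtr_gt0. Qed.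

Lemma neg_lap_main_ge0 k : 0 <= main k.
Proof. by rewrite /neg_lap_main !mulr_ge0 ?bump_ge0 ?ltW// ?invr_gt0. Qed.

Lemma measurable_neg_lap_main : measurable_fun [set: T3] (main : T3 -> R).
Proof.
have mP := measurable_reg_gauge4 e.
rewrite (_ : main = fun k => 4 * e * (exp_bump 0 (P k * c) * ((Num.sqrt (P k))^-1 ^+ 2 * (Num.sqrt (P k))^-1))); last first.
  by apply/funext => k; rewrite /neg_lap_main inv_isqrt.
have mi : measurable_fun [set: T3] (fun k : T3 => (Num.sqrt (P k))^-1 : R).
  by apply: (measurableT_comp measurable_isqrt).
have mPc : measurable_fun [set: T3] (fun k : T3 => P k * c : R).
  by apply: measurable_funM => //; exact: measurable_cst.
apply: measurable_funM; first exact: measurable_cst.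
apply: measurable_funM; first by apply: (measurableT_comp (measurable_bump 0)).
by apply: measurable_funM => //; exact: measurable_funX.
Qed.

Lemma measurable_neg_lap_error : measurable_fun [set: T3] (err : T3 -> R).
Proof.
have mP := measurable_reg_gauge4 e.
have mi : measurable_fun [set: T3] (fun k : T3 => (Num.sqrt (P k))^-1 : R).
  by apply: (measurableT_comp measurable_isqrt).
have mPc : measurable_fun [set: T3] (fun k : T3 => P k * c : R).
  by apply: measurable_funM => //; exact: measurable_cst.
have mb n : measurable_fun [set: T3] (fun k : T3 => exp_bump n (P k * c) : R).
  by apply: (measurableT_comp (measurable_bump n)).
have mz := measurable_planar_sq.
have mc (x : R) : measurable_fun [set: T3] (fun k : T3 => x) by exact: measurable_cst.
apply: measurable_funM; first exact: measurable_funM.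
apply: measurable_funD.
  apply: measurable_funM.
    by apply: measurable_funM => //; exact: measurable_funM.
  by apply: measurable_funB => //; exact: measurable_funM.
apply: measurable_funM => //; apply: measurable_funM => //; exact: measurable_funD.
Qed.

Lemma neg_lap_main_eq0 k : 1 <= gauge4 k * c -> main k = 0.
Proof.
move=> k1; rewrite /neg_lap_main bump_eq0 ?mul0r ?mulr0//.
by rewrite (le_trans k1)// ler_wpM2r ?gauge4_le_reg// ltW.
Qed.

Lemma neg_lap_error_eq0 k : 1 <= gauge4 k * c -> err k = 0.
Proof.
move=> k1; rewrite /neg_lap_error !bump_eq0 ?(mulr0, subr0, addr0)//;
by rewrite (le_trans k1)// ler_wpM2r ?gauge4_le_reg// ltW.
Qed.

Let bump_bound n (t : R) : 0 <= t -> exp_bump n t <= n.+1`!%:R.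
Proof.
move=> t0; have [t1|t1] := ltP t 1; last by rewrite bump_eq0.
apply: le_trans (bump_le n 0 t) _; rewrite addn1 expr1.
by rewrite ler_piMr// gtr0_norm ?subr_gt0// gerBl.
Qed.

Lemma neg_lap_main_le k (eta : R) : 0 < eta -> eta <= gauge4 k ->
  main k <= 4 * c ^+ 2 * (eta^-1 * (Num.sqrt eta)^-1).
Proof.
move=> eta0 etak; have etaP : eta <= P k := le_trans etak (gauge4_le_reg k).
rewrite /neg_lap_main ler_pM2l ?mulr_gt0//.
apply: (@le_trans _ _ (1 * ((P k)^-1 * (Num.sqrt (P k))^-1))).
  rewrite ler_wpM2r ?mulr_ge0 ?(ltW (isq0 _)) ?invr_ge0 ?(ltW (P0 _))//.
  by apply: bump_bound; rewrite mulr_ge0// ltW.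
rewrite mul1r ler_pM ?invr_ge0 ?sqrtr_ge0 ?(ltW (P0 _))//.
  by rewrite lef_pV2 ?posrE.
by rewrite lef_pV2 ?posrE ?sqrtr_gt0// ler_wsqrtr.
Qed.

(** A crude bound that serves to show that [main_mass] is finite. *)
Lemma neg_lap_main_le_const k : main k <= 4 * e * (e ^- 2 * e^-1).
Proof.
have eP : e ^+ 2 <= P k.
  have ze : e <= planar_sq k + e by rewrite lerDr planar_sq_ge0.
  apply: (@le_trans _ _ ((planar_sq k + e) ^+ 2)); last by rewrite lerDl mulr_ge0// sqr_ge0.
  by apply: lerXn2r => //; rewrite nnegrE ?(le_trans (ltW e0))// ltW.
have sP : e <= Num.sqrt (P k).
  by rewrite -[leLHS]ger0_norm ?(ltW e0)// -sqrtr_sqr ler_wsqrtr.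
rewrite /neg_lap_main ler_pM2l ?mulr_gt0//.
apply: (@le_trans _ _ (1 * ((P k)^-1 * (Num.sqrt (P k))^-1))).
  rewrite ler_wpM2r ?mulr_ge0 ?(ltW (isq0 _)) ?invr_ge0 ?(ltW (P0 _))//.
  by apply: bump_bound; rewrite mulr_ge0// ltW.
rewrite mul1r ler_pM ?invr_ge0 ?sqrtr_ge0 ?(ltW (P0 _))//.
  by rewrite lef_pV2 ?posrE ?exprn_gt0.
by rewrite lef_pV2 ?posrE ?sqrtr_gt0.
Qed.

(** [exp_bump n] is at most [(n + 1)!] on nonnegative arguments: [168 = 2 * 24 + 120] comes from the
    indices 3 and 4, and [6] from the index 2. *)
Definition neg_lap_error_bound : R := 16 * 168 + 8 * 6.

Lemma neg_lap_error_bound_ge0 : 0 <= neg_lap_error_bound.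
Proof. by rewrite addr_ge0// mulr_ge0// ler0n. Qed.

(** On the support [reg_gauge4 * c <= 1], and [|z|^2 + e] is at most the square root of
    [reg_gauge4]; after these factors are absorbed a single [c] remains. *)
Lemma neg_lap_error_le k : `|err k| <= neg_lap_error_bound * c.
Proof.
have [Pc|Pc] := leP 1 (P k * c).
  rewrite /neg_lap_error (bump_eq0 2 Pc) (bump_eq0 3 Pc) (bump_eq0 4 Pc).
  rewrite mulr0 subr0 mulr0 mulr0 addr0 mulr0 normr0.
  by apply: mulr_ge0; [exact: neg_lap_error_bound_ge0|exact: ltW].
have P0k := ltW (P0 k); have c0' := ltW c0.
have Pc0 : 0 <= P k * c by exact: mulr_ge0.
have e0' := ltW e0; have z0 := planar_sq_ge0 k.
have zs : planar_sq k + e <= Num.sqrt (P k).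
  have ze : 0 <= planar_sq k + e by exact: addr_ge0.
  rewrite -(ger0_norm ze) -sqrtr_sqr; apply: ler_wsqrtr.
  by rewrite lerDl; apply: mulr_ge0 => //; exact: sqr_ge0.
set i := (Num.sqrt (P k))^-1.
have i0 : 0 < i := isq0 k.
have i1 : i * (planar_sq k + e) <= 1 by rewrite mulrC ler_pdivrMr ?mul1r// sqrtr_gt0.
have i0' := ltW i0; have ze := addr_ge0 z0 e0'.
have i1' := mulr_ge0 i0' ze; have i2' := mulr_ge0 i0' z0.
have i2 : i * planar_sq k <= 1.
  by apply: le_trans i1; rewrite ler_pM2l// lerDl.
have E : err k = c * (16 * ((i * planar_sq k) * (P k * c)) * (2 * exp_bump 3 (P k * c) - exp_bump 4 (P k * c)) +
    8 * (i * (planar_sq k + e)) * exp_bump 2 (P k * c)).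
  by rewrite /neg_lap_error -/i; ring.
rewrite E normrM (gtr0_norm c0) mulrC ler_pM2r//.
have a0 : 0 <= (i * planar_sq k) * (P k * c) by exact: mulr_ge0.
have a1 : (i * planar_sq k) * (P k * c) <= 1.
  by apply: mulr_ile1 => //; exact: ltW.
have b3 := bump_bound 3 Pc0; have b4 := bump_bound 4 Pc0; have b2 := bump_bound 2 Pc0.
have b30 := bump_ge0 3 (P k * c); have b40 := bump_ge0 4 (P k * c); have b20 := bump_ge0 2 (P k * c).
rewrite !factS fact0 in b3 b4 b2.
move: a0 a1 i1 i1' b3 b4 b2 b30 b40 b20.
move: (i * planar_sq k * (P k * c)) (i * (planar_sq k + e)) (exp_bump 3 (P k * c)) (exp_bump 4 (P k * c)) (exp_bump 2 (P k * c)) => a b x3 x4 x2 a0 a1 b1 b0.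
move=> b3 b4 b2 b30 b40 b20.
have d : `|2 * x3 - x4| <= 168 by rewrite ler_norml; apply/andP; split; lra.
apply: le_trans (ler_normD _ _) _.
apply: lerD; rewrite !normrM !normr_nat.
  by apply: ler_pM => //; rewrite ?mulr_ge0// (ger0_norm a0) ger_pMr.
rewrite (ger0_norm b0) (ger0_norm b20); apply: ler_pM; rewrite ?mulr_ge0 ?ger_pMr//; lra.
Qed.

End kernel.

End heisenberg_volume.

(** * Identification of the fundamental solution *)

Section fundamental_solution.
Variables (R : realType) (Gam : heis R -> R).
Hypothesis hGam : positive_fundamental_solution Gam.
Local Notation T3 := (measurableTypeR R * measurableTypeR R * measurableTypeR R)%type.
Local Notation vol := (@leb3 R).
Implicit Types (g h k : heis R).

Lemma left_translate_coord (t : R) h g : 0 <= t -> gauge4 (left_translate h g) < t ^+ 4 ->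
  [/\ `|g.1.1 - h.1.1| <= t, `|g.1.2 - h.1.2| <= t &
      `|g.2 - h.2| <= t ^+ 2 + (`|h.1.1| + `|h.1.2|) * t].
Proof.
move=> t0 /(gauge_ball4_coord t0); rewrite /left_translate/= => -[gx gy gs].
split=> //.
have E : g.2 - h.2 = (g.2 - h.2 - (h.1.1 * g.1.2 - h.1.2 * g.1.1) / 2) +
  (h.1.1 * (g.1.2 - h.1.2) + - (h.1.2 * (g.1.1 - h.1.1))) / 2 by field.
rewrite E; apply: le_trans (ler_normD _ _) _; apply: lerD => //.
rewrite normrM normfV normr_nat ler_pdivrMr//.
apply: le_trans (ler_normD _ _) _; rewrite normrN !normrM mulrDl.
have hx := ler_wpM2l (normr_ge0 h.1.1) gy.
have hy := ler_wpM2l (normr_ge0 h.1.2) gx.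
have := mulr_ge0 (normr_ge0 h.1.1) t0; have := mulr_ge0 (normr_ge0 h.1.2) t0.
lra.
Qed.

(** Outside this ball the test function centred at [h] and both parts of its sublaplacian vanish. *)
Definition translated_ball h (c : R) : set (heis R) :=
  left_translate h @^-1` gauge_ball4 c^-1.

Lemma measurable_translated_ball h c : measurable (translated_ball h c : set T3).
Proof.
rewrite -[translated_ball h c]setTI; apply: (measurable_left_translate h) => //.
exact: measurable_gauge_ball4.
Qed.

Lemma leb3_translated_ball h c : 0 < c -> vol (translated_ball h c) = (c^-1 * unit_vol R)%:E.
Proof.
move=> c0; rewrite leb3_left_translate; last exact: measurable_gauge_ball4.
by rewrite leb3_gauge_ball4// invr_gt0.
Qed.

Lemma translated_ball_box h c : 0 < c -> exists m, translated_ball h c `<=` box m.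
Proof.
move=> c0; pose t := Num.sqrt (Num.sqrt c^-1).
have t4 : t ^+ 4 = c^-1.
  by rewrite (exprM _ 2 2) sqr_sqrtr ?sqrtr_ge0// sqr_sqrtr// invr_ge0 ltW.
have t0 : 0 <= t by exact: sqrtr_ge0.
pose m := `|h.1.1| + `|h.1.2| + `|h.2| + t + (t ^+ 2 + (`|h.1.1| + `|h.1.2|) * t).
have hx := normr_ge0 h.1.1; have hy := normr_ge0 h.1.2; have hs := normr_ge0 h.2.
have t2 := sqr_ge0 t; have ht := mulr_ge0 (addr_ge0 hx hy) t0.
exists m => g; rewrite /translated_ball /gauge_ball4/= -t4 => /(left_translate_coord t0)[gx gy gs].
have tri (a b u : R) : `|a - b| <= u -> `|a| <= `|b| + u.
  by move=> H; rewrite -[a](subrK b) addrC; apply: le_trans (ler_normD _ _) _; rewrite lerD2l.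
have := tri _ _ _ gx; have := tri _ _ _ gy; have := tri _ _ _ gs.
move=> ? ? ?; apply/boxP; rewrite /m; split; lra.
Qed.

Lemma closure_subbox (A : set (heis R)) m : A `<=` box m -> compact (closure A).
Proof.
move=> Am; apply: (subclosed_compact _ (@compact_box R m)); first exact: closed_closure.
have cb : closed (box m : set (heis R)).
  by apply: compact_closed; [exact: norm_hausdorff|exact: compact_box].
by rewrite [X in _ `<=` X]((closure_id _).1 cb); exact: closure_subset.
Qed.

Lemma test_function_bump h c : 0 < c -> test_function (test_bump h (c ^+ 2) c).
Proof.
move=> c0; split; first by apply: smooth_test_bump; rewrite exprn_gt0.
have [m Hm] := translated_ball_box h c0.
apply: (@closure_subbox _ m); apply: subset_trans Hm => g /= /eqP g0.
rewrite /translated_ball /gauge_ball4/= -[_^-1]mul1r ltr_pdivlMr// ltNge; apply/negP => H; apply: g0.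
rewrite /test_bump bump_eq0 ?mul0r//.
by rewrite (le_trans H)// ler_wpM2r ?gauge4_le_reg// ltW.
Qed.

(** Local integrability gives measurability on each box, and countably many boxes exhaust the
    space. *)
Lemma measurable_fundamental : measurable_fun [set: T3] (Gam : T3 -> R).
Proof.
rewrite (_ : [set: T3] = \bigcup_n (box n%:R : set T3)); last first.
  apply/seteqP; split => // g _; exists (truncn `|g|).+1 => //=; apply: contrapT => /norm_le_box.
  by apply/negP; rewrite -leNgt ltW// truncnS_gt.
apply/measurable_fun_bigcup => n; first exact: measurable_box.
have /integrableP[+ _] := fs_locally_integrable hGam (@compact_box R n%:R).
by move=> /measurable_EFinP.
Qed.

Lemma measurable_norm_fundamental (D : set T3) : measurable_fun D (fun g => (`|Gam g|)%:E).
Proof.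
apply/measurable_EFinP; apply: measurable_funTS.
exact: (measurableT_comp (@normr_measurable R setT) measurable_fundamental).
Qed.

Lemma integral_norm_fundamental_lty h c : 0 < c ->
  (\int[vol]_(g in translated_ball h c) (`|Gam g|)%:E < +oo)%E.
Proof.
move=> c0; have [m Hm] := translated_ball_box h c0.
have /integrableP[_ H] := fs_locally_integrable hGam (@compact_box R m).
apply: le_lt_trans H; apply: ge0_subset_integral => //.
- exact: measurable_translated_ball.
- exact: measurable_box.
- exact: measurable_norm_fundamental.
Qed.

Definition local_mass h c : R := fine (\int[vol]_(g in translated_ball h c) (`|Gam g|)%:E)%E.

Lemma local_massE h c : 0 < c ->
  (\int[vol]_(g in translated_ball h c) (`|Gam g|)%:E = (local_mass h c)%:E)%E.
Proof.
move=> c0; rewrite /local_mass fineK// ge0_fin_numE ?integral_norm_fundamental_lty//.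
by apply: integral_ge0.
Qed.

Definition main_mass c : R := fine (\int[vol]_k (neg_lap_main (c ^+ 2) c k)%:E)%E.

Lemma main_massE c : 0 < c -> c <= 1 ->
  (\int[vol]_k (neg_lap_main (c ^+ 2) c k)%:E = (main_mass c)%:E)%E.
Proof.
move=> c0 c1; have e0 : 0 < c ^+ 2 by rewrite exprn_gt0.
rewrite /main_mass fineK// ge0_fin_numE; last first.
  by apply: integral_ge0 => k _; rewrite lee_fin neg_lap_main_ge0.
pose K := 4 * c ^+ 2 * ((c ^+ 2) ^- 2 * (c ^+ 2)^-1).
have K0 : 0 <= K.
  have ie0 := ltW e0; apply: mulr_ge0; first exact: mulr_ge0.
  by apply: mulr_ge0; rewrite invr_ge0//; exact: exprn_ge0.
rewrite (_ : (fun k => _) = ((fun k => (neg_lap_main (c ^+ 2) c k)%:E) \_ (gauge_ball4 c^-1))); last first.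
  apply/funext => k; rewrite /patch; case: ifPn => //; rewrite notin_setE /gauge_ball4/= => /negP.
  rewrite -leNgt -[leLHS]mul1r ler_pdivrMr// => k1; by rewrite neg_lap_main_eq0.
rewrite -integral_mkcond.
apply: (@le_lt_trans _ _ (\int[vol]_(k in gauge_ball4 c^-1) (cst K%:E k))%E).
  apply: ge0_le_integral => //.
  - exact: measurable_gauge_ball4.
  - by move=> k _; rewrite lee_fin neg_lap_main_ge0.
  - by apply/measurable_EFinP; apply: measurable_funTS; exact: measurable_neg_lap_main.
  - by move=> k _; rewrite lee_fin; exact: neg_lap_main_le_const.
rewrite integral_cst; last exact: measurable_gauge_ball4.
by rewrite leb3_gauge_ball4 ?invr_gt0// -EFinM ltry.
Qed.

Lemma main_mass_ge0 c : 0 < c -> 0 <= main_mass c.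
Proof.
move=> c0; apply: fine_ge0; apply: integral_ge0 => k _.
by rewrite lee_fin neg_lap_main_ge0.
Qed.

Section estimate.
Variables (h : heis R) (c delta eta : R).
Hypotheses (c0 : 0 < c) (c1 : c <= 1) (delta0 : 0 <= delta) (eta0 : 0 < eta).
Hypothesis Gam_near : forall g, gauge4 (left_translate h g) < eta -> `|Gam g - Gam h| <= delta.
Local Notation L := (left_translate h).
Local Notation D := (translated_ball h c).
Local Notation main := (neg_lap_main (c ^+ 2) c).
Local Notation err := (neg_lap_error (c ^+ 2) c).

Let q := 4 * c ^+ 2 * (eta^-1 * (Num.sqrt eta)^-1).
Let K := neg_lap_error_bound R * c.
Let F g := (Gam g - Gam h) * main (L g) + Gam g * err (L g).

Let q0 : 0 <= q.
Proof.
have := ltW c0; have := ltW eta0 => eta0' c0'.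
by apply: mulr_ge0; apply: mulr_ge0 => //; rewrite ?exprn_ge0// invr_ge0// sqrtr_ge0.
Qed.

Let K0 : 0 <= K. Proof. by apply: mulr_ge0; [exact: neg_lap_error_bound_ge0|exact: ltW]. Qed.

Let F_out g : ~ D g -> main (L g) = 0 /\ err (L g) = 0.
Proof.
rewrite /translated_ball /gauge_ball4/= => /negP; rewrite -leNgt -[leLHS]mul1r ler_pdivrMr// => H.
by rewrite neg_lap_main_eq0// neg_lap_error_eq0.
Qed.

(** Near [h] the factor [Gam g - Gam h] is at most [delta]. Far from [h] the main kernel is at most
    [q] and the difference is bounded by the sum of absolute values. The error kernel is at most [K]
    everywhere. *)
Let F_le g : `|F g| <= delta * main (L g) + (q * `|Gam h| + (q + K) * `|Gam g|).
Proof.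
have m0 := neg_lap_main_ge0 c0 (L g); have eK := neg_lap_error_le c0 (L g).
have nG := normr_ge0 (Gam g); have nh := normr_ge0 (Gam h).
rewrite /F; apply: le_trans (ler_normD _ _) _.
rewrite (normrM (Gam g - Gam h)) (normrM (Gam g)) (ger0_norm m0).
have H2 := ler_wpM2l nG eK; rewrite -/K in H2.
have := mulr_ge0 q0 nG; have := mulr_ge0 q0 nh => h1 h2.
have [near|far] := ltP (gauge4 (L g)) eta.
  have H1 := ler_wpM2r m0 (Gam_near near).
  rewrite mulrDl (mulrC K); lra.
have H1 := neg_lap_main_le c0 eta0 far; rewrite -/q in H1.
have H3 : `|Gam g - Gam h| * main (L g) <= (`|Gam g| + `|Gam h|) * q.
  by apply: ler_pM => //; apply: ler_normB.
have := mulr_ge0 delta0 m0; rewrite mulrDl (mulrC K); lra.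
Qed.

Let measurable_mainL : measurable_fun [set: T3] (fun g : T3 => main (L g) : R).
Proof. exact: (measurableT_comp (measurable_neg_lap_main c0) (measurable_left_translate h)). Qed.

Let measurable_F : measurable_fun [set: T3] (F : T3 -> R).
Proof.
have mG := measurable_fundamental.
apply: measurable_funD; apply: measurable_funM => //.
  by apply: measurable_funB => //; exact: measurable_cst.
exact: (measurableT_comp (measurable_neg_lap_error c) (measurable_left_translate h)).
Qed.

Let integral_F_le : (\int[vol]_g `|(F g)%:E| <=
  (delta * main_mass c + (q * `|Gam h| * (c^-1 * unit_vol R) + (q + K) * local_mass h c))%:E)%E.
Proof.
have mD := measurable_translated_ball h c.
rewrite (_ : (fun g => _) = ((fun g => `|(F g)%:E|%E) \_ D)); last first.
  apply/funext => g; rewrite /patch; case: ifPn => //; rewrite notin_setE => /F_out[E1 E2].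
  by rewrite /F E1 E2 !mulr0 addr0 abse0.
rewrite -integral_mkcond.
have qK : 0 <= q + K by exact: addr_ge0.
have mmain : measurable_fun D (fun g => (delta * main (L g))%:E).
  by apply/measurable_EFinP; apply: measurable_funTS; apply: measurable_funM.
have mGam : measurable_fun D (fun g => ((q + K) * `|Gam g|)%:E).
  have mn : measurable_fun [set: T3] (fun g : T3 => `|Gam g|).
    by apply/measurable_EFinP; exact: measurable_norm_fundamental.
  by apply/measurable_EFinP; apply: measurable_funTS; apply: measurable_funM.
apply: (@le_trans _ _ (\int[vol]_(g in D) ((delta * main (L g))%:E +
   ((q * `|Gam h|)%:E + ((q + K) * `|Gam g|)%:E)))%E).
  apply: ge0_le_integral => //.
  - by do 2 apply: measurableT_comp => //; apply: measurable_funTS.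
  - apply: emeasurable_funD => //; apply: emeasurable_funD => //.
  - by move=> g _; rewrite -!EFinD lee_fin.
have i1 g : D g -> (0 <= (delta * main (L g))%:E)%E.
  by move=> _; rewrite lee_fin mulr_ge0// neg_lap_main_ge0.
have i2 g : D g -> (0 <= (q * `|Gam h|)%:E)%E by move=> _; rewrite lee_fin mulr_ge0.
have i3 g : D g -> (0 <= ((q + K) * `|Gam g|)%:E)%E by move=> _; rewrite lee_fin mulr_ge0.
rewrite ge0_integralD//; [|by move=> g Dg; apply: adde_ge0; [exact: (i2 g Dg)|exact: i3]|exact: emeasurable_funD].
rewrite ge0_integralD// [leRHS]EFinD; apply: leeD.
  under eq_integral do rewrite EFinM.
  rewrite ge0_integralZl_EFin//; last 2 first.
  - by move=> g _; rewrite lee_fin neg_lap_main_ge0.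
  - by apply/measurable_EFinP; exact: measurable_funTS.
  rewrite [leRHS]EFinM; apply: lee_wpmul2l; first by rewrite lee_fin.
  rewrite -main_massE// -(@ge0_integral_left_translate _ h (fun k => (main k)%:E)).
  - apply: ge0_subset_integral => //; first exact/measurable_EFinP.
    by move=> g _; rewrite lee_fin neg_lap_main_ge0.
  - by apply/measurable_EFinP; exact: measurable_neg_lap_main.
  - by move=> k; rewrite lee_fin neg_lap_main_ge0.
rewrite [leRHS]EFinD; apply: leeD.
  by rewrite (@integral_cst _ _ _ vol D mD) leb3_translated_ball.
under eq_integral do rewrite EFinM.
rewrite ge0_integralZl_EFin//; last exact: measurable_norm_fundamental.
by rewrite local_massE// -EFinM.
Qed.

(** The distributional equation evaluates the test function at the pole 0, while the kernel averages
    [Gam] around [h]. This links [Gam h] to the explicit function of [h] given by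
    [test_bump h (c ^+ 2) c 0]. *)
Lemma test_bump_estimate :
  `|test_bump h (c ^+ 2) c 0 - Gam h * main_mass c| <=
    delta * main_mass c + (q * `|Gam h| * (c^-1 * unit_vol R) + (q + K) * local_mass h c).
Proof.
have IF : vol.-integrable setT (EFin \o F).
  apply/integrableP; split; first by apply/measurable_EFinP; exact: measurable_F.
  by apply: le_lt_trans integral_F_le _; exact: ltry.
have main_E : (\int[vol]_g (main (L g))%:E = (main_mass c)%:E)%E.
  rewrite (@ge0_integral_left_translate _ h (fun k => (main k)%:E)) ?main_massE//.
  - by apply/measurable_EFinP; exact: measurable_neg_lap_main.
  - by move=> k; rewrite lee_fin neg_lap_main_ge0.
have I0 : vol.-integrable setT (EFin \o (fun g => main (L g))).
  apply/integrableP; split; first exact/measurable_EFinP.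
  under eq_integral do rewrite gee0_abs ?lee_fin ?neg_lap_main_ge0//.
  by rewrite main_E ltry.
have IM : vol.-integrable setT (EFin \o (fun g => Gam h * main (L g))).
  rewrite (_ : EFin \o _ = (fun g => (Gam h)%:E * (main (L g))%:E)%E); last exact/funext.
  exact: integrableZl.
have E : \int[vol]_g (Gam h * main (L g)) = Gam h * main_mass c.
  by rewrite RintegralZl// /Rintegral main_E.
have -> : test_bump h (c ^+ 2) c 0 - Gam h * main_mass c = \int[vol]_g F g.
  have sumE g : Gam g * - sublaplacian (test_bump h (c ^+ 2) c) g = F g + Gam h * main (L g).
    by rewrite sublaplacian_test_bump ?exprn_gt0// /F; ring.
  rewrite -(fs_delta hGam (test_function_bump h c0)) -E.
  under eq_Rintegral do rewrite sumE.
  by rewrite RintegralD// addrK.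
apply: le_trans (le_normr_Rintegral _ IF) _ => //.
rewrite -lee_fin; apply: le_trans integral_F_le.
rewrite /Rintegral fineK// ge0_fin_numE; first by case/integrableP: IF.
by apply: integral_ge0.
Qed.

End estimate.

(** Outside a large box [|Gam| < v], and the ball has volume [unit_vol / c], so that part
    contributes at most [v * unit_vol] after multiplication by [c]. Inside, the fixed integral [I]
    is multiplied by the small [c]. *)
Lemma local_mass_small h (eps : R) : 0 < eps ->
  exists2 d, 0 < d & forall c, 0 < c -> c <= d -> c * local_mass h c <= eps.
Proof.
move=> eps0; have V0 := unit_vol_ge0 R.
pose v := eps / 2 / (unit_vol R + 1).
have V1 : 0 < unit_vol R + 1 by rewrite ltr_wpDl.
have v0 : 0 < v by rewrite !divr_gt0.
have [m Hm] : exists m, forall g, m < `|g| -> `|Gam g| < v.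
  have [m [_ Hm]] := fs_vanishes_at_infinity hGam v0.
  by exists (m + 1); apply: Hm; rewrite ltrDl.
have mB := @measurable_box R m.
have [/measurable_EFinP mG Ifin] := integrableP _ _ _ (fs_locally_integrable hGam (@compact_box R m)).
pose I := fine (\int[vol]_(g in box m) (`|Gam g|)%:E)%E.
have I0 : 0 <= I by apply: fine_ge0; apply: integral_ge0.
have IE : (\int[vol]_(g in box m) (`|Gam g|)%:E = I%:E)%E.
  by rewrite /I fineK// ge0_fin_numE//; apply: integral_ge0.
have I1 : 0 < I + 1 by rewrite ltr_wpDl.
exists (eps / 2 / (I + 1)); first by rewrite !divr_gt0.
move=> c c0 cd; have mD := measurable_translated_ball h c.
have key : local_mass h c <= I + v * (c^-1 * unit_vol R).
  rewrite -lee_fin -local_massE//.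
  pose f g : \bar R := (`|Gam g|)%:E.
  have mf : measurable_fun [set: T3] (f \_ (box m)).
    apply/(measurable_restrictT _ mB); exact: measurable_norm_fundamental.
  have f0 g : (0 <= (f \_ (box m)) g)%E by rewrite /patch; case: ifP => // _; rewrite lee_fin.
  apply: (@le_trans _ _ (\int[vol]_(g in translated_ball h c) ((f \_ (box m)) g + v%:E))%E).
    apply: ge0_le_integral => //.
    - exact: measurable_norm_fundamental.
    - by apply: emeasurable_funD => //; exact: measurable_funTS.
    - move=> g _; rewrite /patch; case: ifPn => [_|]; first by rewrite leeDl// lee_fin ltW.
      by rewrite notin_setE add0e => /norm_le_box/Hm/ltW; rewrite lee_fin.
  rewrite ge0_integralD//; [|exact: measurable_funTS|by move=> *; rewrite lee_fin ltW].
  rewrite EFinD; apply: leeD; last by rewrite (integral_cst vol mD) leb3_translated_ball.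
  rewrite -IE [leRHS]integral_mkcond; exact: ge0_subset_integral.
have h1 : c * (I + v * (c^-1 * unit_vol R)) = c * I + v * unit_vol R.
  by field; rewrite gt_eqF.
apply: le_trans (ler_wpM2l (ltW c0) key) _; rewrite h1.
have h2 : c * I <= eps / 2.
  move: cd; rewrite ler_pdivlMr//; apply: le_trans; rewrite ler_pM2l// lerDl//.
have h3 : v * unit_vol R <= eps / 2.
  rewrite /v -mulrA ger_pMr ?divr_gt0// mulrC ler_pdivrMr// mul1r lerDl//.
lra.
Qed.

Lemma fundamental_solution_near h (delta : R) : h != 0 -> 0 < delta -> exists2 eta, 0 < eta &
  forall g, gauge4 (left_translate h g) < eta -> `|Gam g - Gam h| <= delta.
Proof.
move=> h0 delta0.
have /cvgrPdist_le/(_ _ delta0)/nbhs_ballP[eps/= eps0 H] := fs_continuous hGam h0.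
pose b := `|h.1.1| + `|h.1.2|.
have b0 : 0 <= b by rewrite addr_ge0.
(* As [t <= 1], the deviation [t^2 + b t] of the last coordinate is at most [t (b + 1) < eps]. *)
pose t := Num.min 1 (eps / 2 / (b + 1)).
have b1 : 0 < b + 1 by rewrite ltr_wpDl.
have t0 : 0 < t by rewrite lt_min ltr01 !divr_gt0.
have t1 : t <= 1 by rewrite ge_min lexx.
have t2 : t * (b + 1) < eps.
  have : t <= eps / 2 / (b + 1) by rewrite ge_min lexx orbT.
  rewrite ler_pdivlMr//; move=> /le_lt_trans; apply; lra.
exists (t ^+ 4); first by rewrite exprn_gt0.
move=> g /(left_translate_coord (ltW t0)); rewrite -/b => -[gx gy gs].
rewrite distrC; apply: H.
have tb : 0 <= t * b by rewrite mulr_ge0// ltW.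
have tt : t ^+ 2 <= t by rewrite expr2 ger_pMr.
split; [split|]; rewrite /ball/= distrC; lra.
Qed.

Lemma gauge4_gt0 h : h != 0 -> 0 < gauge4 h.
Proof.
case: h => [[x y] s] h0; rewrite lt_neqAle; apply/andP; split; last first.
  by apply: addr_ge0; [exact: sqr_ge0|apply: mulr_ge0 => //; exact: sqr_ge0].
apply: contraNneq h0 => /esym/eqP; rewrite /gauge4 /planar_sq/=.
rewrite paddr_eq0; [|exact: sqr_ge0|by apply: mulr_ge0 => //; exact: sqr_ge0].
rewrite (mulf_eq0 16) pnatr_eq0/= !sqrf_eq0 paddr_eq0 ?sqr_ge0// !sqrf_eq0.
by move=> /andP[/andP[/eqP-> /eqP->] /eqP->].
Qed.

(** The limit of the test function at the pole as [c] tends to 0; the factor [expR (-1)] is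
    [exp_bump 0 0]. *)
Definition pole_value h : R := expR (-1) * (Num.sqrt (gauge4 h))^-1.

Lemma pole_value_gt0 h : h != 0 -> 0 < pole_value h.
Proof. by move=> /gauge4_gt0 g0; rewrite mulr_gt0 ?expR_gt0// invr_gt0 sqrtr_gt0. Qed.

Lemma test_bump_pole h c : test_bump h (c ^+ 2) c 0 =
  exp_bump 0 (reg_gauge4 (c ^+ 2) h * c) * (Num.sqrt (reg_gauge4 (c ^+ 2) h))^-1.
Proof.
rewrite /test_bump (_ : reg_gauge4 _ (left_translate h 0) = reg_gauge4 (c ^+ 2) h)//.
by rewrite /reg_gauge4 /left_translate /planar_sq/=; ring.
Qed.

Lemma test_bump_pole_limit h : h != 0 ->
  test_bump h (c ^+ 2) c 0 @[c --> (0 : R)] --> pole_value h.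
Proof.
move=> h0.
rewrite (_ : (fun c => _) = fun c => exp_bump 0 (reg_gauge4 (c ^+ 2) h * c) *
  (Num.sqrt (reg_gauge4 (c ^+ 2) h))^-1); last by apply/funext => c; exact: test_bump_pole.
have p0 := gauge4_gt0 h0.
have cX : (c ^+ 2 @[c --> (0 : R)] --> (0 : R)).
  by rewrite -[X in _ --> X](mulr0 (0 : R)); apply: cvgM; exact: cvg_id.
have cP : reg_gauge4 (c ^+ 2) h @[c --> (0 : R)] --> gauge4 h.
  have H : planar_sq h + c ^+ 2 @[c --> (0 : R)] --> planar_sq h.
    by rewrite -[X in _ --> X]addr0; apply: cvgD => //; exact: cvg_cst.
  apply: cvgD; last exact: cvg_cst.
  by apply: (@continuous_cvg _ _ _ _ _ _ (fun x : R => x ^+ 2) _ _ H); exact: exprn_continuous.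
have cPc : reg_gauge4 (c ^+ 2) h * c @[c --> (0 : R)] --> (0 : R).
  by rewrite -[X in _ --> X](mulr0 (gauge4 h)); apply: cvgM => //; exact: cvg_id.
have -> : pole_value h = exp_bump 0 0 * (Num.sqrt (gauge4 h))^-1.
  by rewrite /exp_bump ltr01 expr0 mul1r subr0 invr1.
apply: cvgM; first by apply: (@continuous_cvg _ _ _ _ _ _ (exp_bump 0) _ _ cPc); exact: continuous_bump.
apply: cvgV; first by rewrite gt_eqF// sqrtr_gt0.
by apply: (@continuous_cvg _ _ _ _ _ _ Num.sqrt _ _ cP); exact: sqrt_continuous.
Qed.

(** A third of [delta] goes to each of three errors: the test function at the pole against its
    limit, the main kernel away from [h], and the terms carrying [local_mass]. The product
    [delta * main_mass c] is the oscillation of [Gam] near [h]. *)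
Lemma main_mass_approx h (delta : R) : h != 0 -> 0 < delta -> exists2 d, 0 < d &
  forall c, 0 < c -> c <= d ->
    `|pole_value h - Gam h * main_mass c| <= delta * (main_mass c + 1).
Proof.
move=> h0 delta0; have [eta eta0 Heta] := fundamental_solution_near h0 delta0.
have /cvgrPdist_le/(_ (delta / 3))[|d1/= d10 H1] := test_bump_pole_limit h0; first by rewrite divr_gt0.
pose kap := 4 * (eta^-1 * (Num.sqrt eta)^-1).
have kap0 : 0 <= kap by rewrite /kap !mulr_ge0// invr_ge0 ?sqrtr_ge0// ltW.
pose K := kap + neg_lap_error_bound R.
have K0 : 0 <= K by rewrite addr_ge0// neg_lap_error_bound_ge0.
have K1 : 0 < K + 1 by rewrite ltr_wpDl.
have e2 : 0 < delta / 3 / (K + 1) by rewrite !divr_gt0.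
have [d2 d20 H2] := local_mass_small h e2.
pose b := kap * `|Gam h| * unit_vol R.
have b0 : 0 <= b by apply: mulr_ge0; [exact: mulr_ge0|exact: unit_vol_ge0].
have b1 : 0 < b + 1 by rewrite ltr_wpDl.
pose d := Num.min (Num.min 1 (d1 / 2)) (Num.min d2 (delta / 3 / (b + 1))).
exists d; first by rewrite !lt_min ltr01 d20 !divr_gt0.
move=> c c0; rewrite !le_min => /andP[/andP[c1 cd1] /andP[cd2 cb]].
have := test_bump_estimate c0 c1 (ltW delta0) eta0 Heta.
have L1 : `|pole_value h - test_bump h (c ^+ 2) c 0| <= delta / 3.
  by apply: H1 => /=; rewrite sub0r normrN gtr0_norm// (le_lt_trans cd1)// ltr_pdivrMr// ltr_pMr// ltr1n.
have L2 : c * b <= delta / 3.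
  by move: cb; rewrite ler_pdivlMr//; apply: le_trans; rewrite ler_pM2l// lerDl.
have L3 : K * (c * local_mass h c) <= delta / 3.
  have := H2 _ c0 cd2; rewrite ler_pdivlMr//; apply: le_trans; rewrite mulrC ler_wpM2l ?lerDl//.
  by rewrite mulr_ge0 ?(ltW c0)//; apply: fine_ge0; exact: integral_ge0.
have E1 : 4 * c ^+ 2 * (eta^-1 * (Num.sqrt eta)^-1) * `|Gam h| * (c^-1 * unit_vol R) = c * b.
  rewrite /b /kap; field; rewrite gt_eqF ?gt_eqF ?sqrtr_gt0//.
have L4 : (4 * c ^+ 2 * (eta^-1 * (Num.sqrt eta)^-1) + neg_lap_error_bound R * c) * local_mass h c <= K * (c * local_mass h c).
  have J0 : 0 <= local_mass h c by apply: fine_ge0; exact: integral_ge0.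
  rewrite [leRHS]mulrA; apply: ler_wpM2r => //; rewrite /K [leRHS]mulrDl lerD2r -/kap /kap.
  have -> : 4 * c ^+ 2 * (eta^-1 * (Num.sqrt eta)^-1) = (kap * c) * c by rewrite /kap; ring.
  by apply: ler_piMr => //; apply: mulr_ge0 => //; exact: ltW.
rewrite E1 => L5.
rewrite -[X in `|X|](subrKA (test_bump h (c ^+ 2) c 0)); apply: le_trans (ler_normD _ _) _.
rewrite mulrDr; lra.
Qed.

(** The mass of the kernel is not computed. It is the same for [h] and for the reference point [h0],
    so it is eliminated between the two approximations, and [Gam h / pole_value h] is constant. *)
Theorem fundamental_solution_gauge : exists2 C, 0 < C &
  forall h, h != 0 -> Gam h = C * (Num.sqrt (gauge4 h))^-1.
Proof.
pose h0 : heis R := ((1, 0), 0).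
have h00 : h0 != 0 by apply/eqP => -[/eqP]; rewrite oner_eq0.
have G0 := fs_positive hGam h00; have a0 := pole_value_gt0 h00.
set G := Gam h0 in G0; set a := pole_value h0 in a0.
exists (G / a * expR (-1)); first by apply: mulr_gt0; [exact: divr_gt0|exact: expR_gt0].
move=> h hn0; suff H : G * pole_value h = Gam h * a.
  transitivity (G * pole_value h / a); first by rewrite H mulfK// gt_eqF.
  by rewrite /pole_value; ring.
have Gh := fs_positive hGam hn0.
(* At [h0], the estimate [|a - G M| <= (G / 2) (M + 1)] forces [M <= (2 a + G) / G], so the mass
   stays bounded as the precision is refined. *)
pose B := (2 * a + G) / G + 1.
have B0 : 0 < B by rewrite ltr_wpDl// divr_ge0// ltW// addr_gt0// mulr_gt0.
have GB : 0 < (G + Gam h) * B by rewrite mulr_gt0// addr_gt0.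
apply/eqP; rewrite -subr_eq0 -normr_le0; apply/ler_addgt0Pl => eps eps0; rewrite addr0.
pose delta := Num.min (G / 2) (eps / ((G + Gam h) * B)).
have delta0 : 0 < delta by rewrite lt_min !divr_gt0.
have [d1 d10 H1] := main_mass_approx h00 delta0.
have [d2 d20 H2] := main_mass_approx hn0 delta0.
pose c := Num.min 1 (Num.min d1 d2).
have c0 : 0 < c by rewrite !lt_min ltr01 d10.
have cd1 : c <= d1 by rewrite !ge_min lexx orbT.
have cd2 : c <= d2 by rewrite !ge_min lexx !orbT.
have := H1 _ c0 cd1; have := H2 _ c0 cd2; rewrite -/G -/a.
have M0 := main_mass_ge0 c0; move: (main_mass c) M0 => M M0 K2 K1.
have dG : delta <= G / 2 by rewrite ge_min lexx.
have de : delta * ((G + Gam h) * B) <= eps by rewrite -ler_pdivlMr// ge_min lexx orbT.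
have M1 : M + 1 <= B.
  rewrite /B lerD2r ler_pdivlMr// mulrC.
  move: K1; rewrite ler_norml => /andP[K1 _].
  have := ler_wpM2r (addr_ge0 M0 ler01) dG; lra.
(* The terms [G * Gam h * M] cancel, which removes the unknown mass. *)
have E : G * pole_value h - Gam h * a = G * (pole_value h - Gam h * M) + - (Gam h * (a - G * M)) by ring.
rewrite E; apply: le_trans (ler_normD _ _) _; rewrite normrN !normrM (gtr0_norm G0) (gtr0_norm Gh).
apply: le_trans de; rewrite mulrCA mulrDl; apply: lerD; rewrite ler_pM2l//.
  by apply: le_trans K2 _; rewrite ler_pM2l.
by apply: le_trans K1 _; rewrite ler_pM2l.
Qed.

End fundamental_solution.

(** * The pseudo-gauge *)

Section koranyi_gauge.
Variable R : realType.
Implicit Types (g h : heis R) (T lam tau : R).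

Definition koranyi lam g : R := lam * Num.sqrt (Num.sqrt (gauge4 g)).

Lemma gauge4_ge0 g : 0 <= gauge4 g.
Proof. by apply: addr_ge0; [exact: sqr_ge0|apply: mulr_ge0 => //; exact: sqr_ge0]. Qed.

Lemma gauge40 : gauge4 (0 : heis R) = 0.
Proof. by rewrite /gauge4 /planar_sq/= !expr0n/= mulr0 !addr0 expr0n. Qed.

(** The exponent [- 1 / (Q - 2) = - 1/2] turns [C N^-2] into [C^(-1/2) N], and the value 0 chosen at
    the pole agrees with [N 0 = 0]. *)
Lemma pseudo_gauge_koranyi (Gam : heis R -> R) : positive_fundamental_solution Gam ->
  exists2 lam, 0 < lam & pseudo_gauge Gam = koranyi lam.
Proof.
move=> /fundamental_solution_gauge[C C0 H]; exists (Num.sqrt C)^-1; first by rewrite invr_gt0 sqrtr_gt0.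
apply/funext => g; rewrite /pseudo_gauge /koranyi.
have [->|g0] := eqVneq g 0; first by rewrite gauge40 !sqrtr0 mulr0.
rewrite H// (_ : ((homogeneous_dim - 2)%:R)^-1 = 2^-1)// powRN powR12_sqrt; last first.
  by apply: mulr_ge0; [exact: ltW|rewrite invr_ge0 sqrtr_ge0].
by rewrite sqrtrM ?(ltW C0)// sqrtrV ?sqrtr_ge0// invfM invrK.
Qed.

Lemma koranyi_lt lam tau g : 0 < lam -> 0 <= tau -> (koranyi lam g < lam * tau) = (gauge4 g < tau ^+ 4).
Proof.
move=> l0 t0; rewrite ltr_pM2l// -(ltr_pXn2r (n := 4)) ?nnegrE ?sqrtr_ge0//.
by rewrite (exprM _ 2 2) sqr_sqrtr ?sqrtr_ge0// sqr_sqrtr ?gauge4_ge0.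
Qed.

Lemma gauge_ball_koranyi lam tau : 0 < lam -> 0 <= tau ->
  gauge_ball (koranyi lam) (lam * tau) = gauge_ball4 (tau ^+ 4).
Proof. by move=> l0 t0; apply/seteqP; split => g; rewrite /gauge_ball /gauge_ball4/= koranyi_lt. Qed.

Lemma directional_planar_sq : has_directional (@planar_sq R)
  (fun v g => 2 * (g.1.1 * v.1.1 + g.1.2 * v.1.2)).
Proof.
have H := has_directionalD (has_directionalM (@has_directional_x R) (@has_directional_x R))
  (has_directionalM (@has_directional_y R) (@has_directional_y R)).
move=> g; have [H1 H2] := H g; rewrite (_ : @planar_sq R = (fun g => g.1.1 * g.1.1 + g.1.2 * g.1.2)).
  by split => // v; rewrite H2; ring.
by apply/funext => k; rewrite /planar_sq !expr2.
Qed.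

Lemma directional_gauge4 : has_directional (@gauge4 R)
  (fun v g => 4 * planar_sq g * (g.1.1 * v.1.1 + g.1.2 * v.1.2) + 32 * g.2 * v.2).
Proof.
have H := has_directionalD (has_directionalM directional_planar_sq directional_planar_sq)
  (has_directionalM (has_directional_cst 16) (has_directionalM (@has_directional_s R) (@has_directional_s R))).
move=> g; have [H1 H2] := H g.
rewrite (_ : @gauge4 R = (fun g => planar_sq g * planar_sq g + 16 * (g.2 * g.2))).
  by split => // v; rewrite H2; ring.
by apply/funext => k; rewrite /gauge4 !expr2.
Qed.

Lemma continuous_gauge4 : continuous (@gauge4 R).
Proof. by move=> g; apply: differentiable_continuous; have [] := directional_gauge4 g. Qed.

Lemma open_gauge_ball4 T : open (gauge_ball4 T : set (heis R)).
Proof.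
rewrite (_ : gauge_ball4 T = @gauge4 R @^-1` [set x | x < T])//.
by apply: open_comp; [move=> g _; exact: continuous_gauge4|exact: open_lt].
Qed.

(* A point of the sphere is the limit of its contractions under the dilations. *)
Lemma closure_gauge_ball4 T : 0 < T -> closure (gauge_ball4 T) = [set g : heis R | gauge4 g <= T].
Proof.
move=> T0; apply/seteqP; split => g.
  have cl : closed [set g : heis R | gauge4 g <= T].
    rewrite (_ : [set g | _] = @gauge4 R @^-1` [set x | x <= T])//.
    by apply: closed_comp; [move=> k _; exact: continuous_gauge4|exact: closed_le].
  by rewrite [X in _ -> X g]((closure_id _).1 cl); apply: closure_subset => k /ltW.
move=> /= gT B nB.
pose dil (t : R) : heis R := ((t * g.1.1, t * g.1.2), t ^+ 2 * g.2).
have dilE t : gauge4 (dil t) = t ^+ 4 * gauge4 g by rewrite /gauge4 /planar_sq/=; ring.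
have cd : dil t @[t --> (1 : R)] --> g.
  have c1 (a : R) : t * a @[t --> (1 : R)] --> a.
    by rewrite -[X in _ --> X]mul1r; apply: cvgM; [exact: cvg_id|exact: cvg_cst].
  have c2 (a : R) : t ^+ 2 * a @[t --> (1 : R)] --> a.
    rewrite -[X in _ --> X]mul1r; apply: cvgM; last exact: cvg_cst.
    by have := @exprn_continuous R 2 1; rewrite /continuous_at /= expr1n.
  case: g {gT nB dilE} @dil => [[a b] c] dil.
  exact: (cvg_pair (cvg_pair (c1 a) (c1 b)) (c2 c)).
have /cvg_at_left_filter cdl := cd.
have [t [Bt t0 t1]] : exists t, [/\ B (dil t), 0 < t & t < 1].
  apply: (@filter_ex _ (at_left (1 : R))); near=> t; split.
  - by near: t; exact: cdl.
  - near: t; exact: nbhs_left_gt.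
  - near: t; exact: nbhs_left_lt.
exists (dil t); split => //; rewrite /gauge_ball4/= dilE.
apply: (@le_lt_trans _ _ (t ^+ 4 * T)); first by rewrite ler_pM2l ?exprn_gt0.
by rewrite gtr_pMl// exprn_ilt1// ltW.
Unshelve. all: by end_near. Qed.

Lemma gauge_sphere_koranyi lam tau : 0 < lam -> 0 < tau ->
  gauge_sphere (koranyi lam) (lam * tau) = [set g | gauge4 g = tau ^+ 4].
Proof.
move=> l0 t0; rewrite /gauge_sphere gauge_ball_koranyi// ?(ltW t0)//.
rewrite closure_gauge_ball4 ?exprn_gt0// ((interior_id _).1 (@open_gauge_ball4 _)).
apply/seteqP; split => g; rewrite /gauge_ball4/=.
  by move=> [gT /negP]; rewrite -leNgt => Tg; apply/eqP; rewrite eq_le gT Tg.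
by move=> ->; rewrite lexx ltxx; split.
Qed.

Lemma derive_comp_at (F : R -> R) (u : heis R -> R) (dF : R) v g : differentiable u g ->
  is_derive (u g) 1 F dF -> 'D_v (fun k => F (u k)) g = dF * 'D_v u g.
Proof.
move=> du [F1 F2].
have dF1 : differentiable F (u g) by apply/derivable1_diffP.
have dFu : differentiable (F \o u) g by exact: differentiable_comp.
rewrite -[LHS]/('D_v (F \o u) g) deriveE// diff_comp// [in RHS]deriveE//=.
by rewrite diff1E// derive1E F2 mulrC.
Qed.

Lemma derive_koranyi lam g v : 0 < gauge4 g -> 'D_v (koranyi lam) g =
  lam / (4 * Num.sqrt (Num.sqrt (gauge4 g)) ^+ 3) *
  (4 * planar_sq g * (g.1.1 * v.1.1 + g.1.2 * v.1.2) + 32 * g.2 * v.2).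
Proof.
move=> g0; have [dg Dg] := directional_gauge4 g; rewrite -Dg.
apply: (@derive_comp_at (fun x => lam * Num.sqrt (Num.sqrt x))) => //; set x := gauge4 g in g0 *.
have s0 : 0 < Num.sqrt x by rewrite sqrtr_gt0.
have ss0 : 0 < Num.sqrt (Num.sqrt x) by rewrite sqrtr_gt0.
have D1 := @is_derive1_comp _ Num.sqrt Num.sqrt x _ _ (is_derive1_sqrt s0) (is_derive1_sqrt g0).
have D2 := @is_deriveM _ _ (cst lam : R -> R) _ x 1 _ _ (is_derive_cst _ _ _) D1.
apply: (is_derive_eq D2); rewrite /GRing.scale/= mulr0 addr0.
set y := Num.sqrt (Num.sqrt x) in ss0 *.
have <- : y ^+ 2 = Num.sqrt x by rewrite sqr_sqrtr// ltW.
by field; rewrite gt_eqF.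
Qed.

(** For [P = N^4] one has [|grad_H P|^2 = 16 |z|^2 P] and [|grad P|^2 = 16 (|z|^6 + 64 sigma^2)].
    The chain rule multiplies both gradients by [c = lam / (4 tau^3)]. *)
Lemma perimeter_weight lam tau g : 0 < lam -> 0 < tau -> gauge4 g = tau ^+ 4 ->
  horizontal_grad_norm (koranyi lam) g * (horizontal_grad_norm (koranyi lam) g / grad_norm (koranyi lam) g) =
  lam * tau * area_weight (tau ^+ 4) g.2.
Proof.
move=> l0 t0 gT; have g0 : 0 < gauge4 g by rewrite gT exprn_gt0.
have z0 := planar_sq_ge0 g.
have qE : Num.sqrt (Num.sqrt (gauge4 g)) = tau.
  rewrite gT (exprM _ 2 2) sqrtr_sqr ger0_norm ?exprn_ge0 ?ltW//.
  by rewrite sqrtr_sqr ger0_norm ?ltW.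
have [c c0 cE] : exists2 c, 0 < c & lam / (4 * tau ^+ 3) = c.
  by eexists; last reflexivity; rewrite divr_gt0// mulr_gt0// exprn_gt0.
have -> : horizontal_grad_norm (koranyi lam) g = 4 * c * (Num.sqrt (planar_sq g) * tau ^+ 2).
  rewrite /horizontal_grad_norm /X1 /X2 /d_x /d_y /d_s !derive_koranyi// qE cE/=.
  have -> : (c * (4 * planar_sq g * (g.1.1 * 1 + g.1.2 * 0) + 32 * g.2 * 0) -
     g.1.2 / 2 * (c * (4 * planar_sq g * (g.1.1 * 0 + g.1.2 * 0) + 32 * g.2 * 1))) ^+ 2 +
     (c * (4 * planar_sq g * (g.1.1 * 0 + g.1.2 * 1) + 32 * g.2 * 0) +
     g.1.1 / 2 * (c * (4 * planar_sq g * (g.1.1 * 0 + g.1.2 * 0) + 32 * g.2 * 1))) ^+ 2 =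
     (4 * c) ^+ 2 * (planar_sq g * gauge4 g).
    by rewrite /gauge4 /planar_sq; field.
  rewrite sqrtrM ?sqr_ge0// sqrtr_sqr gtr0_norm ?mulr_gt0//.
  rewrite sqrtrM// gT (exprM tau 2 2) sqrtr_sqr ger0_norm ?sqr_ge0//.
have -> : grad_norm (koranyi lam) g = 4 * c * Num.sqrt (planar_sq g ^+ 3 + 64 * g.2 ^+ 2).
  rewrite /grad_norm /d_x /d_y /d_s !derive_koranyi// qE cE/=.
  have -> : (c * (4 * planar_sq g * (g.1.1 * 1 + g.1.2 * 0) + 32 * g.2 * 0)) ^+ 2 +
    (c * (4 * planar_sq g * (g.1.1 * 0 + g.1.2 * 1) + 32 * g.2 * 0)) ^+ 2 +
    (c * (4 * planar_sq g * (g.1.1 * 0 + g.1.2 * 0) + 32 * g.2 * 1)) ^+ 2 =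
    (4 * c) ^+ 2 * (planar_sq g ^+ 3 + 64 * g.2 ^+ 2).
    by rewrite /planar_sq; ring.
  by rewrite sqrtrM ?sqr_ge0// sqrtr_sqr gtr0_norm ?mulr_gt0.
rewrite /area_weight -(planar_sq_rad2 gT).
set w := Num.sqrt (planar_sq g ^+ 3 + _).
have -> : planar_sq g / w = Num.sqrt (planar_sq g) ^+ 2 / w by rewrite sqr_sqrtr.
have [->|w0] := eqVneq w 0; first by rewrite !mulr0 invr0 !mulr0.
rewrite -cE; by field; rewrite w0 (gt_eqF l0) (gt_eqF t0).
Qed.

End koranyi_gauge.

(** * The boundary integral *)

Section isometry.
Variable R : realType.
Local Notation Tc := (caratheodory_type (@hausdorff2_outer R)).
Variables (rot inv_rot : heis R -> heis R).
Hypothesis inv_rotK : cancel inv_rot rot.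
Hypothesis isom : forall p q, sqdist (rot p) (rot q) = sqdist p q.

Let image_preimage A : rot @` (rot @^-1` A) = A.
Proof.
apply/seteqP; split => [_ [p Ap <-]//|p Ap].
by exists (inv_rot p); rewrite /= inv_rotK.
Qed.

Lemma hausdorff2_preimage A : hausdorff2 (rot @^-1` A) = hausdorff2 A.
Proof. by rewrite -(hausdorff2_isometry _ isom) image_preimage. Qed.

(** The Caratheodory condition for the preimage of [A], tested on [X], is carried by the isometry to
    the condition for [A], tested on the image of [X]. *)
Lemma measurable_isometry : measurable_fun [set: Tc] (rot : Tc -> Tc).
Proof.
move=> _ A mA; rewrite setTI.
suff : (@hausdorff2_outer R).-caratheodory (rot @^-1` A) by [].
move=> X; have : (@hausdorff2_outer R).-caratheodory A by [].
move=> /(_ (rot @` X)); rewrite /=.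
rewrite (hausdorff2_isometry X isom) => ->.
rewrite -[in RHS](hausdorff2_isometry (X `&` _) isom) -[in RHS](hausdorff2_isometry (X `&` ~` _) isom).
congr (hausdorff2 _ + hausdorff2 _)%E; apply/seteqP; split.
- by move=> _ [[p Xp <-] Ap]; exists p.
- by move=> _ [p [Xp Ap] <-]; split => //; exists p.
- by move=> _ [[p Xp <-] Ap]; exists p.
- by move=> _ [p [Xp Ap] <-]; split => //; exists p.
Qed.

Lemma ge0_integral_isometry (f : Tc -> \bar R) : measurable_fun setT f ->
  (forall p, 0 <= f p)%E -> (\int[@H2 R]_p f (rot p) = \int[@H2 R]_p f p)%E.
Proof.
move=> mf f0; have mrot := measurable_isometry.
pose m : {measure set _ -> \bar R} := measure_function_pushforward__canonical__measure_function_Measure (@H2 R) mrot.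
transitivity (\int[m]_p f p)%E; first by rewrite [RHS]ge0_integral_pushforward.
by apply: eq_measure_integral => A mA _; exact: hausdorff2_preimage.
Qed.

End isometry.

(** * Averaging over rotations about the vertical axis *)

Section perimeter_average.
Variable R : realType.
Local Notation Tc := (caratheodory_type (@hausdorff2_outer R)).
Local Notation leb := (@lebesgue_measure R).
Local Notation H2 := (@H2 R).
Local Notation f := (@cubic_harmonic R).
Implicit Types (p q : heis R) (T s t : R).

Let c : R := (Num.sqrt 2)^-1.

Let c2 : c ^+ 2 = 2^-1. Proof. by rewrite exprVn sqr_sqrtr. Qed.

Definition rotate45 p : heis R := ((c * (p.1.1 - p.1.2), c * (p.1.1 + p.1.2)), p.2).

Let unrotate45 p : heis R := ((c * (p.1.1 + p.1.2), c * (p.1.2 - p.1.1)), p.2).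

(** Identities that hold modulo [2 c^2 = 1] become polynomial identities once one side is multiplied
    by [2 c^2]. *)
Let cc (a b : R) : a = (2 * c ^+ 2) * b -> a = b.
Proof. by move=> ->; rewrite c2 mulfV ?mul1r// pnatr_eq0. Qed.

Let unrotate45K : cancel unrotate45 rotate45.
Proof. by move=> [[x y] s]; rewrite /rotate45 /unrotate45/=; congr ((_, _), _); apply: cc; ring. Qed.

Let rotate45_isometry p q : sqdist (rotate45 p) (rotate45 q) = sqdist p q.
Proof.
rewrite /sqdist /rotate45/=; congr (_ + _); apply: cc; ring.
Qed.

Let planar_sq_rotate45 p : planar_sq (rotate45 p) = planar_sq p.
Proof. by rewrite /planar_sq /rotate45/=; apply: cc; ring. Qed.

Lemma measurable_punctured_sphere T : measurable (punctured_sphere T : set Tc).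
Proof.
have [mx my ms] := @measurable_coordinates R.
have m1 : measurable ([set p | gauge4 p = T] : set Tc).
  rewrite (_ : [set p | _] = setT `&` (@gauge4 R : Tc -> R) @^-1` [set T]); last by rewrite setTI.
  by apply: measurable_gauge4.
have m2 : measurable ([set p | 16 * p.2 ^+ 2 < T] : set Tc).
  rewrite (_ : [set p | _] = setT `&` (fun p : Tc => 16 * p.2 ^+ 2 : R) @^-1` [set x | x < T]); last by rewrite setTI.
  have : measurable_fun [set: Tc] (fun p : Tc => 16 * p.2 ^+ 2 : R).
    by apply: measurable_funM; [exact: measurable_cst|exact: measurable_funX].
  by apply => //; rewrite -set_itvNyo; exact: measurable_itv.
exact: measurableI.
Qed.

Lemma integral_sphere_rotate45 T (h : Tc -> R) : measurable_fun setT h -> (forall p, 0 <= h p) ->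
  (\int[H2]_(p in (punctured_sphere T : set Tc)) (h (rotate45 p) * area_weight T p.2)%:E =
   \int[H2]_(p in (punctured_sphere T : set Tc)) (h p * area_weight T p.2)%:E)%E.
Proof.
move=> mh h0; rewrite [LHS]integral_mkcond [RHS]integral_mkcond.
have [mx my ms] := @measurable_coordinates R.
have mS := measurable_punctured_sphere T.
pose F (p : Tc) : \bar R := ((fun p => (h p * area_weight T p.2)%:E) \_ (punctured_sphere T : set Tc)) p.
rewrite -(@ge0_integral_isometry R rotate45 unrotate45 unrotate45K rotate45_isometry F).
- apply: eq_integral => p _; rewrite /F /patch/=.
  have -> // : (rotate45 p \in (punctured_sphere T : set Tc)) = (p \in (punctured_sphere T : set Tc)).
  by apply/idP/idP; rewrite !inE /punctured_sphere/= /gauge4 planar_sq_rotate45.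
- apply/(measurable_restrictT _ mS); apply: measurable_funTS; apply/measurable_EFinP.
  exact: (measurable_funM mh (measurableT_comp (measurable_area_weight T) ms)).
- by move=> p; rewrite /F /patch; case: ifP => // _; rewrite lee_fin mulr_ge0// area_weight_ge0.
Qed.

(* The mean of [f ^+ 2] over a circle of squared radius [w] at height [s]. As
   [f ^+ 2] is even under the half turn and its Fourier modes have order at
   most 6, the mean is attained by the four rotations by multiples of pi / 4. *)
Definition circle_mean (w s : R) : R :=
  w / 2 + 18 * w * s ^+ 2 - 3 / 4 * w ^+ 2 + 5 / 16 * w ^+ 3.

(** The means of [x^2], [x^4], [x^6] are [w / 2], [3/8 w^2], [5/16 w^3]. They produce [w / 2] from
    [x^2], [18 w s^2] from [(6 y s)^2], [- 3/4 w^2] from [- 2 x^4] and [5/16 w^3] from [x^6]; the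
    products with an odd power of [y] average to 0. *)
Lemma circle_meanE p : f p ^+ 2 + f (rotate45 p) ^+ 2 + f (rotate45 (rotate45 p)) ^+ 2 +
  f (rotate45 (rotate45 (rotate45 p))) ^+ 2 = 4 * circle_mean (planar_sq p) p.2.
Proof.
(* [f] is odd in the planar variables, so a single factor [c] comes out of [f (rotate45 q)] and its
   square is rational. *)
have f45 (q : heis R) : f (rotate45 q) ^+ 2 =
  2^-1 * ((q.1.1 - q.1.2) + 6 * (q.1.1 + q.1.2) * q.2 - (q.1.1 - q.1.2) ^+ 3 / 2) ^+ 2.
  rewrite -c2 /cubic_harmonic /rotate45/= -exprMn; congr (_ ^+ 2).
  by ring.
have r2 (q : heis R) : rotate45 (rotate45 q) = ((- q.1.2, q.1.1), q.2).
  by rewrite /rotate45/=; congr ((_, _), _); apply: cc; ring.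
rewrite r2 !f45 /cubic_harmonic/= /circle_mean /planar_sq; by field.
Qed.

(** A mean of squares at the point of the circle with [y = 0]; the polynomial itself has a negative
    coefficient. *)
Lemma circle_mean_ge0 w s : 0 <= w -> 0 <= circle_mean w s.
Proof.
move=> w0; have := circle_meanE ((Num.sqrt w, 0), s).
rewrite /planar_sq/= expr0n addr0 sqr_sqrtr// => E.
by rewrite -(pmulr_rge0 _ (ltr0n R 4)) -E !addr_ge0// sqr_ge0.
Qed.

Lemma continuous_circle_mean T : continuous (fun s => circle_mean (rad2 T s) s).
Proof.
have cw n : continuous (fun s => rad2 T s ^+ n).
  move=> s; apply: (@continuous_comp _ _ _ (rad2 T) (fun x => x ^+ n)); first exact: continuous_rad2.
  exact: exprn_continuous.
have cM (u v : R -> R) : continuous u -> continuous v -> continuous (fun s => u s * v s).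
  by move=> cu cv s; apply: cvgM; [exact: cu|exact: cv].
have ck (x : R) : continuous (fun _ : R => x) by move=> s; exact: cvg_cst.
have c1 := @continuous_rad2 R T.
have cX n : continuous (fun s : R => s ^+ n) by exact: exprn_continuous.
move=> s; apply: cvgD; last by apply: (@cM (fun=> 5 / 16) (fun s => rad2 T s ^+ 3)).
apply: cvgB; last by apply: (@cM (fun=> 3 / 4) (fun s => rad2 T s ^+ 2)).
apply: cvgD; first by apply: (@cM (rad2 T) (fun=> 2^-1)).
apply: (@cM (fun s => 18 * rad2 T s) (fun s => s ^+ 2)) => //.
exact: (@cM (fun=> 18) (rad2 T)).
Qed.

Lemma measurable_cubic_harmonic : measurable_fun [set: Tc] (f : Tc -> R).
Proof.
have [mx my ms] := @measurable_coordinates R.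
apply: measurable_funB; last exact: measurable_funX.
apply: measurable_funD; first exact: mx.
apply: measurable_funM; last exact: ms.
by apply: measurable_funM; [exact: measurable_cst|exact: my].
Qed.

Lemma perimeter_cubic T : 0 < T ->
  (\int[H2]_(p in (punctured_sphere T : set Tc)) (f p ^+ 2 * area_weight T p.2)%:E =
   (cylinder_const R)%:E * \int[leb]_(s in height_range T) (circle_mean (rad2 T s) s)%:E)%E.
Proof.
move=> T0; rewrite -surf_int_total//; last 2 first.
- exact: continuous_circle_mean.
- by move=> s; apply: circle_mean_ge0; exact: sqrtr_ge0.
set S : set Tc := punctured_sphere T.
have [mx my ms] := @measurable_coordinates R.
have mr : measurable_fun [set: Tc] (rotate45 : Tc -> Tc).
  exact: (measurable_isometry rotate45_isometry).
pose h0 (p : Tc) : R := f p ^+ 2.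
have m0 : measurable_fun [set: Tc] h0 by apply: measurable_funX; exact: measurable_cubic_harmonic.
pose h1 p := h0 (rotate45 p); pose h2 p := h1 (rotate45 p); pose h3 p := h2 (rotate45 p).
have m1 : measurable_fun [set: Tc] h1 := measurableT_comp m0 mr.
have m2 : measurable_fun [set: Tc] h2 := measurableT_comp m1 mr.
have m3 : measurable_fun [set: Tc] h3 := measurableT_comp m2 mr.
have h0_ge0 p : 0 <= h0 p by exact: sqr_ge0.
have E1 := integral_sphere_rotate45 T m0 h0_ge0.
have E2 := integral_sphere_rotate45 T m1 (fun p => h0_ge0 _).
have E3 := integral_sphere_rotate45 T m2 (fun p => h0_ge0 _).
rewrite -/S in E1 E2 E3.
pose w (p : Tc) := area_weight T p.2.
have mw : measurable_fun [set: Tc] w := measurableT_comp (measurable_area_weight T) ms.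
have w0 p : 0 <= w p by exact: area_weight_ge0.
have mS : measurable S by exact: measurable_punctured_sphere.
have Z (h : Tc -> R) : measurable_fun setT h -> (forall p, 0 <= h p) ->
  (\int[H2]_(p in S) (4^-1 * (h p * w p))%:E = (4^-1)%:E * \int[H2]_(p in S) (h p * w p)%:E)%E.
  move=> mh hp; under eq_integral do rewrite EFinM.
  apply: ge0_integralZl_EFin; [exact: mS| | |by rewrite invr_ge0].
  - by move=> p _; rewrite lee_fin; apply: mulr_ge0; [exact: hp|exact: w0].
  - by apply/measurable_EFinP; apply: measurable_funTS; exact: measurable_funM.
transitivity (\int[H2]_(p in S) (((4^-1 * (h0 p * w p))%:E + (4^-1 * (h1 p * w p))%:E) +
  ((4^-1 * (h2 p * w p))%:E + (4^-1 * (h3 p * w p))%:E)))%E; last first.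
  apply: eq_integral => p; rewrite inE => -[gT _].
  rewrite -!EFinD; congr _%:E; rewrite -(planar_sq_rad2 gT) -/(w p).
  transitivity (4^-1 * (h0 p + h1 p + h2 p + h3 p) * w p); first by ring.
  by rewrite /h3 /h2 /h1 /h0 circle_meanE mulKf.
have mm (h : Tc -> R) : measurable_fun setT h -> measurable_fun S (fun p => (4^-1 * (h p * w p))%:E).
  move=> mh; apply/measurable_EFinP; apply: measurable_funTS.
  by apply: (measurable_funM (measurable_cst _)); exact: measurable_funM.
have pp (h : Tc -> R) : (forall p, 0 <= h p) -> forall p, S p -> (0 <= (4^-1 * (h p * w p))%:E)%E.
  by move=> hp p _; rewrite lee_fin; apply: mulr_ge0 => //; exact: mulr_ge0.
have h1_ge0 p : 0 <= h1 p by exact: sqr_ge0.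
have h2_ge0 p : 0 <= h2 p by exact: sqr_ge0.
have h3_ge0 p : 0 <= h3 p by exact: sqr_ge0.
rewrite (ge0_integralD _ mS); last 4 first.
- by move=> p Sp; apply: adde_ge0; [exact: (pp h0)|exact: (pp h1)].
- by apply: emeasurable_funD; [exact: (mm h0)|exact: (mm h1)].
- by move=> p Sp; apply: adde_ge0; [exact: (pp h2)|exact: (pp h3)].
- by apply: emeasurable_funD; [exact: (mm h2)|exact: (mm h3)].
rewrite (ge0_integralD _ mS (pp h0 h0_ge0) (mm h0 m0) (pp h1 h1_ge0) (mm h1 m1)).
rewrite (ge0_integralD _ mS (pp h2 h2_ge0) (mm h2 m2) (pp h3 h3_ge0) (mm h3 m3)).
rewrite (Z h0 m0 h0_ge0) (Z h1 m1 h1_ge0) (Z h2 m2 h2_ge0) (Z h3 m3 h3_ge0) E3 E2 E1 -/S.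
set I := (\int[H2]_(p in S) _)%E.
have I0 : (0 <= I)%E.
  by apply: integral_ge0 => p _; rewrite lee_fin; apply: mulr_ge0; [exact: sqr_ge0|exact: area_weight_ge0].
have q0 : (0 <= (4^-1 : R)%:E)%E by rewrite lee_fin invr_ge0.
rewrite -!ge0_muleDl//; try exact: adde_ge0.
rewrite -!EFinD (_ : _ + _ = 1) ?mul1e//.
by field.
Qed.

End perimeter_average.

(** * The energy integral *)

Section slices.
Variable R : realType.
Local Notation T1 := (measurableTypeR R).
Local Notation T2 := (measurableTypeR R * measurableTypeR R)%type.
Local Notation T3 := (measurableTypeR R * measurableTypeR R * measurableTypeR R)%type.
Local Notation leb := (@lebesgue_measure R).
Local Notation vol := (@leb3 R).
Implicit Types (v w s t : R).

Definition disc_sq (p : T2) : R := p.1 ^+ 2 + p.2 ^+ 2.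
Definition disc v : set T2 := [set p | disc_sq p < v].

Lemma disc_sq_ge0 p : 0 <= disc_sq p.
Proof. by rewrite addr_ge0 ?sqr_ge0. Qed.

Lemma measurable_disc_sq : measurable_fun setT disc_sq.
Proof.
by apply: measurable_funD; apply: measurable_funX; [exact: measurable_fst|exact: measurable_snd].
Qed.

Lemma measurable_disc v : measurable (disc v).
Proof.
rewrite (_ : disc v = setT `&` disc_sq @^-1` `]-oo, v[); last first.
  by rewrite setTI; apply/seteqP; split => p; rewrite /= in_itv.
by apply: measurable_disc_sq => //; exact: measurable_itv.
Qed.

Lemma integral_disc_dilation (f : T2 -> \bar R) w : 0 < w -> measurable_fun setT f ->
  (forall p, 0 <= f p)%E ->
  (\int[@leb2 R]_(p in disc w) f p =
   w%:E * \int[@leb2 R]_(p in disc 1) f (Num.sqrt w * p.1, Num.sqrt w * p.2)%R)%E.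
Proof.
move=> w0 mf f0; rewrite [LHS]integral_mkcond [in RHS]integral_mkcond.
have sw : 0 < Num.sqrt w by rewrite sqrtr_gt0.
have H := @ge0_integral_shear2 R (Num.sqrt w) (Num.sqrt w) 0 0 (f \_ (disc w)) sw sw.
rewrite -[LHS]/(\int[leb \x leb]_p (f \_ (disc w)) p)%E H; last 2 first.
- by apply/(measurable_restrictT _ (measurable_disc w)); exact: measurable_funTS.
- by move=> p; rewrite /patch; case: ifP.
rewrite -expr2 sqr_sqrtr ?ltW//; congr (_ * _)%E.
apply: eq_integral => p _; rewrite /patch !addr0.
have -> // : ((Num.sqrt w * p.1, Num.sqrt w * p.2) \in disc w) = (p \in disc 1).
have E : disc_sq (Num.sqrt w * p.1, Num.sqrt w * p.2) = w * disc_sq p.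
  by rewrite /disc_sq/= !exprMn sqr_sqrtr ?ltW// mulrDr.
by apply/idP/idP; rewrite !inE /disc/= E gtr_pMr.
Qed.

Lemma leb2_disc_fin : (@leb2 R (disc 1) < +oo)%E.
Proof.
pose I : set T1 := [set` `[-1, 1]].
have lI : (leb I < +oo)%E by rewrite lebesgue_measure_itv/=; case: ifPn => _; rewrite ltry.
have mI : measurable I by exact: measurable_itv.
apply: (@le_lt_trans _ _ (@leb2 R (I `*` I))).
  apply: le_measure; rewrite ?inE; [exact: measurable_disc|exact: measurableX|].
  move=> [x y]; rewrite /disc /disc_sq/= => xy1.
  have x2 := sqr_ge0 x; have y2 := sqr_ge0 y.
  have abs1 (z : R) : z ^+ 2 <= 1 -> I z.
    move=> z1; rewrite /I/= in_itv/= -ler_norml -(ler_pXn2r (n := 2)) ?nnegrE//.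
    by rewrite real_normK ?num_real// expr1n.
  by split; apply: (abs1 _) => /=; lra.
have -> : @leb2 R (I `*` I) = (leb I * leb I)%E by exact: (@product_measure1E _ _ _ _ _ leb leb I I).
by rewrite lte_mul_pinfty// ge0_fin_numE.
Qed.

(** Classically [pi]; the proof uses only that it is finite and positive. *)
Definition disc_const : R := fine (@leb2 R (disc 1)).

Lemma disc_constE : (@leb2 R (disc 1) = disc_const%:E)%E.
Proof. by rewrite /disc_const fineK// ge0_fin_numE// leb2_disc_fin. Qed.

Lemma disc_const_gt0 : 0 < disc_const.
Proof.
pose I : set T1 := [set` `[0, 2^-1]].
have mI : measurable I by exact: measurable_itv.
have lI : leb I = (2^-1)%:E by rewrite lebesgue_measure_itv/= lte_fin invr_gt0 ltr0n sube0.
rewrite -lte_fin -disc_constE; apply: (@lt_le_trans _ _ (@leb2 R (I `*` I))).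
  have -> : @leb2 R (I `*` I) = (leb I * leb I)%E by exact: (@product_measure1E _ _ _ _ _ leb leb I I).
  by rewrite lI -EFinM lte_fin mulr_gt0// invr_gt0.
apply: le_measure; rewrite ?inE; [exact: measurableX|exact: measurable_disc|].
move=> [x y] [/=]; rewrite /I/= !in_itv/= => /andP[x0 x1] /andP[y0 y1]; rewrite /disc /disc_sq/=.
have := ler_pM x0 x0 x1 x1; have := ler_pM y0 y0 y1 y1; rewrite -!expr2; lra.
Qed.

Lemma leb2_disc w : 0 <= w -> @leb2 R (disc w) = (disc_const * w)%:E.
Proof.
rewrite le_eqVlt => /predU1P[<-|w0].
  rewrite mulr0 (_ : disc 0 = set0) ?measure0//.
  by apply/seteqP; split => // p; rewrite /disc/= ltNge disc_sq_ge0.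
have := @integral_disc_dilation (cst 1%E) w w0 (measurable_cst _) (fun=> lee01).
rewrite !integral_cst ?mul1e; [|exact: measurable_disc|exact: measurable_disc].
move=> E; transitivity (w%:E * @leb2 R (disc 1))%E; first exact: E.
by rewrite disc_constE -EFinM mulrC.
Qed.

Let integral_ramp : (\int[leb]_(v in [set` `[0, 1]%R]) (disc_const * v)%:E = (disc_const / 2)%:E)%E.
Proof.
pose F (v : R) : R := disc_const / 2 * v ^+ 2.
have dF (v : R) : is_derive v 1 F (disc_const * v).
  have H := @is_deriveX _ _ (id : R -> R) 2 v (1 : R) _ (@is_derive_id _ _ v (1 : R)).
  have K := @is_deriveM _ _ (cst (disc_const / 2) : R -> R) _ v 1 _ _ (is_derive_cst _ _ _) H.
  rewrite (_ : F = cst (disc_const / 2) * (id ^+ 2)); last by apply/funext => x; rewrite /F exprfctE.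
  by apply: (is_derive_eq K); rewrite /GRing.scale/=; field.
have cF : continuous F.
  by move=> v; apply/differentiable_continuous/derivable1_diffP; have [] := dF v.
rewrite (@continuous_FTC2 _ (fun v => disc_const * v) F 0 1)//.
- by rewrite /F -EFinB expr1n expr0n mulr1 mulr0 subr0.
- apply: continuous_subspaceT => v; apply: cvgM; first exact: cvg_cst.
  exact: cvg_id.
- split; first by move=> v _; have [] := dF v.
  + by apply: cvg_at_right_filter; exact: cF.
  + by apply: cvg_at_left_filter; exact: cF.
- by move=> v _; rewrite derive1E; have [_ ->] := dF v.
Qed.

(* Layer cake: [1 - disc_sq p] is the length of [{v | disc_sq p < v <= 1}]. *)
Let integral_one_minus_disc_sq :
  (\int[@leb2 R]_(p in disc 1) (1 - disc_sq p)%:E = (disc_const / 2)%:E)%E.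
Proof.
pose U : set T3 := [set q | disc_sq q.1 < q.2 <= 1].
have mU : measurable U.
  have m1 : measurable_fun [set: T3] (fun q : T3 => q.2 - disc_sq q.1 : R).
    apply: measurable_funB; first exact: measurable_snd.
    exact: (measurableT_comp measurable_disc_sq measurable_fst).
  have m2 : measurable_fun [set: T3] (fun q : T3 => q.2 : R) by exact: measurable_snd.
  rewrite (_ : U = ([set: T3] `&` (fun q : T3 => q.2 - disc_sq q.1 : R) @^-1` [set` `]0, +oo[]) `&`
    ([set: T3] `&` (fun q : T3 => q.2 : R) @^-1` [set` `]-oo, 1]])).
    apply: measurableI; [apply: m1|apply: m2] => //; exact: measurable_itv.
  rewrite !setTI; apply/seteqP; split => q; rewrite /U/= !in_itv/= andbT subr_gt0.
    by move=> /andP[].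
  by move=> [-> ->].
pose f (q : T3) : \bar R := (\1_U q)%:E.
have mf : measurable_fun [set: T3] f by apply/measurable_EFinP; exact: measurable_indic.
have f0 q : (0 <= f q)%E by rewrite lee_fin.
have := @fubini_tonelli _ _ _ _ R (@leb2 R) leb f mf f0.
have -> : (\int[@leb2 R]_p \int[leb]_v f (p, v) = \int[@leb2 R]_(p in disc 1) (1 - disc_sq p)%:E)%E.
  rewrite [RHS]integral_mkcond; apply: eq_integral => p _.
  rewrite (_ : (fun v => f (p, v)) = (fun v => (\1_([set` `]disc_sq p, 1]]) v)%:E)); last first.
    apply/funext => v; rewrite /f !indicE.
    have -> // : ((p, v) \in U) = (v \in [set` `]disc_sq p, 1]]).
    by rewrite /U; apply/idP/idP => /set_mem/= H; apply/mem_set => /=; move: H; rewrite in_itv.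
  rewrite integral_indic ?setIT; [|exact: measurableT|exact: measurable_itv].
  rewrite -[LHS]/(leb [set` `]disc_sq p, 1]]) lebesgue_measure_itv/= lte_fin /patch.
  by have [p1|p1] := ltP (disc_sq p) 1; [rewrite mem_set|rewrite memNset// /disc/= ltNge p1].
have -> : (\int[leb]_v \int[@leb2 R]_p f (p, v) = \int[leb]_(v in [set` `[0, 1]%R]) (disc_const * v)%:E)%E.
  rewrite [RHS]integral_mkcond; apply: eq_integral => v _; rewrite /patch.
  have [v1|v1] := leP v 1; last first.
    rewrite memNset/=; last by rewrite in_itv/= (leNgt v) v1 andbF.
    rewrite (_ : (fun p => f (p, v)) = cst 0%E) ?integral0//.
    by apply/funext => p; rewrite /f indicE memNset// /U/= (leNgt v) v1 andbF.
  rewrite (_ : (fun p => f (p, v)) = (fun p => (\1_(disc v) p)%:E)); last first.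
    apply/funext => p; rewrite /f !indicE.
    have -> // : ((p, v) \in U) = (p \in disc v).
    by apply/idP/idP; rewrite !inE /U/= v1 andbT.
  rewrite integral_indic ?setIT; [|exact: measurableT|exact: measurable_disc].
  rewrite -[LHS]/(@leb2 R (disc v)).
  have [v0|v0] := leP 0 v; first by rewrite leb2_disc// mem_set//= in_itv/= v0.
  rewrite memNset/=; last by rewrite in_itv/= leNgt v0.
  rewrite (_ : disc v = set0) ?measure0//.
  by apply/seteqP; split => // p; rewrite /disc/= ltNge (le_trans (ltW v0))// disc_sq_ge0.
by move=> ->; exact: integral_ramp.
Qed.

(** On the unit disc [disc_sq] and [1 - disc_sq] add up to 1, and the second integrates to half the
    area; a dilation gives the other radii. *)
Lemma integral_disc_sq w : 0 <= w ->
  (\int[@leb2 R]_(p in disc w) (disc_sq p)%:E = (disc_const / 2 * w ^+ 2)%:E)%E.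
Proof.
rewrite le_eqVlt => /predU1P[<-|w0].
  rewrite expr0n mulr0 (_ : disc 0 = set0) ?integral_set0//.
  by apply/seteqP; split => // p; rewrite /disc/= ltNge disc_sq_ge0.
have mEd : measurable_fun setT (fun p => (disc_sq p)%:E).
  by apply/measurable_EFinP; exact: measurable_disc_sq.
rewrite integral_disc_dilation//; last by move=> p; rewrite lee_fin disc_sq_ge0.
have key : (\int[@leb2 R]_(p in disc 1) (disc_sq p)%:E = (disc_const / 2)%:E)%E.
  have E : (\int[@leb2 R]_(p in disc 1) (disc_sq p)%:E + (disc_const / 2)%:E = disc_const%:E)%E.
    rewrite -integral_one_minus_disc_sq -ge0_integralD//.
    - rewrite -disc_constE -[RHS]mul1e -integral_cst; last exact: measurable_disc.
      by apply: eq_integral => p _; rewrite -EFinD addrC subrK.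
    - exact: measurable_disc.
    - by move=> p _; rewrite lee_fin disc_sq_ge0.
    - exact: measurable_funTS.
    - by move=> p /ltW; rewrite lee_fin subr_ge0.
    - apply/measurable_EFinP; apply: measurable_funTS; apply: measurable_funB => //.
      exact: measurable_disc_sq.
  move: E; case: (\int[_]_(_ in _) _)%E => [x||]//; rewrite -EFinD => -[xE].
  by congr _%:E; lra.
rewrite (eq_integral (fun p => w%:E * (disc_sq p)%:E)%E); last first.
  move=> p _; rewrite -EFinM /disc_sq/= !exprMn sqr_sqrtr ?ltW//.
  by rewrite mulrDr.
rewrite ge0_integralZl_EFin; last 4 first.
- exact: measurable_disc.
- by move=> p _; rewrite lee_fin disc_sq_ge0.
- exact: measurable_funTS.
- exact: ltW.
by rewrite key -!EFinM; congr _%:E; ring.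
Qed.

Lemma leb3_slices (f : T3 -> \bar R) : measurable_fun setT f -> (forall g, 0 <= f g)%E ->
  (\int[vol]_g f g = \int[leb]_s \int[@leb2 R]_p f (p, s))%E.
Proof. by move=> mf f0; exact: (@fubini_tonelli2 _ _ _ _ R (@leb2 R) leb f mf f0). Qed.

Lemma gauge_ball4_slice (p : T2) s : gauge_ball4 1 (p, s) <-> disc (rad2 1 s) p.
Proof.
have d0 := disc_sq_ge0 p.
rewrite /gauge_ball4 /disc/= /gauge4 /planar_sq/= -/(disc_sq p) /rad2 -ltrBrDr.
have [s1|s1] := ltP 0 (1 - 16 * s ^+ 2).
  by rewrite -{2}(ger0_norm d0) -sqrtr_sqr ltr_sqrt.
by rewrite ler0_sqrtr// !ltNge d0 (le_trans s1)// sqr_ge0.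
Qed.

(** The slice of the unit gauge ball at height [s] is a disc of squared radius [rad2 1 s]. For
    [16 s^2 >= 1] it is empty, in accordance with [F 0 = 0]. *)
Lemma integral_unit_ball_slices (u : R -> R) (F : R -> R) : measurable_fun setT u ->
  (forall x, 0 <= x -> 0 <= u x) -> F 0 = 0 ->
  (forall w, (0 <= w)%R -> \int[@leb2 R]_(p in disc w) (u (disc_sq p))%:E = (F w)%:E)%E ->
  (\int[vol]_(g in gauge_ball4 1) (u (planar_sq g))%:E =
   \int[leb]_(s in height_range 1) (F (rad2 1 s))%:E)%E.
Proof.
move=> mu u0 F0 H; rewrite [LHS]integral_mkcond [RHS]integral_mkcond leb3_slices; last 2 first.
- apply/(measurable_restrictT _ (measurable_gauge_ball4 1)); apply: measurable_funTS.
  apply/measurable_EFinP; exact: (measurableT_comp mu (@measurable_planar_sq R)).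
- by move=> g; rewrite /patch; case: ifP => // _; rewrite lee_fin u0// planar_sq_ge0.
apply: eq_integral => s _; rewrite /patch.
have -> : (\int[@leb2 R]_p (if (p, s) \in gauge_ball4 1 then (u (planar_sq (p, s)))%:E else 0) =
  \int[@leb2 R]_(p in disc (rad2 1 s)) (u (disc_sq p))%:E)%E.
  rewrite [RHS]integral_mkcond; apply: eq_integral => p _; rewrite /patch.
  have -> // : ((p, s) \in (gauge_ball4 1 : set T3)) = (p \in disc (rad2 1 s)).
  by apply/idP/idP; rewrite !inE => /gauge_ball4_slice.
rewrite H; last exact: sqrtr_ge0.
case: ifPn => //; rewrite notin_setE /height_range/= => /negP; rewrite -leNgt => s1.
by rewrite /rad2 ler0_sqrtr ?subr_le0// F0.
Qed.

(** The [W_n] of the overview. *)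
Definition height_moment n : R := \int[leb]_(s in height_range 1) (rad2 1 s ^+ n).

Lemma measurable_height_range T : measurable (height_range T : set T1).
Proof.
have : measurable_fun [set: T1] (fun s : T1 => 16 * s ^+ 2 : R).
  by apply: measurable_funM; [exact: measurable_cst|exact: measurable_funX].
rewrite (_ : height_range T = setT `&` (fun s : T1 => 16 * s ^+ 2 : R) @^-1` [set` `]-oo, T[]); last first.
  by rewrite setTI; apply/seteqP; split => x; rewrite /= in_itv.
by apply => //; exact: measurable_itv.
Qed.

Lemma integrable_height (u : R -> R) : continuous u ->
  leb.-integrable (height_range 1) (EFin \o u).
Proof.
move=> cu; apply: (@integrableS _ _ _ leb [set` `[(-1 : R), 1]]).
- exact: measurable_itv.
- exact: measurable_height_range.
- move=> x; rewrite /height_range/= => x1; rewrite in_itv/= -ler_norml.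
  rewrite -(ler_pXn2r (n := 2)) ?nnegrE// real_normK ?num_real// expr1n.
  by have := sqr_ge0 x; lra.
- apply: continuous_compact_integrable; first exact: segment_compact.
  exact: continuous_subspaceT.
Qed.

Lemma height_momentE n : (\int[leb]_(s in height_range 1) (rad2 1 s ^+ n)%:E = (height_moment n)%:E)%E.
Proof.
rewrite /height_moment /Rintegral fineK//; apply: integrable_fin_num.
  exact: measurable_height_range.
apply: (@integrable_height (fun s => rad2 1 s ^+ n)) => s.
apply: (@continuous_comp _ _ _ (rad2 1) (fun x => x ^+ n)); first exact: continuous_rad2.
exact: exprn_continuous.
Qed.

Let integral_height_momentZ k n : (0 <= k)%R ->
  (\int[leb]_(s in height_range 1) (k * rad2 1 s ^+ n)%:E = (k * height_moment n)%:E)%E.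
Proof.
move=> k0; under eq_integral do rewrite EFinM.
rewrite ge0_integralZl_EFin; last 4 first.
- exact: measurable_height_range.
- by move=> s _; rewrite lee_fin exprn_ge0// sqrtr_ge0.
- apply/measurable_EFinP; apply: measurable_funTS; apply: measurable_funX; exact: measurable_rad2.
- exact: k0.
by rewrite height_momentE -EFinM.
Qed.

Lemma unit_vol_moment : unit_vol R = disc_const * height_moment 1.
Proof.
have D0 := ltW disc_const_gt0.
have := @integral_unit_ball_slices (fun=> 1) (fun w => disc_const * w) (measurable_cst _)
  (fun _ _ => ler01) (mulr0 _).
rewrite integral_cst; last exact: measurable_gauge_ball4.
rewrite mul1e leb3_gauge_ball4// mul1r => H.
apply: EFin_inj; rewrite H => [|w w0]; last first.
  by rewrite integral_cst; [rewrite mul1e -[LHS]/(@leb2 R (disc w)) leb2_disc|exact: measurable_disc].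
by rewrite -integral_height_momentZ//; apply: eq_integral => s _; rewrite expr1.
Qed.

Lemma planar_moment :
  \int[vol]_(g in gauge_ball4 1) planar_sq g = disc_const / 2 * height_moment 2.
Proof.
have D0 : 0 <= disc_const / 2 by rewrite divr_ge0// ltW// disc_const_gt0.
rewrite /Rintegral (@integral_unit_ball_slices id (fun w => disc_const / 2 * w ^+ 2))//.
- by rewrite integral_height_momentZ.
- by rewrite expr0n mulr0.
- exact: integral_disc_sq.
Qed.

Lemma integrable_unit_ball (u : T3 -> R) (K : R) : measurable_fun setT u ->
  (forall g, gauge4 g < 1 -> `|u g| <= K) -> vol.-integrable (gauge_ball4 1) (EFin \o u).
Proof.
move=> mu uK; have mB := @measurable_gauge_ball4 R 1.
apply/integrableP; split; first by apply/measurable_EFinP; exact: measurable_funTS.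
apply: (@le_lt_trans _ _ (\int[vol]_(k in gauge_ball4 1) (cst K%:E k))%E).
  apply: ge0_le_integral => //.
  - by apply: measurableT_comp => //; apply/measurable_EFinP; exact: measurable_funTS.
by rewrite integral_cst// leb3_gauge_ball4// -EFinM ltry.
Qed.

(** The part of [|grad_H f|^2] of degree 4 under dilations; the parts of degree 0 and 2 are [1] and
    [- 6 |z|^2]. *)
Let quartic (g : T3) : R := 9 * planar_sq g ^+ 2 + (6 * g.2 + 3 * (g.1.1 * g.1.2)) ^+ 2.

Definition quartic_moment : R := \int[vol]_(g in gauge_ball4 1) quartic g.

Let density (g : T3) : R := (1 - 3 * planar_sq g) ^+ 2 + (6 * g.2 + 3 * (g.1.1 * g.1.2)) ^+ 2.

Let measurable_cross : measurable_fun setT (fun g : T3 => (6 * g.2 + 3 * (g.1.1 * g.1.2)) ^+ 2 : R).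
Proof.
have mx := @measurable_heis_x R; have my := @measurable_heis_y R; have ms := @measurable_heis_s R.
apply: measurable_funX; apply: measurable_funD.
  by apply: measurable_funM; [exact: measurable_cst|exact: ms].
by apply: measurable_funM; [exact: measurable_cst|exact: (measurable_funM mx my)].
Qed.

Let fineMl (a : R) (x : \bar R) : 0 < a -> fine (a%:E * x)%E = a * fine x.
Proof.
move=> a0; case: x => [x| |]; first by [].
  by rewrite mulry gtr0_sg// mul1e /= mulr0.
by rewrite mulrNy gtr0_sg// mul1e /= mulr0.
Qed.

(** Dilating to the unit ball, with Jacobian [tau^4], sorts the density by degree; [- 6 tau^2] times
    the integral of [|z|^2] gives the coefficient [- 3 disc_const W_2]. *)
Lemma energy_cubic tau : 0 < tau ->
  \int[vol]_(g in gauge_ball4 (tau ^+ 4)) (horizontal_grad_norm (@cubic_harmonic R) g ^+ 2) =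
  tau ^+ 4 * (disc_const * height_moment 1 - 3 * disc_const * height_moment 2 * tau ^+ 2 +
    quartic_moment * tau ^+ 4).
Proof.
move=> t0; have mB := @measurable_gauge_ball4 R 1.
rewrite (@eq_Rintegral _ _ _ vol _ density); last by move=> g _; exact: horizontal_grad_norm_cubic.
have mz := @measurable_planar_sq R.
have md : measurable_fun setT density.
  apply: measurable_funD; last exact: measurable_cross.
  apply: measurable_funX; apply: measurable_funB; first exact: measurable_cst.
  by apply: measurable_funM; [exact: measurable_cst|exact: mz].
have d0 g : 0 <= density g by rewrite addr_ge0 ?sqr_ge0.
pose dil := @shear R tau tau (tau ^+ 2) 0 0 (cst 0).
have t20 : 0 < tau ^+ 2 by rewrite exprn_gt0.
have dilE g : density (dil g) = 1 - 6 * tau ^+ 2 * planar_sq g + tau ^+ 4 * quartic g.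
  by rewrite /density /dil /shear /quartic /planar_sq/=; ring.
have gE g : gauge4 (dil g) = tau ^+ 4 * gauge4 g by rewrite /dil /shear /gauge4 /planar_sq/=; ring.
have -> : \int[vol]_(g in gauge_ball4 (tau ^+ 4)) density g =
  tau ^+ 4 * \int[vol]_(g in gauge_ball4 1) density (dil g).
  rewrite /Rintegral -[tau ^+ 4 in RHS]/(fine (tau ^+ 4)%:E) [in LHS]integral_mkcond.
  rewrite (@ge0_integral_shear R tau tau (tau ^+ 2) 0 0 (cst 0))//; last 2 first.
  - apply/(measurable_restrictT _ (@measurable_gauge_ball4 R _)); apply: measurable_funTS.
    exact/measurable_EFinP.
  - by move=> g; rewrite /patch; case: ifP => // _; rewrite lee_fin.
  rewrite (_ : tau * tau * tau ^+ 2 = tau ^+ 4); last by ring.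
  rewrite [in RHS]integral_mkcond.
  set I := (\int[vol]_g _)%E; set J := (\int[vol]_g _)%E.
  have <- : I = J.
    apply: eq_integral => g _; rewrite /patch -/(dil g).
    have -> // : (dil g \in (gauge_ball4 (tau ^+ 4) : set T3)) = (g \in (gauge_ball4 1 : set T3)).
    by apply/idP/idP; rewrite !in_setE /gauge_ball4/= gE gtr_pMr ?exprn_gt0.
  by apply: (@fineMl (tau ^+ 4)); exact: exprn_gt0.
congr (_ * _).
have mq : measurable_fun setT quartic.
  apply: measurable_funD; last exact: measurable_cross.
  by apply: measurable_funM; [exact: measurable_cst|exact: (measurable_funX 2 mz)].
(* On the unit ball all coordinates are at most 1 in absolute value, so [|z|^2 <= 2] and
   [|6 sigma + 3 x y| <= 9], whence [117 = 9 * 4 + 81]. *)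
have b1 (g : T3) : gauge4 g < 1 -> `|planar_sq g| <= 2 /\ `|quartic g| <= 117.
  move=> g1; have := @gauge_ball4_coord R 1 g ler01; rewrite !expr1n => /(_ g1)[x1 y1 s1].
  have sq (z : R) : `|z| <= 1 -> z ^+ 2 <= 1.
    by move=> z1; rewrite -real_normK ?num_real// expr_le1.
  have z2 : planar_sq g <= 2 by rewrite /planar_sq; have := sq _ x1; have := sq _ y1; lra.
  have z0 := planar_sq_ge0 g.
  split; first by rewrite ger0_norm.
  rewrite ger0_norm; last by apply: addr_ge0; [apply: mulr_ge0 => //; exact: sqr_ge0|exact: sqr_ge0].
  have zz4 : planar_sq g ^+ 2 <= 4 by have := ler_pM z0 z0 z2 z2; rewrite -expr2; lra.
  have c9 : `|6 * g.2 + 3 * (g.1.1 * g.1.2)| <= 9.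
    apply: le_trans (ler_normD _ _) _; rewrite !normrM !normr_nat.
    have xy : `|g.1.1| * `|g.1.2| <= 1 by apply: mulr_ile1.
    by lra.
  have c81 : (6 * g.2 + 3 * (g.1.1 * g.1.2)) ^+ 2 <= 81.
    rewrite -real_normK ?num_real//; have := ler_pM (normr_ge0 _) (normr_ge0 _) c9 c9.
    by rewrite -expr2; lra.
  by rewrite /quartic; lra.
have iz := integrable_unit_ball mz (fun g g1 => (b1 g g1).1).
have iq := integrable_unit_ball mq (fun g g1 => (b1 g g1).2).
have i1 : vol.-integrable (gauge_ball4 1) (EFin \o (fun _ : T3 => 1 : R)).
  by apply: (@integrable_unit_ball _ 1) => // g _; rewrite normr1.
have izk : vol.-integrable (gauge_ball4 1) (EFin \o (fun g => 6 * tau ^+ 2 * planar_sq g)).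
  rewrite (_ : _ \o _ = (fun g => (6 * tau ^+ 2)%:E * (EFin \o @planar_sq R) g)%E); last exact/funext.
  exact: integrableZl.
have iqk : vol.-integrable (gauge_ball4 1) (EFin \o (fun g => tau ^+ 4 * quartic g)).
  rewrite (_ : _ \o _ = (fun g => (tau ^+ 4)%:E * (EFin \o quartic) g)%E); last exact/funext.
  exact: integrableZl.
have i1z : vol.-integrable (gauge_ball4 1) (EFin \o (fun g => 1 - 6 * tau ^+ 2 * planar_sq g)).
  rewrite (_ : _ \o _ = (EFin \o (fun _ : T3 => 1%R)) \- (EFin \o (fun g => (6 * tau ^+ 2 * planar_sq g)%R)))%E; last exact/funext.
  exact: integrableB.
rewrite (@eq_Rintegral _ _ _ vol _ (fun g => (1 - 6 * tau ^+ 2 * planar_sq g) + tau ^+ 4 * quartic g)); last first.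
  by move=> g _; exact: dilE.
rewrite RintegralD// RintegralB// !RintegralZl// planar_moment Rintegral_cst//.
rewrite -/quartic_moment -/(unit_vol R) unit_vol_moment.
by field.
Qed.

End slices.

(** * The frequency *)

Section frequency.
Variable R : realType.
Local Notation T1 := (measurableTypeR R).
Local Notation Tc := (caratheodory_type (@hausdorff2_outer R)).
Local Notation leb := (@lebesgue_measure R).
Local Notation W := (@height_moment R).
Local Notation f := (@cubic_harmonic R).
Implicit Types (s t tau lam : R).

(** For [|s| <= 1/8] one has [16 s^2 <= 1/4], so [rad2 1 s] is at least [1/2] on an interval of
    positive length. *)
Lemma height_moment_gt0 n : 0 < W n.
Proof.
pose J : set T1 := [set` `[- 8^-1, 8^-1]].
have mJ : measurable J by exact: measurable_itv.
have r2 s : J s -> 2^-1 <= rad2 1 s.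
  rewrite /J/= in_itv/= -ler_norml => s8.
  have s64 : s ^+ 2 <= 64^-1.
    have := ler_pM (normr_ge0 _) (normr_ge0 _) s8 s8.
    by rewrite -expr2 real_normK ?num_real// -invfM -natrM.
  have h0 : 0 <= 2^-1 :> R by rewrite invr_ge0.
  rewrite /rad2 -(ger0_norm h0) -sqrtr_sqr; apply: ler_wsqrtr; lra.
rewrite -lte_fin -height_momentE.
apply: (@lt_le_trans _ _ (\int[leb]_(s in J) (cst (2^-1 ^+ n)%:E s))%E).
  have lJ : leb J = (8^-1 + 8^-1)%:E.
    by rewrite lebesgue_measure_itv/= lte_fin gtrN ?invr_gt0// -EFinB opprK.
  have -> : (\int[leb]_(s in J) (cst (2^-1 ^+ n)%:E s) = (2^-1 ^+ n)%:E * leb J)%E by exact: integral_cst.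
  by rewrite lJ -EFinM lte_fin mulr_gt0 ?exprn_gt0 ?invr_gt0// addr_gt0// invr_gt0.
have mr : measurable_fun [set: T1] (fun s => (rad2 1 s ^+ n)%:E).
  by apply/measurable_EFinP; apply: measurable_funX; exact: measurable_rad2.
apply: (@le_trans _ _ (\int[leb]_(s in J) (rad2 1 s ^+ n)%:E)%E).
  apply: ge0_le_integral => //.
  - by move=> s _; rewrite lee_fin exprn_ge0// invr_ge0.
  - exact: measurable_funTS.
  - by move=> s /r2 rs; rewrite lee_fin lerXn2r// nnegrE ?invr_ge0// sqrtr_ge0.
apply: ge0_subset_integral => //.
- exact: measurable_height_range.
- exact: measurable_funTS.
- by move=> s _; rewrite lee_fin exprn_ge0// sqrtr_ge0.
- move=> s; rewrite /J/= in_itv/= -ler_norml => s8; rewrite /height_range/=.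
  have := ler_pM (normr_ge0 _) (normr_ge0 _) s8 s8.
  by rewrite -expr2 real_normK ?num_real// -invfM -natrM; lra.
Qed.

(** The terms of [circle_mean] of degree 6 under dilations, where both [w] and [s] count as degree
    2. *)
Let sextic s : R := 18 * rad2 1 s * s ^+ 2 + 5 / 16 * rad2 1 s ^+ 3.

Definition sextic_moment : R := \int[leb]_(s in height_range 1) sextic s.

Let cM (u v : R -> R) : continuous u -> continuous v -> continuous (fun s => u s * v s).
Proof. by move=> cu cv s; apply: cvgM; [exact: cu|exact: cv]. Qed.

Let ck (k : R) : continuous (fun _ : R => k). Proof. by move=> s; exact: cvg_cst. Qed.

Let cr n : continuous (fun s => rad2 (1 : R) s ^+ n).
Proof.
move=> s; apply: (@continuous_comp _ _ _ (rad2 1) (fun x => x ^+ n)); first exact: continuous_rad2.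
exact: exprn_continuous.
Qed.

Let continuous_sextic : continuous sextic.
Proof.
have c1 : continuous (rad2 (1 : R)) by exact: continuous_rad2.
have c2 : continuous (fun s : R => s ^+ 2) by exact: exprn_continuous.
move=> s; apply: cvgD; last by apply: (@cM (fun=> 5 / 16) (fun s => rad2 1 s ^+ 3)).
by apply: (@cM (fun s => 18 * rad2 1 s) (fun s => s ^+ 2)) => //; exact: (@cM (fun=> 18) (rad2 1)).
Qed.

(** The substitution [s -> tau^2 s] gives one factor [tau^2] from the length and another from the
    lowest term of [circle_mean]. *)
Lemma integral_circle_mean tau : 0 < tau ->
  (\int[leb]_(s in height_range (tau ^+ 4)) (circle_mean (rad2 (tau ^+ 4) s) s)%:E =
   (tau ^+ 4 * (W 1 / 2 - 3 / 4 * W 2 * tau ^+ 2 + sextic_moment * tau ^+ 4))%:E)%E.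
Proof.
move=> t0; have t2 : 0 < tau ^+ 2 by rewrite exprn_gt0.
have t4 : 0 < tau ^+ 4 by rewrite exprn_gt0.
have mH := @measurable_height_range R.
have mc : measurable_fun [set: T1] (fun s => circle_mean (rad2 (tau ^+ 4) s) s).
  by apply: continuous_measurable_fun; exact: continuous_circle_mean.
have rE s : rad2 (tau ^+ 4) (tau ^+ 2 * s) = tau ^+ 2 * rad2 1 s.
  rewrite /rad2 (_ : _ - _ = (tau ^+ 2) ^+ 2 * (1 - 16 * s ^+ 2)); last by ring.
  by rewrite sqrtrM ?sqr_ge0// sqrtr_sqr ger0_norm// ltW.
pose q s := 1 / 2 * rad2 1 s ^+ 1 - 3 / 4 * tau ^+ 2 * rad2 1 s ^+ 2 + tau ^+ 4 * sextic s.
have cE s : circle_mean (rad2 (tau ^+ 4) (tau ^+ 2 * s)) (tau ^+ 2 * s) = tau ^+ 2 * q s.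
  by rewrite rE /circle_mean /q /sextic; field.
have q0 s : 0 <= q s.
  by rewrite -(pmulr_rge0 _ t2) -cE circle_mean_ge0// sqrtr_ge0.
rewrite integral_mkcond (@ge0_integral_affine R (tau ^+ 2) 0)//; last 2 first.
- by apply/(measurable_restrictT _ (mH _)); apply: measurable_funTS; exact/measurable_EFinP.
- by move=> s; rewrite /patch; case: ifP => // _; rewrite lee_fin circle_mean_ge0// sqrtr_ge0.
set I := (\int[leb]_s _)%E.
have -> : I = (\int[leb]_(s in height_range 1) ((tau ^+ 2)%:E * (q s)%:E))%E.
  rewrite [RHS]integral_mkcond; apply: eq_integral => s _; rewrite /patch addr0 cE.
  have -> // : (tau ^+ 2 * s \in (height_range (tau ^+ 4) : set T1)) = (s \in (height_range 1 : set T1)).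
  have E : 16 * (tau ^+ 2 * s) ^+ 2 = tau ^+ 4 * (16 * s ^+ 2) by ring.
  by apply/idP/idP; rewrite !in_setE /height_range/= E gtr_pMr.
have c1 : continuous (fun s => 1 / 2 * rad2 1 s ^+ 1) by exact: (@cM (fun=> 1 / 2) (fun s => rad2 1 s ^+ 1)).
have c2 : continuous (fun s => 3 / 4 * tau ^+ 2 * rad2 1 s ^+ 2).
  exact: (@cM (fun=> 3 / 4 * tau ^+ 2) (fun s => rad2 1 s ^+ 2)).
have c3 : continuous (fun s => tau ^+ 4 * sextic s) by exact: (@cM (fun=> tau ^+ 4) sextic).
have c12 : continuous (fun s => 1 / 2 * rad2 1 s ^+ 1 - 3 / 4 * tau ^+ 2 * rad2 1 s ^+ 2).
  by move=> s; apply: cvgB; [exact: c1|exact: c2].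
have cq : continuous q by move=> s; apply: cvgD; [exact: c12|exact: c3].
rewrite ge0_integralZl_EFin; last 4 first.
- exact: mH.
- by move=> s _; rewrite lee_fin.
- by apply/measurable_EFinP; apply: measurable_funTS; exact: continuous_measurable_fun.
- exact: ltW.
have iq := integrable_height cq.
have -> : (\int[leb]_(s in height_range 1) (q s)%:E = (\int[leb]_(s in height_range 1) q s)%:E)%E.
  by rewrite fineK//; apply: integrable_fin_num.
rewrite -!EFinM mulrA -exprD; congr (_ * _)%:E.
rewrite (RintegralD (mH 1) (integrable_height c12) (integrable_height c3)).
rewrite (RintegralB (mH 1) (integrable_height c1) (integrable_height c2)).
rewrite (RintegralZl _ (mH 1) (integrable_height (@cr 1))).
rewrite (RintegralZl _ (mH 1) (integrable_height (@cr 2))).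
rewrite (RintegralZl _ (mH 1) (integrable_height continuous_sextic)).
by rewrite -/(W 1) -/(W 2) -/sextic_moment; field.
Qed.

Lemma perimeter_integral_koranyi lam tau : 0 < lam -> 0 < tau ->
  perimeter_integral (koranyi lam) (lam * tau) (fun g => f g ^+ 2 * horizontal_grad_norm (koranyi lam) g) =
  lam * tau * tau ^+ 4 * (cylinder_const R *
    (W 1 / 2 - 3 / 4 * W 2 * tau ^+ 2 + sextic_moment * tau ^+ 4)).
Proof.
move=> l0 t0; have t4 : 0 < tau ^+ 4 by rewrite exprn_gt0.
have lt0 : 0 < lam * tau by rewrite mulr_gt0.
rewrite /perimeter_integral gauge_sphere_koranyi// /Rintegral.
set I := (\int[_]_(_ in _) _)%E.
suff -> : I = ((lam * tau)%:E * ((cylinder_const R)%:E * (tau ^+ 4 * (W 1 / 2 - 3 / 4 * W 2 * tau ^+ 2 + sextic_moment * tau ^+ 4))%:E))%E.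
  by rewrite -!EFinM/=; ring.
rewrite -integral_circle_mean// -perimeter_cubic//.
have [mx my ms] := @measurable_coordinates R.
rewrite -ge0_integralZl_EFin; last 4 first.
- exact: measurable_punctured_sphere.
- by move=> p _; rewrite lee_fin; apply: mulr_ge0; [exact: sqr_ge0|exact: area_weight_ge0].
- apply/measurable_EFinP; apply: measurable_funTS.
  exact: (measurable_funM (measurable_funX 2 (@measurable_cubic_harmonic R : measurable_fun [set: Tc] (f : Tc -> R))) (measurableT_comp (measurable_area_weight _) ms)).
- exact: ltW.
rewrite /I integral_mkcond [RHS]integral_mkcond; apply: eq_integral => p _; rewrite /patch.
have [pT|pT] := pselect (gauge4 p = tau ^+ 4); last first.
  by rewrite !memNset//= => -[].
rewrite mem_set// -mulrA (perimeter_weight l0 t0 pT).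
(* At the two poles [rad2] is 0 and the weight vanishes, so the integrals over the full and the
   punctured sphere agree. *)
have [ps|ps] := ltP (16 * p.2 ^+ 2) (tau ^+ 4).
  by rewrite mem_set// -EFinM; congr _%:E; ring.
rewrite memNset; last by move=> [_] /=; rewrite ltNge ps.
by rewrite /area_weight /rad2 ler0_sqrtr ?subr_le0// mul0r !mulr0.
Qed.

(** Both integrals carry [tau^4], and the radius cancels against the factor [lam * tau] of the
    perimeter. [cylinder_const] is kept as a separate divisor: its inverse is nonnegative in every
    case, the inverse of 0 being 0. *)
Lemma frequency_koranyi lam tau : 0 < lam -> 0 < tau ->
  frequency (koranyi lam) f (lam * tau) =
  (disc_const R * W 1 - 3 * disc_const R * W 2 * tau ^+ 2 + quartic_moment R * (tau ^+ 2) ^+ 2) /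
  (W 1 / 2 - 3 / 4 * W 2 * tau ^+ 2 + sextic_moment * (tau ^+ 2) ^+ 2) / cylinder_const R.
Proof.
move=> l0 t0; rewrite /frequency gauge_ball_koranyi ?(ltW t0)// energy_cubic// perimeter_integral_koranyi//.
rewrite -exprM; set P := _ + quartic_moment R * _; set Q := _ + sextic_moment * _.
rewrite (mulrA (lam * tau)) -mulf_div divff ?mul1r; first by rewrite invfM; ring.
by rewrite mulf_neq0 ?mulf_neq0 ?expf_neq0// gt_eqF.
Qed.

(** After cross multiplication the difference is [t - s] times [d] minus terms of first order in [s]
    and [t], where [d = p0 q1 - p1 q0 > 0] is minus the numerator of the derivative at 0. *)
Lemma quadratic_ratio_nonincreasing (p0 p1 p2 q0 q1 q2 : R) : 0 < q0 -> p1 * q0 < p0 * q1 ->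
  exists2 t0, 0 < t0 & forall s t, 0 <= s -> s <= t -> t < t0 ->
    (p0 + p1 * t + p2 * t ^+ 2) / (q0 + q1 * t + q2 * t ^+ 2) <=
    (p0 + p1 * s + p2 * s ^+ 2) / (q0 + q1 * s + q2 * s ^+ 2).
Proof.
move=> q00 pq; pose d := p0 * q1 - p1 * q0; have d0 : 0 < d by rewrite subr_gt0.
pose a := `|p2 * q0 - p0 * q2|; pose b := `|p2 * q1 - p1 * q2|.
have a0 : 0 <= a := normr_ge0 _; have b0 : 0 <= b := normr_ge0 _.
have A0 : 0 < 2 * a + b + 1 by rewrite ltr_wpDl// addr_ge0// mulr_ge0.
have Q0 : 0 < `|q1| + `|q2| + 1 by rewrite ltr_wpDl// addr_ge0.
(* The three bounds make squares smaller than first powers, keep the denominators positive, and keep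
   the terms of first order below [d]. *)
exists (Num.min 1 (Num.min (q0 / (`|q1| + `|q2| + 1)) (d / (2 * a + b + 1)))).
  by rewrite !lt_min ltr01 !divr_gt0.
move=> s t s0 st; rewrite !lt_min !ltr_pdivlMr// => /and3P[t1 tq ta].
have t0 : 0 <= t := le_trans s0 st.
have den (x : R) : 0 <= x -> x <= t -> 0 < q0 + q1 * x + q2 * x ^+ 2.
  move=> x0 xt; have x1 : x <= 1 by lra.
  have h1 : - (`|q1| * x) <= q1 * x by rewrite -mulNr ler_wpM2r// lerNnormlW.
  have h2 : - (`|q2| * x) <= q2 * x ^+ 2.
    apply: (@le_trans _ _ (- (`|q2| * x ^+ 2))); last by rewrite -mulNr ler_wpM2r ?sqr_ge0// lerNnormlW.
    by rewrite lerN2 ler_wpM2l// expr2 ler_piMr.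
  have h3 : x * (`|q1| + `|q2| + 1) <= t * (`|q1| + `|q2| + 1) by rewrite ler_wpM2r// ltW.
  lra.
rewrite ler_pdivrMr ?den// mulrAC ler_pdivlMr ?den// -subr_ge0.
rewrite (_ : _ - _ = (t - s) * (d - ((p2 * q0 - p0 * q2) * (s + t) + (p2 * q1 - p1 * q2) * (s * t)))); last first.
  by rewrite /d; ring.
apply: mulr_ge0; first by rewrite subr_ge0.
have h1 : (p2 * q0 - p0 * q2) * (s + t) <= a * (2 * t).
  apply: (@le_trans _ _ (a * (s + t))); first by rewrite ler_wpM2r ?addr_ge0// ler_norm.
  by rewrite ler_wpM2l//; lra.
have h2 : (p2 * q1 - p1 * q2) * (s * t) <= b * t.
  apply: (@le_trans _ _ (b * (s * t))); first by rewrite ler_wpM2r ?mulr_ge0// ler_norm.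
  by rewrite ler_wpM2l// ler_piMl//; lra.
lra.
Qed.

End frequency.

Theorem mainTheorem5 (R : realType) (Gam : heis R -> R)
    (hGam : positive_fundamental_solution Gam) :
  let f := fun g : heis R => g.1.1 + 6 * g.1.2 * g.2 - g.1.1 ^+ 3 in
  (forall g, sublaplacian f g = 0) /\
  exists2 r0 : R, 0 < r0 &
    forall r s : R, 0 < r -> r <= s -> s < r0 ->
      frequency (pseudo_gauge Gam) f s <= frequency (pseudo_gauge Gam) f r.
Proof.
move=> f; split; first exact: sublaplacian_cubic.
have [lam l0 ->] := pseudo_gauge_koranyi hGam.
have W1 := height_moment_gt0 R 1; have W2 := height_moment_gt0 R 2; have k0 := disc_const_gt0 R.
have q0 : 0 < height_moment R 1 / 2 by rewrite divr_gt0.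
have [|t0 t00 H] := @quadratic_ratio_nonincreasing R (disc_const R * height_moment R 1)
  (- (3 * disc_const R * height_moment R 2)) (quartic_moment R) _ (- (3 / 4 * height_moment R 2))
  (sextic_moment R) q0.
  (* In units of [disc_const * W_1 * W_2] the condition reads [- 3/2 < - 3/4]. *)
  have := mulr_gt0 k0 (mulr_gt0 W1 W2); lra.
(* The variable of the quotient is [t = (r / lam)^2], so [t < t0] means [r < lam * sqrt t0]. *)
exists (lam * Num.sqrt t0); first by rewrite mulr_gt0// sqrtr_gt0.
move=> r s r0 rs sr0.
have s0 : 0 < s := lt_le_trans r0 rs.
have E (x : R) : x = lam * (x / lam) by rewrite mulrC divfK// gt_eqF.
rewrite (E r) (E s) !frequency_koranyi ?divr_gt0//.
rewrite ler_wpM2r ?invr_ge0 ?cylinder_const_ge0//.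
have := H ((r / lam) ^+ 2) ((s / lam) ^+ 2); rewrite !mulNr; apply.
- exact: sqr_ge0.
- by rewrite lerXn2r ?nnegrE ?divr_ge0 ?(ltW r0) ?(ltW s0) ?(ltW l0)// ler_pM2r ?invr_gt0.
- rewrite -[ltRHS]sqr_sqrtr ?(ltW t00)// ltrXn2r ?nnegrE ?divr_ge0 ?sqrtr_ge0 ?(ltW s0) ?(ltW l0)//.
  by rewrite ltr_pdivrMr// mulrC.
Qed.
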